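(* Let $\Omega,X,\Gamma,\boldsymbol q_0,J_X$ be as in the context, and let $\varpi\in C^2(\Omega)$ be strictly positive. For every continuous $\psi:\Omega\to\mathbb C$ put $$Z_z[\psi]:=\int_\Omega\psi(\boldsymbol q)\varpi(\boldsymbol q)\exp\Bigl\{-\frac z2|X(\boldsymbol q)-1|^2\Bigr\}\,d\boldsymbol q,$$ and let $Z_z:=Z_z[1]$. Then, as $z\to\infty$, $$Z_z[\psi]=z^{-1}\left[2\pi\int_\Gamma\frac{\psi(p)\varpi(p)}{J_X(p)}\,d\ell(p)+C_{\mathrm{fold}}\,\psi(\boldsymbol q_0)\varpi(\boldsymbol q_0)+o(1)\right],$$ where $d\ell$ is arclength for the product metric and $$C_{\mathrm{fold}}:=\int_{\mathbb R\times\mathbb R_+^2}\exp\Bigl\{-\tfrac12\bigl[s^2+(u^2+4uv+3v^2)^2\bigr]\Bigr\}\,ds\,du\,dv=\frac\pi4\log3 .$$ Consequently, if $$K_{\mathrm{reg}}:=2\pi\int_\Gamma\frac{\varpi(p)}{J_X(p)}\,d\ell(p),\qquad K_{\mathrm{fold}}:=\frac\pi4\log3\;\varpi(\boldsymbol q_0),$$ then $Z_z=z^{-1}(K_{\mathrm{reg}}+K_{\mathrm{fold}}+o(1))$. Moreover the probability measures $$\Pi_z(d\boldsymbol q)=\frac1{Z_z}\varpi(\boldsymbol q)\exp\Bigl\{-\frac z2|X(\boldsymbol q)-1|^2\Bigr\}d\boldsymbol q\quad\text{on }\Omega$$ converge weakly to the probability measure $\Pi_\infty$ defined by $$\int_\Omega\psi\,d\Pi_\infty=\frac{2\pi\int_\Gamma\frac{\psi(p)\varpi(p)}{J_X(p)}\,d\ell(p)+C_{\mathrm{fold}}\psi(\boldsymbol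 q_0)\varpi(\boldsymbol q_0)}{K_{\mathrm{reg}}+K_{\mathrm{fold}}} .$$ In particular $\Pi_\infty(\{\boldsymbol q_0\})=K_{\mathrm{fold}}/(K_{\mathrm{reg}}+K_{\mathrm{fold}})>0$. For the flat prior $\varpi\equiv1$, $$K_{\mathrm{reg}}=\frac\pi2\log3,\qquad K_{\mathrm{fold}}=\frac\pi4\log3,\qquad \Pi_\infty(\{\boldsymbol q_0\})=\frac13 .$$
   Context: $\mathbb T:=\mathbb R/(2\pi\mathbb Z)$; $\mathbb T^3$ carries its standard flat product metric. $\Omega:=\mathbb T\times[0,\tfrac{3\pi}2]\times[\pi,\tfrac{4\pi}3]\subset\mathbb T^3$ (the intervals being closed arcs). $\boldsymbol q=(q_1,q_2,q_3)$, $d\boldsymbol q=dq_1dq_2dq_3$. With $\mathbb R^2\cong\mathbb C$, the forward-kinematics map of a planar arm with link lengths $2,1,2$ is $$X(\boldsymbol q)=2e^{iq_1}+e^{i(q_1+q_2)}+2e^{i(q_1+q_2+q_3)}\in\mathbb C .$$ $DX(\boldsymbol q)$ is its real $2\times3$ derivative and $J_X(\boldsymbol q):=\sqrt{\det(DX(\boldsymbol q)DX(\boldsymbol q)^{\mathsf T})}$, which is positive on $\Gamma$ below. Put $S(u,v):=2+e^{iu}+2e^{i(u+v)}$. For $u\in[4\pi/3,3\pi/2]$ set $$v_\Gamma(u):=2\pi-2\arctan\Bigl(-\frac3{\tan(u/2)}\Bigr)$$ and let $\vartheta(u)\in\mathbb T$ be the unique angular class with $e^{i\vartheta(u)}S(u,v_\Gamma(u))=1$.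 Then $$\Gamma:=\Bigl\{(\vartheta(u),u,v_\Gamma(u)):\tfrac{4\pi}3\le u\le\tfrac{3\pi}2\Bigr\},\qquad \boldsymbol q_0:=(0,0,\pi).$$ $\mathbb R_+=[0,\infty)$. *)

(* Defs.v *)
From HB Require Import structures.
From mathcomp Require Import all_boot all_order all_algebra.
From mathcomp Require Import all_classical all_reals all_analysis.
From mathcomp Require Import measurable_realfun complex.

Set Implicit Arguments.
Unset Strict Implicit.
Unset Printing Implicit Defensive.

Import Order.TTheory GRing.Theory Num.Theory.
Import numFieldTopology.Exports numFieldNormedType.Exports.

Local Open Scope classical_set_scope.
Local Open Scope complex_scope.
Local Open Scope quotient_scope.
Local Open Scope ring_scope.

(* The norm topology on the complex numbers. *)
HB.instance Definition _ (R : rcfType) := PseudoPointedMetric.copy R[i] R[i]^o.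

Section Circle.
Context (R : realType).

Definition eqmod2pi (x y : R) : bool :=
  `[< exists k : int, x - y = k%:~R * (2 * pi) >].

Lemma eqmod2pi_equiv : equiv_class_of eqmod2pi.
Proof.
split=> [x|x y|y x z].
- by apply/asboolP; exists 0; rewrite subrr mul0r.
- by apply/asboolP/asboolP => -[k kE]; exists (- k);
    rewrite -opprB kE mulrNz mulNr.
- move=> /asboolP[k kE] /asboolP[l lE]; apply/asboolP; exists (k + l).
  by rewrite intrD mulrDl -kE -lE addrA subrK.
Qed.

Canonical eqmod2pi_rel := EquivRelPack eqmod2pi_equiv.

(* R / 2 pi Z with the quotient topology, its Borel sigma-algebra and the
   image of Lebesgue measure on [0, 2 pi[. *)
Definition circle : Type := quotient_topology {eq_quot eqmod2pi_rel}.

HB.instance Definition _ := Quotient.on circle.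
HB.instance Definition _ := Topological.on circle.
HB.instance Definition _ := Pointed.on circle.

Definition ang (x : R) : circle := \pi_circle x.

Lemma ang_continuous : continuous ang.
Proof. exact: (@pi_continuous R {eq_quot eqmod2pi_rel}). Qed.

Lemma ang_eq (x y : R) :
  ang x = ang y <-> exists k : int, x - y = k%:~R * (2 * pi).
Proof.
split; first by move=> /eqquotP/asboolP.
by move=> ?; apply/eqquotP/asboolP.
Qed.

HB.instance Definition _ := @isMeasurable.Build (sigma_display (@open circle))
  circle <<s @open circle >>
  (@sigma_algebra0 _ setT _) (@sigma_algebraC _ _)
  (@sigma_algebra_bigcup _ setT _).

Lemma ang_measurable (A : set circle) :
  measurable A -> measurable (ang @^-1` A).
Proof.
pose G := [set B : set circle | measurable (ang @^-1` B)].
suff : <<s @open circle >> `<=` G by exact.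
apply: smallest_sub.
  split=> [|B mB|F mF]; rewrite /G /=.
  - by rewrite preimage_set0; exact: measurable0.
  - by rewrite setTD preimage_setC; exact: measurableC.
  - by rewrite preimage_bigcup; exact: bigcupT_measurable.
move=> B oB; apply: open_measurable.
by move/continuousP : ang_continuous; exact.
Qed.

Definition circle_measure (A : set circle) : \bar R :=
  lebesgue_measure (ang @^-1` A `&` `[0, 2 * pi[).

Let circle_measure0 : circle_measure set0 = 0%E.
Proof. by rewrite /circle_measure preimage_set0 set0I measure0. Qed.

Let circle_measure_ge0 A : (0 <= circle_measure A)%E.
Proof. exact: measure_ge0. Qed.

Let circle_measure_sigma_additive : semi_sigma_additive circle_measure.
Proof.
move=> F mF tF mUF; rewrite /circle_measure preimage_bigcup setI_bigcupl.
apply: measure_semi_sigma_additive.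
- by move=> n; apply: measurableI => //; exact: ang_measurable.
- apply/trivIsetP => i j _ _ ij.
  rewrite setIACA -preimage_setI.
  by move/trivIsetP : tF => /(_ _ _ _ _ ij) ->//; rewrite preimage_set0 set0I.
- rewrite -setI_bigcupl -preimage_bigcup; apply: measurableI => //.
  exact: ang_measurable.
Qed.

HB.instance Definition _ := isMeasure.Build _ _ _ circle_measure
  circle_measure0 circle_measure_ge0 circle_measure_sigma_additive.

Let circle_measure_fin : fin_num_fun circle_measure.
Proof.
move=> A mA; rewrite ge0_fin_numE//.
apply: (@le_lt_trans _ _ (lebesgue_measure (`[0, 2 * pi[ : set R))).
  apply: le_measure; rewrite ?inE//.
  by apply: measurableI => //; exact: ang_measurable.
by rewrite lebesgue_measure_itv/=; case: ifP => _; rewrite ?ltry.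
Qed.

HB.instance Definition _ := Measure_isFinite.Build _ _ _ circle_measure
  circle_measure_fin.

End Circle.

Arguments circle_measure {R}.
Notation torus3 R := (circle R * circle R * circle R)%type.

Section Torus.
Context (R : realType).

Definition volume3 : set (torus3 R) -> \bar R :=
  ((circle_measure \x circle_measure) \x circle_measure)%E.
HB.instance Definition _ := Measure.on volume3.

Definition proj3 (x : 'rV[R]_3) : torus3 R :=
  (ang (x 0 0), ang (x 0 1), ang (x 0 ord_max)).

Definition lift3 (q : torus3 R) : 'rV[R]_3 :=
  \row_j nth 0 [:: repr q.1.1; repr q.1.2; repr q.2] j.

Lemma lift3K : cancel lift3 proj3.
Proof.
case=> -[a b] c; by rewrite /proj3 /lift3 /ang !mxE/= !reprK.
Qed.

(* Flat Riemannian distance: the distance between the fibres in R. *)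
Definition circle_dist (s t : circle R) : R :=
  inf [set r | exists x y : R, [/\ ang x = s, ang y = t & r = `|x - y|]].

Definition torus3_dist (p q : torus3 R) : R :=
  Num.sqrt (circle_dist p.1.1 q.1.1 ^+ 2 + circle_dist p.1.2 q.1.2 ^+ 2
            + circle_dist p.2 q.2 ^+ 2).

Definition speed (g : R -> torus3 R) (u : R) : R :=
  lim (torus3_dist (g (u + h)) (g u) / `|h| @[h --> 0^']).

(* Integral of f with respect to arclength along the curve g on [a, b]. *)
Definition arc_integral (g : R -> torus3 R) (a b : R) (f : torus3 R -> R) : R :=
  \int[lebesgue_measure]_(u in `[a, b]) (f (g u) * speed g u).

Definition arc_integralC (g : R -> torus3 R) (a b : R)
    (f : torus3 R -> R[i]) : R[i] :=
  arc_integral g a b (fun p => complex.Re (f p))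
  +i* arc_integral g a b (fun p => complex.Im (f p)).

Definition integralC d (T : measurableType d)
    (mu : {measure set T -> \bar R}) (D : set T) (f : T -> R[i]) : R[i] :=
  (\int[mu]_(q in D) complex.Re (f q)) +i* (\int[mu]_(q in D) complex.Im (f q)).

Definition C1_open (O : set 'rV[R]_3) (f : 'rV[R]_3 -> R) :=
  forall (i : 'I_3) x, O x ->
    derivable f x (delta_mx 0 i) /\
    {for x, continuous (fun y => 'D_(delta_mx 0 i) f y)}.

Definition C2_open (O : set 'rV[R]_3) (f : 'rV[R]_3 -> R) :=
  C1_open O f /\
  forall i : 'I_3, C1_open O (fun y => 'D_(delta_mx 0 i) f y).

(* f is C^2 on D when it extends to a C^2 function on an open set containing D. *)
Definition C2 (D : set (torus3 R)) (f : torus3 R -> R) :=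
  exists (U : set (torus3 R)) (g : torus3 R -> R),
    [/\ open U, D `<=` U, {in D, f =1 g} & C2_open (proj3 @^-1` U) (g \o proj3)].

(* Measures on D are represented as measures on the torus giving full mass
   to D; test functions need only be defined and continuous on D. *)
Definition weak_cvg (D : set (torus3 R))
    (P : R -> probability (torus3 R) R) (Q : probability (torus3 R) R) :=
  forall f : torus3 R -> R, {within D, continuous f} ->
    (exists M, forall q, D q -> `|f q| <= M) ->
    \int[P z]_(q in D) f q @[z --> +oo] --> \int[Q]_(q in D) f q.

End Torus.

Section Arm.
Context (R : realType).

Definition expi (x : R) : R[i] := cos x +i* sin x.

Definition S_arm (u v : R) : R[i] := 2 + expi u + 2 * expi (u + v).

(* X does not depend on the chosen representatives, see X_proj3. *)
Definition X (q : torus3 R) : R[i] :=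
  let q1 := repr q.1.1 in let q2 := repr q.1.2 in let q3 := repr q.2 in
  2 * expi q1 + expi (q1 + q2) + 2 * expi (q1 + q2 + q3).

Lemma expiDk (x : R) (k : int) : expi (x + k%:~R * (2 * pi)) = expi x.
Proof.
have expiDn y (n : nat) : expi (y + n%:R * (2 * pi)) = expi y.
  rewrite mulr_natl [2 * pi]mulr_natl /expi.
  by rewrite (periodicn (@cosD2pi R)) (periodicn (@sinD2pi R)).
case: (intP k) => [|n|n]; first by rewrite mul0r addr0.
- exact: expiDn.
- by rewrite -[LHS](expiDn _ n.+1) -addrA -mulrDl mulrNz addNr mul0r addr0.
Qed.

Lemma X_proj3 (x : 'rV[R]_3) :
  X (proj3 x) = 2 * expi (x 0 0) + expi (x 0 0 + x 0 1)
                + 2 * expi (x 0 0 + x 0 1 + x 0 ord_max).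
Proof.
have reprE (y : R) : exists k : int, repr (ang y) = y + k%:~R * (2 * pi).
  have /ang_eq[k kE] : ang (repr (ang y)) = ang y by rewrite /ang reprK.
  by exists k; rewrite -kE subrKC.
rewrite /X /=; have [k ->] := reprE (x 0 0); have [l ->] := reprE (x 0 1).
have [m ->] := reprE (x 0 ord_max).
rewrite expiDk addrACA -mulrDl -intrD expiDk addrACA -mulrDl -intrD.
by rewrite expiDk.
Qed.

Definition Omega : set (torus3 R) :=
  [set q | (@ang R @` `[0, 3 * pi / 2]) q.1.2 /\
           (@ang R @` `[pi, 4 * pi / 3]) q.2].

Definition X_coord (x : 'rV[R]_3) : 'rV[R]_2 :=
  let y := X (proj3 x) in \row_j (if j == 0 then complex.Re y else complex.Im y).

(* The library's jacobian acts on row vectors. *)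
Definition DX (q : torus3 R) : 'M[R]_(2, 3) := ('J X_coord (lift3 q))^T.

Definition J_X (q : torus3 R) : R := Num.sqrt (\det (DX q *m (DX q)^T)).

Definition v_Gamma (u : R) : R := 2 * pi - 2 * atan (- (3 / tan (u / 2))).

Definition theta (u : R) : circle R :=
  get [set t : circle R | expi (repr t) * S_arm u (v_Gamma u) = 1].

Definition gamma (u : R) : torus3 R := (theta u, ang u, ang (v_Gamma u)).

Definition Gamma : set (torus3 R) := gamma @` `[4 * pi / 3, 3 * pi / 2].

(* gamma is injective on the parameter interval, so these are the integrals
   over Gamma with respect to arclength. *)
Definition Gamma_integral : (torus3 R -> R) -> R :=
  arc_integral gamma (4 * pi / 3) (3 * pi / 2).

Definition Gamma_integralC : (torus3 R -> R[i]) -> R[i] :=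
  arc_integralC gamma (4 * pi / 3) (3 * pi / 2).

Definition q0 : torus3 R := (ang 0, ang 0, ang pi).

Definition weight (w : torus3 R -> R) (z : R) (q : torus3 R) : R :=
  w q * expR (- (z / 2) * complex.Re (`|X q - 1| ^+ 2)).

Definition Z (w : torus3 R -> R) (z : R) (psi : torus3 R -> R[i]) : R[i] :=
  integralC (@volume3 R) Omega (fun q => psi q * (weight w z q)%:C).

Definition C_fold : R :=
  \int[((lebesgue_measure \x lebesgue_measure) \x lebesgue_measure)%E]_(p in
      [set p : R * R * R | 0 <= p.1.2 /\ 0 <= p.2])
    (let: (s, u, v) := p in
     expR (- 2^-1 * (s ^+ 2 + (u ^+ 2 + 4 * u * v + 3 * v ^+ 2) ^+ 2))).

Definition limit_functional (w : torus3 R -> R) (psi : torus3 R -> R[i]) : R[i] :=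
  (2 * pi)%:C * Gamma_integralC (fun p => psi p * (w p)%:C / (J_X p)%:C)
  + C_fold%:C * psi q0 * (w q0)%:C.

Definition K_reg (w : torus3 R -> R) : R :=
  2 * pi * Gamma_integral (fun p => w p / J_X p).

Definition K_fold (w : torus3 R -> R) : R := pi / 4 * ln 3 * w q0.

Definition is_Pi (w : torus3 R -> R) (z : R) (P : probability (torus3 R) R) :=
  P Omega = 1%E /\
  forall A, measurable A ->
    (fine (P A))%:C =
    (Z w z (fun=> 1))^-1 * (\int[@volume3 R]_(q in Omega `&` A) weight w z q)%:C.

Definition is_Pi_infty (w : torus3 R -> R) (Q : probability (torus3 R) R) :=
  Q Omega = 1%E /\
  forall psi : torus3 R -> R[i], {within Omega, continuous psi} ->
    integralC Q Omega psi
    = limit_functional w psi / (K_reg w + K_fold w)%:C.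

End Arm.

(* Main.v *)
(* Write rho = |S(u, v)|. Integrating out q_1 turns the weight into a multiple of
   exp (- z (rho - 1)^2 / 2) / sqrt z. Since
     rho^2 - 1 = 8 cos((u + v)/2) (3 cos(u/2) cos(v/2) - sin(u/2) sin(v/2)),
   rho = 1 holds on Omega along v = v_Gamma(u), which is crossed transversally
   (d rho / d v = 2 sin u there), and at the corner (u, v) = (0, pi), where both
   factors vanish and rho - 1 is u^2 + 4 u (v - pi) + 3 (v - pi)^2 to leading
   order. For u in [pi, 3 pi / 2] one rescales v - v_Gamma(u) by z^(1/2), for u in
   [0, pi[ one rescales both u and v - pi by z^(1/4); in either case dominated
   convergence applies. The resulting integral over Gamma is the one with respect
   to arclength because the speed of gamma is J_X / (2 |sin u|). The mass of the
   limit at q0 is read off by testing against powers of a function peaked at q0. *)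
From HB Require Import structures.
Require Import Defs.
From mathcomp Require Import all_boot all_order all_algebra.
From mathcomp Require Import all_classical all_reals all_analysis.
From mathcomp Require Import measurable_realfun gauss_integral complex ring lra.

Set Implicit Arguments.
Unset Strict Implicit.
Unset Printing Implicit Defensive.

Import Order.TTheory GRing.Theory Num.Theory.
Import numFieldTopology.Exports numFieldNormedType.Exports.

Local Open Scope classical_set_scope.
Local Open Scope complex_scope.
Local Open Scope ring_scope.

(** Both contributions have order z^-1 because z = a^2 with a = sqrt z: one factor a is spent on the
    Gaussian integral over q_1, the other is the Jacobian of the rescaling, namely a in v alone
    along the curve and sqrt a in each of u and v at the corner. Domination is global: the lower
    bounds for (rho - 1)^2 hold for all u in [0, pi] and for all u in [pi, 3 pi / 2], so neither
    cut-offs nor tubular neighbourhoods occur. The point u = 4 pi / 3, where the curve leaves the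
    box through v = 4 pi / 3, is a null set and is removed; for smaller u >= pi the curve lies above
    the box and contributes nothing. The limits are first proved for nonnegative bounded continuous
    data, with extended real integrals, so that Tonelli applies freely, and along sequences, as
    dominated convergence requires. Signed test functions follow by adding a constant, complex ones
    by components. A test function is continuous on Omega only, so it is pulled back to R^3 by a
    clamped chart. One explicit density in the parameter u describes the curve term of the limit
    functional and also builds the limit measure. *)

Section IntegrationTools.
Context {R : realType}.
Local Notation mu := (@lebesgue_measure R).

(** * Affine substitution and Gaussian integrals *)

Lemma measurable_affine (c d : R) :
  measurable_fun [set: R] (fun x => c * x + d).
Proof. by apply: measurable_funD => //; exact: measurable_funM. Qed.

(** The image of Lebesgue measure under x |-> c x + d, multiplied by c, gives every ]a, b] its
    length, so uniqueness of Lebesgue measure identifies the two. *)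
Lemma ge0_integral_affine (c d : R) (f : R -> \bar R) : 0 < c ->
  measurable_fun [set: R] f -> (forall x, (0 <= f x)%E) ->
  (\int[mu]_x f x = c%:E * \int[mu]_x f (c * x + d)%R)%E.
Proof.
move=> c0 mf f0.
pose phi : measurableTypeR R -> measurableTypeR R := fun x => c * x + d.
have mphi : measurable_fun setT phi by exact: measurable_affine.
pose k : {nonneg R} := NngNum (ltW c0).
pose nu0 : {measure set (measurableTypeR R) -> \bar R} := pushforward mu phi.
transitivity (\int[mscale k (nu0 mphi)]_x f x)%E.
  apply: eq_measure_integral => A mA _.
  apply: lebesgue_measure_unique => //= _ [[a b]] _ <-.
  rewrite /mscale/= /pushforward.
  have -> : phi @^-1` `]a, b] = `](a - d) / c, (b - d) / c]%classic.
    apply/seteqP; split=> x; rewrite /= /phi !in_itv/=;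
      by rewrite ltr_pdivrMr// ler_pdivlMr// ltrBlDr lerBrDr [x * c]mulrC.
  rewrite !lebesgue_measure_itv/= !lte_fin ltr_pM2r ?invr_gt0// ltrD2r.
  case: ifPn => ab; last by rewrite mule0.
  by rewrite -EFinD -EFinM; congr EFin; field; rewrite gt_eqF.
rewrite ge0_integral_mscale//= ge0_integral_pushforward//.
Qed.

Lemma gauss_integral_scaled (a : R) : 0 < a ->
  (\int[mu]_x (expR (- (a * x ^+ 2)))%:E = (Num.sqrt (pi / a))%:E)%E.
Proof.
move=> a0; have sa : 0 < Num.sqrt a by rewrite sqrtr_gt0.
have := @integralT_gauss R.
rewrite (@ge0_integral_affine (Num.sqrt a) 0)//; last 2 first.
- by apply/measurable_EFinP; exact: measurable_gauss_fun.
- by move=> x; rewrite lee_fin gauss_fun_ge0.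
under eq_integral => x _.
  rewrite /gauss_fun addr0 exprMn sqr_sqrtr ?ltW//.
  over.
move=> /(congr1 (fun y => (Num.sqrt a)^-1%:E * y)%E).
rewrite muleA -!EFinM mulVf ?gt_eqF// mul1e => ->.
by rewrite sqrtrM ?pi_ge0// sqrtrV ?ltW// mulrC.
Qed.

Lemma measurable_gauss_scaled (a : R) :
  measurable_fun [set: R] (fun x => expR (- (a * x ^+ 2))).
Proof.
apply: measurableT_comp => //; apply: measurableT_comp => //.
by apply: measurable_funM => //; exact: measurable_funX.
Qed.

Lemma integrable_gauss_scaled (a : R) : 0 < a ->
  mu.-integrable setT (fun x => (expR (- (a * x ^+ 2)))%:E).
Proof.
move=> a0; apply/integrableP; split.
  by apply/measurable_EFinP; exact: measurable_gauss_scaled.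
under eq_integral do rewrite gee0_abs ?lee_fin ?expR_ge0//.
by rewrite gauss_integral_scaled// ltry.
Qed.

End IntegrationTools.

(** * Integrals of a periodic function over one period *)

Section PeriodicIntegral.
Context {R : realType}.
Local Notation mu := (@lebesgue_measure R).
Variables (T : R) (f : R -> \bar R).
Hypotheses (T0 : 0 < T) (mf : measurable_fun setT f) (f0 : forall x, (0 <= f x)%E).
Hypothesis fT : forall x, f (x + T) = f x.

Lemma integral_translate_itv (a b d : R) :
  (\int[mu]_(x in `[a, b[) f (x + d)%R = \int[mu]_(x in `[(a + d)%R, (b + d)%R[) f x)%E.
Proof.
rewrite integral_mkcond [RHS]integral_mkcond.

rewrite [RHS](@ge0_integral_affine _ 1 d)//; last 2 first.
- have mD : measurable (`[(a + d)%R, (b + d)%R[ : set R).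
    exact: measurable_itv.
  by apply: (measurable_restrictT f mD).1; exact: measurable_funTS.
- by move=> x; rewrite /patch; case: ifP.
rewrite mul1e; apply: eq_integral => x _.
rewrite /patch !mem_setE !in_itv/= mul1r.
by rewrite lerD2r ltrD2r.
Qed.

Lemma integral_itv_cat (a b c : R) : a <= b -> b <= c ->
  (\int[mu]_(x in `[a, c[) f x =
   \int[mu]_(x in `[a, b[) f x + \int[mu]_(x in `[b, c[) f x)%E.
Proof.
move=> ab bc; rewrite -ge0_integral_setU//.
- by rewrite -itv_bndbnd_setU ?bnd_simp.
- exact: measurable_funS mf.
- apply/disj_setPS => x [/=]; rewrite !in_itv/= => /andP[_ xb] /andP[bx _].
  by move: (lt_le_trans xb bx); rewrite ltxx.
Qed.

Lemma integral_period_shift_nat (n : nat) (a b : R) :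
  (\int[mu]_(x in `[a, b[) f x =
   \int[mu]_(x in `[(a + n%:R * T)%R, (b + n%:R * T)%R[) f x)%E.
Proof.
elim: n => [|n IH]; first by rewrite mul0r !addr0.
rewrite -natr1 mulrDl mul1r !addrA -[RHS]integral_translate_itv IH.
by apply: eq_integral => x _; rewrite fT.

Qed.

Lemma integral_period_window (b : R) :
  (\int[mu]_(x in `[b, (b + T)%R[) f x = \int[mu]_(x in `[0%R, T[) f x)%E.
Proof.
(* A negative [b] is first moved to the right by a multiple of [T] larger than |b|, so that the
   truncated quotient below is available. *)
wlog b0 : b / 0 <= b.
  move=> H; have [/H//|b0] := leP 0 b.
  pose n := Num.bound (`|b| / T).
  have bn : 0 <= b + n%:R * T.
    have := archi_boundP (divr_ge0 (normr_ge0 b) (ltW T0)).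
    rewrite ltr_pdivrMr// -/n; clearbody n.
    rewrite ltr0_norm//; lra.
  rewrite (integral_period_shift_nat n) addrAC.
  exact: H.
pose n := Num.truncn (b / T).
have /andP[nb bn] : n%:R <= b / T < n.+1%:R.
  by rewrite truncn_itv// divr_ge0// ltW.
pose c := b - n%:R * T.
have bE : b = c + n%:R * T by rewrite /c subrK.
have c0 : 0 <= c by rewrite subr_ge0 -ler_pdivlMr.
have cT : c <= T.
  by move: bn; rewrite ltr_pdivrMr// -natr1 mulrDl mul1r /c lerBlDl => /ltW.
clearbody c; transitivity (\int[mu]_(x in `[c, (c + T)%R[) f x)%E.
  by rewrite [RHS](integral_period_shift_nat n) addrAC -bE.
(* With b = c + n T and 0 <= c <= T, the window [c, c + T[ is cut at [T]; its right part is [0, c[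
   translated by one period. *)
rewrite (@integral_itv_cat _ T)//; last by rewrite lerDr.
rewrite [RHS](@integral_itv_cat _ c)// addeC; congr (_ + _)%E.
by rewrite (integral_period_shift_nat 1 0) mul1r add0r.
Qed.

End PeriodicIntegral.

(** * Measures with a density *)

Section Density.
Context d (T : measurableType d) (R : realType) (m : {measure set T -> \bar R}).
Variable h : T -> R.
Hypotheses (mh : measurable_fun setT h) (h0 : forall x, 0 <= h x).

Import HBNNSimple.

Lemma density_measure_exists : exists nu : {measure set T -> \bar R},
  forall A, nu A = (\int[m]_(x in A) (h x)%:E)%E.
Proof.
pose nu (A : set T) := (\int[m]_(x in A) (h x)%:E)%E.
have nu0 : nu set0 = 0%E by rewrite /nu integral_set0.
have nu_ge0 A : (0 <= nu A)%E by apply: integral_ge0 => x _; rewrite lee_fin.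
have nuS : semi_sigma_additive nu.
  move=> F mF tF mUF; rewrite /nu ge0_integral_bigcup//=; last 2 first.
  - by apply/measurable_EFinP; exact: measurable_funTS.
  - by move=> x _; rewrite lee_fin.
  apply: is_cvg_ereal_nneg_natsum_cond => n _ _.
  by apply: integral_ge0 => x _; rewrite lee_fin.
pose nuM := isMeasure.Build _ _ _ nu nu0 nu_ge0 nuS.
pose nuP : {measure set T -> \bar R} := HB.pack nu nuM.
by exists nuP.
Qed.

(** By monotone convergence both sides are limits over increasing simple functions, and for an
    indicator the claim is the hypothesis on [nu]. *)
Lemma ge0_integral_density (nu : {measure set T -> \bar R}) (f : T -> \bar R) :
  (forall A, measurable A -> nu A = \int[m]_(x in A) (h x)%:E)%E ->
  measurable_fun setT f -> (forall x, (0 <= f x)%E) ->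
  (\int[nu]_x f x = \int[m]_x (f x * (h x)%:E))%E.
Proof.
move=> nuE mf f0.
pose f_ := nnsfun_approx measurableT mf.
have f_cvg x : (EFin \o f_ ^~ x) @ \oo --> f x.
  exact: cvg_nnsfun_approx.
transitivity (limn (fun n => \int[nu]_x (f_ n x)%:E))%E.
  rewrite -monotone_convergence//.
  - by apply: eq_integral => y _; apply/esym/cvg_lim => //; exact: f_cvg.
  - by move=> n; exact/measurable_EFinP/measurable_funP.
  - by move=> n y _; rewrite lee_fin.
  - by move=> y _ a b ab; rewrite lee_fin; exact/lefP/nd_nnsfun_approx.
transitivity (limn (fun n => \int[m]_x ((f_ n x)%:E * (h x)%:E)))%E; last first.
  rewrite -monotone_convergence//.
  - apply: eq_integral => y _; apply/cvg_lim => //.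
    by apply: cvgeZr => //; exact: f_cvg.
  - move=> n; apply: emeasurable_funM; first exact/measurable_EFinP/measurable_funP.
    exact/measurable_EFinP.
  - by move=> n y _; rewrite mule_ge0// lee_fin.
  - move=> y _ a b ab; apply: lee_wpmul2r; first by rewrite lee_fin.
    by rewrite lee_fin; exact/lefP/nd_nnsfun_approx.
congr (limn _); apply/funext => n.
under eq_integral do rewrite fimfunE -fsumEFin//.
rewrite ge0_integral_fsum//; last 2 first.
- by move=> r; exact/measurable_EFinP/measurable_funM.
- by move=> r x _; rewrite nnfun_muleindic_ge0.
under [RHS]eq_integral => x _.
  rewrite fimfunE -fsumEFin// ge0_mule_fsuml; last first.
    by move=> r; rewrite EFinM nnfun_muleindic_ge0.
  over.
rewrite [RHS]ge0_integral_fsum//; last 2 first.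
- move=> r; apply: emeasurable_funM; last exact/measurable_EFinP.
  exact/measurable_EFinP/measurable_funM.
- move=> r x _; apply: mule_ge0; last by rewrite lee_fin.
  by rewrite EFinM nnfun_muleindic_ge0.
apply: eq_fsbigr => r /set_mem[t _ ftr].
have r0 : 0 <= r by rewrite -ftr.
rewrite integralZl_indic_nnsfun//; rewrite integral_indic//= setIT nuE//.
under [RHS]eq_integral do rewrite EFinM -muleA.
rewrite ge0_integralZl_EFin//; last 2 first.
- by move=> x _; rewrite mule_ge0// lee_fin.
- by apply: emeasurable_funM; exact/measurable_EFinP.
congr (_ * _)%E; rewrite integral_mkcond; apply: eq_integral => x _.
rewrite patchE indicE; case: ifPn => _; rewrite ?mul1e ?mul0e//.
Qed.

End Density.

(** A countable base of the topology whose members belong to [M]. It serves to show that open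
    subsets of R^3 are measurable for the iterated product sigma-algebra, and thus that continuous
    functions on R^3 are measurable. *)
Definition basis_in (T : topologicalType) (M : set (set T)) :=
  exists2 B : nat -> set T, forall n, M (B n) &
    forall (x : T) (U : set T), nbhs x U -> exists2 n, B n x & B n `<=` U.

Lemma basis_in_open (T : topologicalType) (M : set (set T)) (A : set T) :
  basis_in M -> M set0 -> (forall F : nat -> set T, (forall n, M (F n)) ->
    M (\bigcup_n F n)) ->
  open A -> M A.
Proof.
move=> [B mB BP] M0 MU oA.
have -> : A = \bigcup_n (if `[< B n `<=` A >] then B n else set0).
  apply/seteqP; split => [x Ax|x [n _]]; last first.
    by case: ifPn => // /asboolP BA /BA.
  have [n Bx BA] := BP x A (open_nbhs_nbhs (conj oA Ax)).
  by exists n => //; rewrite ifT//; apply/asboolP.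
by apply: MU => n; case: ifP.
Qed.

Lemma basis_in_prod (T1 T2 : topologicalType) (M1 : set (set T1))
    (M2 : set (set T2)) (M : set (set (T1 * T2))) :
  (forall A B, M1 A -> M2 B -> M (A `*` B)) ->
  basis_in M1 -> basis_in M2 -> basis_in M.
Proof.
move=> MM [B1 mB1 B1P] [B2 mB2 B2P].
(* Pairs of indices are coded by one natural number; numbers that code no pair are sent to (0,
   0). *)
pose dec n : nat * nat := odflt (0, 0)%N (unpickle n).
exists (fun n => B1 (dec n).1 `*` B2 (dec n).2) => [n|[x y] U].
  exact: MM.
move=> [[U1 U2] /= [n1 n2] UU].
have [i B1x BU1] := B1P _ _ n1; have [j B2y BU2] := B2P _ _ n2.
exists (pickle (i, j)); rewrite /dec pickleK/=; first by split.
by move=> [a b] /= [/BU1 ? /BU2 ?]; exact: UU.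
Qed.

Lemma basis_in_R (R : realType) : basis_in (@measurable _ (measurableTypeR R)).
Proof.
pose I (p : rat * rat) : set R := `]ratr p.1, ratr p.2[%classic.
pose dec n : rat * rat := odflt (0, 0) (unpickle n).
exists (fun n => I (dec n)) => [n|x U]; first exact: measurable_itv.
move=> /nbhs_ballP[e /= e0 eU].
have xe : x - e < x by rewrite ltrBlDr ltrDl.
have ex : x < x + e by rewrite ltrDl.
have [p] := rat_in_itvoo xe; rewrite in_itv/= => /andP[ep px].
have [q] := rat_in_itvoo ex; rewrite in_itv/= => /andP[xq qe].
exists (pickle (p, q)); rewrite /dec pickleK /I /= ?in_itv/= ?px//.
move=> y; rewrite /= in_itv/= => /andP[py yq]; apply: eU.
rewrite /ball/= ltr_distlC; apply/andP; split.
- exact: lt_trans ep py.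
- exact: lt_trans yq qe.
Qed.


Section MeasurableR3.
Context {R : realType}.

Lemma basis_in_R3 : basis_in (@measurable _ (R * R * R)%type).
Proof.
apply: (@basis_in_prod _ _ (@measurable _ (R * R)%type) (@measurable _ R)).
- by move=> A B mA mB; exact: measurableX.
- apply: (@basis_in_prod _ _ (@measurable _ R) (@measurable _ R)).
  + by move=> A B mA mB; exact: measurableX.
  + exact: basis_in_R.
  + exact: basis_in_R.
- exact: basis_in_R.
Qed.

Lemma continuous_measurable_R3 (f : R * R * R -> R) :
  continuous f -> measurable_fun [set: R * R * R] f.
Proof.
move=> /continuousP cf; apply: (measurability _ (RGenOpens.measurableE R)).
move=> _ [_ [a [b ->] <-]]; rewrite setTI.
apply: (basis_in_open basis_in_R3) => //.
- by move=> F mF; exact: bigcupT_measurable.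
- exact/cf/interval_open.
Qed.

End MeasurableR3.

(** * Trigonometric inequalities, special values and polar coordinates *)

Lemma pi_neq0 {R : realType} : pi != 0 :> R.
Proof. by rewrite gt_eqF// pi_gt0. Qed.

(* [field] would unfold [pi], so it is generalized first. *)
Ltac field_pi R :=
  let P := fresh in let P0 := fresh in
  move: (@pi_neq0 R); move: (@pi R) => P P0; field; rewrite ?P0 ?andbT //=.

Section Trigonometry.
Context {R : realType}.
Implicit Types x y s u v t p q : R.

(** Jordan's inequality. [g] vanishes at 0 and pi / 2; if it were negative at [y], the mean value
    theorem would give a negative derivative at some x1 < y and a positive one at some x2 > y,
    against the monotonicity of cos. *)
Lemma sin_ge_chord y : 0 <= y <= pi / 2 -> 2 / pi * y <= sin y.
Proof.
move=> /andP[y0 yp]; rewrite leNgt; apply/negP => h.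
have pi0 := @pi_gt0 R.
have y_gt0 : 0 < y.
  rewrite lt_neqAle y0 andbT; apply/eqP => y0E.
  by move: h; rewrite -y0E mulr0 sin0 ltxx.
have y_ltp : y < pi / 2.
  rewrite lt_neqAle yp andbT; apply/eqP => yE; move: h.
  rewrite yE sin_pihalf; suff -> : 2 / pi * (pi / 2) = 1 :> R by rewrite ltxx.
  by field_pi R.
pose g (x : R) := sin x - 2 / pi * x.
have dg x : is_derive x 1 g (cos x - 2 / pi).
  by rewrite /g; apply: is_derive_eq; rewrite /GRing.scale/=; ring.
have cg a b : {within `[a, b], continuous g}.
  apply: continuous_subspaceT => x; apply: differentiable_continuous.
  by apply/derivable1_diffP; exact: (@ex_derive _ _ _ _ _ _ _ (dg x)).
have [x1] := MVT y_gt0 (fun x _ => dg x) (cg _ _).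
rewrite in_itv/= => /andP[x10 x1y]; rewrite /g sin0 mulr0 subr0 => e1.
have [x2] := MVT y_ltp (fun x _ => dg x) (cg _ _).
rewrite in_itv/= => /andP[x2y x2p]; rewrite /g sin_pihalf => e2.
have c1 : cos x1 < 2 / pi.
  rewrite ltNge; apply/negP => c.
  have : 0 <= (cos x1 - 2 / pi) * (y - 0) by apply: mulr_ge0; lra.
  by rewrite -e1; lra.
have c2 : 2 / pi < cos x2.
  rewrite -subr_gt0 -(pmulr_lgt0 _ (x := pi / 2 - y)) ?subr_gt0// -e2.
  have -> : 2 / pi * (pi / 2) = 1 :> R by field_pi R.
  by rewrite subrr sub0r opprB subr_gt0.
have : cos x2 < cos x1.
  by rewrite ltr_cos ?in_itv/=; lra.
by move: c1 c2; lra.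
Qed.

(** The range 2 pi / 3 is what (u + e) / 2 requires for u <= pi and e <= pi / 3. Giving up half of
    Jordan's slope allows going past pi / 2, where sin (pi - y) is bounded instead. *)
Lemma sin_ge_pi y : 0 <= y <= 2 * pi / 3 -> y / pi <= sin y.
Proof.
move=> /andP[y0 yp]; have pi0 := @pi_gt0 R.
have [yp2|yp2] := leP y (pi / 2).
  apply: le_trans (sin_ge_chord _); last by rewrite y0.
  rewrite mulrC; apply: ler_wpM2r => //; rewrite ler_pdivlMr// mulVf ?gt_eqF//; lra.
have -> : sin y = sin (pi - y) by rewrite sinB cospi sinpi; ring.
apply: (@le_trans _ _ (2 / pi * (pi - y))); last by apply: sin_ge_chord; lra.
have -> : 2 / pi * (pi - y) = 2 - 2 * (y / pi) by field_pi R.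
have : y / pi <= 2 / 3 by rewrite ler_pdivrMr//; lra.
lra.
Qed.

Lemma sqr_sin_ge y : `|y| <= pi / 2 -> (2 / pi * y) ^+ 2 <= sin y ^+ 2.
Proof.
move=> yp; have [y0|y0] := leP 0 y.
  rewrite ger0_norm// in yp.
  rewrite ler_pXn2r ?nnegrE ?sin_ge0_pi//.
  - by apply: sin_ge_chord; rewrite y0.
  - by rewrite mulr_ge0// divr_ge0// pi_ge0.
  - rewrite y0/=; have := @pi_gt0 R; lra.
rewrite ltr0_norm// in yp; rewrite -[in sin y](opprK y) sinN sqrrN -(sqrrN (_ * y)) -mulrN.
rewrite ler_pXn2r ?nnegrE ?sin_ge0_pi//.
- by apply: sin_ge_chord; rewrite oppr_ge0 ltW.
- by rewrite mulr_ge0 ?oppr_ge0 ?(ltW y0)// divr_ge0// pi_ge0.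
- have := @pi_gt0 R; lra.
Qed.

Lemma cos_pi3 : cos (pi / 3) = 2^-1 :> R.
Proof.
have pi0 := @pi_gt0 R; set c := cos (pi / 3).
have c0 : 0 < c by apply: cos_gt0_pihalf; lra.
have s2 : sin (pi / 3) ^+ 2 = 1 - c ^+ 2 by exact: sin2cos2.
have : cos (pi / 3 + pi / 3 + pi / 3) = -1 :> R.
  by rewrite -cospi; congr cos; field.
rewrite !(cosD, sinD) -/c; move: s2; set s := sin _ => s2 e.
(* The triple angle formula with cos (3 (pi / 3)) = -1 gives 4 c^3 - 3 c + 1 = 0; positivity of [c]
   selects the root. *)
have : (c + 1) * (2 * c - 1) ^+ 2 = 0.
  transitivity (4 * c ^+ 3 - 3 * c + 1); first by ring.
  transitivity (c * (c ^+ 2 - (1 - c ^+ 2) * 3) + 1); first by ring.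
  rewrite -s2; move: e; lra.
move=> /eqP; rewrite mulf_eq0 (gt_eqF (addr_gt0 _ _))//= expf_eq0/= => /eqP; lra.
Qed.

Lemma sin_pi3 : sin (pi / 3) = Num.sqrt 3 / 2 :> R.
Proof.
have pi0 := @pi_gt0 R.
have s0 : 0 <= sin (pi / 3) :> R by apply: sin_ge0_pi; lra.
apply/eqP; rewrite -(@eqrXn2 _ 2)// ?divr_ge0// ?sqrtr_ge0// sin2cos2 cos_pi3.
by rewrite expr_div_n sqr_sqrtr//; apply/eqP; field.
Qed.

Lemma atan_sqrt3 : atan (Num.sqrt 3) = pi / 3 :> R.
Proof.
have pi0 := @pi_gt0 R.
rewrite -[RHS]tanK; last by rewrite in_itv/=; lra.
by rewrite /tan sin_pi3 cos_pi3; congr atan; field.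
Qed.

Lemma cvgV_pinfty (a : nat -> R) : (forall n, 0 < a n) ->
  a n @[n --> \oo] --> +oo -> (a n)^-1 @[n --> \oo] --> (0 : R).
Proof. by move=> a0 aoo; apply/gtr0_cvgV0 => //; exact: nearW. Qed.

(** This is the derivative of sin at 0. The limit defining it runs over nonzero increments, so t = 0
    is treated apart. *)
Lemma cvg_sin_scaled t (a : nat -> R) : (forall n, 0 < a n) ->
  a n @[n --> \oo] --> +oo -> a n * sin (t / a n) @[n --> \oo] --> t.
Proof.
move=> a0 aoo; have [->|t0] := eqVneq t 0.
  under eq_cvg do rewrite mul0r sin0 mulr0.
  exact: cvg_cst.
have ne n : t / a n != 0 by rewrite mulf_neq0// invr_neq0// gt_eqF.
have sin1 : h^-1 * sin h @[h --> (0 : R)^'] --> (1 : R).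
  have d : h^-1 *: ((@sin R \o shift 0) h%:A - sin 0) @[h --> 0^'] --> 'D_1 (@sin R) 0.
    exact: (@derivable_sin R 0).
  rewrite derive_val cos0 in d; apply: cvg_trans d; apply: near_eq_cvg.
  by apply: nearW => h /=; rewrite [h%:A]mulr1 addr0 sin0 subr0.
have h0 : t / a n @[n --> \oo] --> (0 : R).
  by rewrite -(mulr0 t); apply: cvgMr; exact: cvgV_pinfty.
have u0 : t / a n @[n --> \oo] --> (0 : R)^'.
  move=> A A0.
  have H : \forall n \near \oo, t / a n != 0 -> A (t / a n) := h0 _ A0.
  by change (\forall n \near \oo, A (t / a n)); apply: filterS H => n; apply.
suff : t * ((t / a n)^-1 * sin (t / a n)) @[n --> \oo] --> t * 1.
  rewrite mulr1; apply: cvg_trans; apply: near_eq_cvg; apply: nearW => n /=.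
  by rewrite invf_div mulrA mulrCA mulfV// mulr1.
by apply: cvgMr; exact: (cvg_comp _ _ u0 sin1).
Qed.

(* The distance from [1] to the point of modulus [r] and argument [s]. *)
Lemma sqr_dist1_polar r s : (r * cos s - 1) ^+ 2 + (r * sin s) ^+ 2 =
  (r - 1) ^+ 2 + r * (2 * sin (s / 2)) ^+ 2.
Proof.
have e1 : cos s = 1 - 2 * sin (s / 2) ^+ 2.
  have {1}-> : s = s / 2 + s / 2 by field.
  rewrite cosD; have := cos2Dsin2 (s / 2); lra.
transitivity (r ^+ 2 * (cos s ^+ 2 + sin s ^+ 2) - 2 * r * cos s + 1); first by ring.
by rewrite cos2Dsin2 e1; ring.
Qed.

(** The average of two bounds. One comes from [sqr_dist1_polar]. The other is the distance from 1 to
    the ray of argument [s], which is at least |sin s| for |s| <= pi / 2 and at least 1 beyond.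
    Uniformity in [r] yields a fixed Gaussian in the angle even where [r] is close to 0. *)
Lemma sqr_dist1_polar_ge r s : 0 <= r -> `|s| <= pi ->
  2^-1 * (r - 1) ^+ 2 + 2^-1 * (s / pi) ^+ 2 <=
  (r * cos s - 1) ^+ 2 + (r * sin s) ^+ 2.
Proof.
move=> r0 sp; have pi0 := @pi_gt0 R.
have h1 : (r - 1) ^+ 2 <= (r * cos s - 1) ^+ 2 + (r * sin s) ^+ 2.
  by rewrite sqr_dist1_polar lerDl mulr_ge0// sqr_ge0.
suff h2 : (s / pi) ^+ 2 <= (r * cos s - 1) ^+ 2 + (r * sin s) ^+ 2 by lra.
have cs := cos2Dsin2 s.
have E : (r * cos s - 1) ^+ 2 + (r * sin s) ^+ 2 = r ^+ 2 - 2 * r * cos s + 1.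
  transitivity (r ^+ 2 * (cos s ^+ 2 + sin s ^+ 2) - 2 * r * cos s + 1); first by ring.
  by rewrite cs mulr1.
have [sp2|sp2] := leP `|s| (pi / 2).
  have := sqr_sin_ge sp2.
  have -> : (2 / pi * s) ^+ 2 = 4 * (s / pi) ^+ 2 by ring.
  have := sqr_ge0 (s / pi); have := sqr_ge0 (r - cos s).
  rewrite E; nra.
have c0 : cos s <= 0.
  rewrite -cos_norm -oppr_ge0; have -> : - cos `|s| = cos (pi - `|s|).
    by rewrite cosB cospi sinpi; ring.
  by apply: cos_ge0_pihalf; lra.
have : (s / pi) ^+ 2 <= 1.
  rewrite -(real_normK (num_real _)) exprn_ile1//.
  by rewrite normrM normfV (gtr0_norm pi0) ler_pdivrMr// mul1r.
have := sqr_ge0 r; rewrite E; nra.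
Qed.

(** An argument of p + i q with values in [- pi / 2, 3 pi / 2[. Continuity is used only where p > 0,
    where it equals atan (q / p). *)
Definition polar_arg p q : R :=
  if 0 < p then atan (q / p) else
  if p < 0 then atan (q / p) + pi else
  if 0 <= q then pi / 2 else - (pi / 2).

Lemma sin_atan x : sin (atan x) = x * cos (atan x).
Proof.
have c0 : cos (atan x) != 0.
  by rewrite gt_eqF// cos_gt0_pihalf// atan_gtNpi2 atan_ltpi2.
by rewrite -{2}(atanK x) /tan divfK.
Qed.

Lemma polar_argP p q :
  p = Num.sqrt (p ^+ 2 + q ^+ 2) * cos (polar_arg p q) /\
  q = Num.sqrt (p ^+ 2 + q ^+ 2) * sin (polar_arg p q).
Proof.
have sqE : p != 0 ->
    Num.sqrt (p ^+ 2 + q ^+ 2) = `|p| * Num.sqrt (1 + (q / p) ^+ 2).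
  move=> p0; rewrite -sqrtr_sqr -sqrtrM ?sqr_ge0//; congr Num.sqrt.
  by field.
have sq0 : Num.sqrt (1 + (q / p) ^+ 2) != 0 :> R.
  by rewrite sqrtr_eq0 -ltNge; have := sqr_ge0 (q / p); lra.
rewrite /polar_arg; case: ltgtP => [p0|p0|p0].
- rewrite sqE ?gt_eqF// sin_atan cos_atan gtr0_norm// mulrCA -!mulrA.
  by rewrite (mulfV sq0) ?mulVf// !mulr1; split=> //; field; rewrite gt_eqF.
- rewrite sqE ?lt_eqF// cosDpi sinDpi sin_atan cos_atan ltr0_norm//.
  split; first by field.
  by field; rewrite sq0 lt_eqF.
- rewrite -p0 expr0n/= add0r sqrtr_sqr; case: ifPn => q0.
    by rewrite cos_pihalf sin_pihalf mulr0 mulr1 ger0_norm.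
  rewrite cosN sinN cos_pihalf sin_pihalf mulr0 ltr0_norm ?ltNge//.
  by rewrite mulrNN mulr1.
Qed.

(** * The modulus of S(u, v) and the curve v = v_Gamma(u) *)

Definition arm_re u v : R := 2 + cos u + 2 * cos (u + v).
Definition arm_im u v : R := sin u + 2 * sin (u + v).
Definition arm_sqr u v : R := arm_re u v ^+ 2 + arm_im u v ^+ 2.
(** Where the two cosines do not vanish, its zero set is tan (u / 2) tan (v / 2) = 3, the equation
    that [v_Gamma] solves. *)
Definition branch u v : R :=
  3 * cos (u / 2) * cos (v / 2) - sin (u / 2) * sin (v / 2).

(** Together with [arm_imE] this is S(u, v) = - e^(i v) + 2 L e^(i (u + v) / 2), where L = branch u
    v. It exhibits the two facts used on the curve L = 0: the modulus is 1 and the argument is v -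
    pi. *)
Lemma arm_reE u v :
  arm_re u v = - cos v + 2 * branch u v * cos ((u + v) / 2).
Proof.
rewrite /arm_re /branch.
have -> : (u + v) / 2 = u / 2 + v / 2 by field.
have : u = u / 2 + u / 2 by field.
have : v = v / 2 + v / 2 by field.
move: (u / 2) (v / 2) => x y -> ->.
have e1 := sin2cos2 x; have e2 := sin2cos2 y.
rewrite !(cosD, sinD).
move: e1 e2; set a := cos x; set b := sin x.
set c := cos y; set d := sin y => e1 e2.
(* The identity is polynomial in the half-angle values; these products eliminate the squared sines,
   and what remains is linear. *)
have h1 : b ^+ 2 * d ^+ 2 = (1 - a ^+ 2) * (1 - c ^+ 2) by rewrite e1 e2.
have h2 : a ^+ 2 * d ^+ 2 = a ^+ 2 * (1 - c ^+ 2) by rewrite e2.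
have h3 : c ^+ 2 * b ^+ 2 = c ^+ 2 * (1 - a ^+ 2) by rewrite e1.
lra.
Qed.

Lemma arm_imE u v :
  arm_im u v = - sin v + 2 * branch u v * sin ((u + v) / 2).
Proof.
rewrite /arm_im /branch.
have -> : (u + v) / 2 = u / 2 + v / 2 by field.
have : u = u / 2 + u / 2 by field.
have : v = v / 2 + v / 2 by field.
move: (u / 2) (v / 2) => x y -> ->.
have e1 := sin2cos2 x; have e2 := sin2cos2 y.
rewrite !(cosD, sinD).
move: e1 e2; set a := cos x; set b := sin x.
set c := cos y; set d := sin y => e1 e2.
have h1 : a * b * d ^+ 2 = a * b * (1 - c ^+ 2) by rewrite e2.
have h2 : c * d * b ^+ 2 = c * d * (1 - a ^+ 2) by rewrite e1.
lra.
Qed.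

(** The squared modulus of the form above is 1 + 4 L^2 - 4 L cos (v - p) with p = (u + v) / 2, and L
    - cos (v - p) = 2 cos p. *)
Lemma arm_sqrE u v : arm_sqr u v = 1 + 8 * cos ((u + v) / 2) * branch u v.
Proof.
rewrite /arm_sqr arm_reE arm_imE; set L := branch u v; set p := (u + v) / 2.
transitivity ((cos v ^+ 2 + sin v ^+ 2) +
  4 * L ^+ 2 * (cos p ^+ 2 + sin p ^+ 2) -
  4 * L * (cos v * cos p + sin v * sin p)); first by ring.
rewrite !cos2Dsin2 -cosB; have -> : v - p = v / 2 - u / 2 by rewrite /p; field.
have -> : p = u / 2 + v / 2 by rewrite /p; field.
by rewrite cosB cosD /L /branch; ring.
Qed.

(* Near the crossing point [(0, pi)] of the two branches. *)
Lemma arm_sqr_crossing u e : arm_sqr u (pi + e) = 1 +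
  8 * sin ((u + e) / 2) * (sin ((u + e) / 2) + 2 * cos (u / 2) * sin (e / 2)).
Proof.
rewrite arm_sqrE /branch.
have -> : (u + (pi + e)) / 2 = (u + e) / 2 + pi / 2 by field.
have -> : (pi + e) / 2 = e / 2 + pi / 2 by field.
rewrite !cosDpihalf sinDpihalf.
have -> : (u + e) / 2 = u / 2 + e / 2 by field.
rewrite sinD; ring.
Qed.

(** On this rectangle cos (u / 2) and sin (e / 2) are nonnegative, so the second factor of
    [arm_sqr_crossing] is at least the first and the excess over 1 is at least 8 sin^2 ((u + e) /
    2). Covering all of [0, pi] makes it unnecessary to isolate the corner. *)
Lemma arm_sqr_crossing_ge u e : 0 <= u <= pi -> 0 <= e <= pi / 3 ->
  1 + 2 / pi ^+ 2 * (u + e) ^+ 2 <= arm_sqr u (pi + e).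
Proof.
move=> /andP[u0 up] /andP[e0 ep]; have pi0 := @pi_gt0 R.
have s1 : (u + e) / 2 / pi <= sin ((u + e) / 2) by apply: sin_ge_pi; lra.
have c0 : 0 <= cos (u / 2) by apply: cos_ge0_pihalf; lra.
have s0 : 0 <= sin (e / 2) by apply: sin_ge0_pi; lra.
have a0 : 0 <= (u + e) / 2 / pi by apply: divr_ge0; lra.
rewrite arm_sqr_crossing lerD2l.
have -> : 2 / pi ^+ 2 * (u + e) ^+ 2 = 8 * ((u + e) / 2 / pi) ^+ 2.
  by field_pi R.
move: s1 c0 s0 a0; set x := _ / pi; set y := sin _; set c := cos _; set d := sin _.
move=> xy c0 d0 x0; rewrite -mulrA ler_pM2l// expr2.
apply: ler_pM => //; rewrite (le_trans xy)// lerDl; apply: mulr_ge0 => //.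
by rewrite mulr_ge0.
Qed.

(** For fixed [u], [branch] combines cos (v / 2) and sin (v / 2), so it is a sine with amplitude [A]
    and phase [f], and [v_Gamma] is its zero. Moreover A^2 = sin^2 (u / 2) + 9 cos^2 (u / 2) >=
    1. *)
Lemma v_Gamma_branch u : pi <= u <= 3 * pi / 2 -> exists A f : R,
  [/\ v_Gamma u = 2 * pi - 2 * f, 0 <= f < pi / 2, 1 <= A &
   [/\ A * cos f = sin (u / 2), A * sin f = - 3 * cos (u / 2) &
       forall v, branch u v = A * sin ((v - v_Gamma u) / 2)]].
Proof.
move=> /andP[up u3]; have pi0 := @pi_gt0 R.
pose f := atan (- (3 / tan (u / 2))).
have s0 : 0 < sin (u / 2) by apply: sin_gt0_pi; lra.
have c0 : cos (u / 2) <= 0.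
  rewrite -oppr_ge0; have -> : - cos (u / 2) = cos (pi - u / 2).
    by rewrite cosB cospi sinpi; ring.
  by apply: cos_ge0_pihalf; lra.
(* At u = pi the cosine in tan (u / 2) is 0 and both divisions by 0 give 0. This is the right value:
   the phase is 0 and v_Gamma pi = 2 pi. *)
have tf : - (3 / tan (u / 2)) = - 3 * cos (u / 2) / sin (u / 2).
  rewrite /tan; have [->|c1] := eqVneq (cos (u / 2)) 0.
    by rewrite invr0 !(mulr0, invr0, mul0r) oppr0.
  by field; rewrite c1 gt_eqF.
have f0 : 0 <= f.
  rewrite /f -(@atan0 R); apply: le_atan; rewrite tf.
  by rewrite divr_ge0 ?(ltW s0)// mulr_le0// oppr_le0.
have fp : f < pi / 2 by exact: atan_ltpi2.
have cf : 0 < cos f by apply: cos_gt0_pihalf; lra.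
have sf : sin f = - 3 * cos (u / 2) / sin (u / 2) * cos f by rewrite {1}/f sin_atan -/f tf.
pose A := sin (u / 2) / cos f.
have A0 : 0 < A by exact: divr_gt0.
have Ac : A * cos f = sin (u / 2) by rewrite /A divfK// gt_eqF.
have As : A * sin f = - 3 * cos (u / 2).
  by rewrite sf /A; field; rewrite !gt_eqF.
have vE : v_Gamma u = 2 * pi - 2 * f by [].
exists A, f; split => //; first by rewrite f0.
  have : 1 <= A ^+ 2.
    have -> : A ^+ 2 = (A * cos f) ^+ 2 + (A * sin f) ^+ 2.
      by rewrite !exprMn -mulrDr cos2Dsin2 mulr1.
    rewrite Ac As; have := cos2Dsin2 (u / 2); have := sqr_ge0 (cos (u / 2)); lra.
  by move=> A2; rewrite -(@ler_pXn2r _ 2)// ?nnegrE ?(ltW A0)// expr1n.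
split=> // v; rewrite vE.
have -> : (v - (2 * pi - 2 * f)) / 2 = v / 2 + f - pi by field.
have -> : sin (v / 2 + f - pi) = - sin (v / 2 + f).
  by rewrite sinB cospi sinpi; ring.
rewrite sinD /branch -Ac; have -> : 3 * cos (u / 2) = - (A * sin f) by rewrite As; ring.
ring.
Qed.

(** The cotangent is smooth at u = pi, where the quotient by tan relies on the convention for
    division by 0; differentiation starts from this form. *)
Lemma v_GammaE u : sin (u / 2) != 0 ->
  v_Gamma u = 2 * pi + 2 * atan (3 * (cos (u / 2) / sin (u / 2))).
Proof.
move=> s0; rewrite /v_Gamma atanN mulrN opprK; congr (_ + 2 * atan _).
rewrite /tan; have [->|c0] := eqVneq (cos (u / 2)) 0.
  by rewrite invr0 !(mulr0, invr0, mul0r).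
by field; rewrite s0 c0.
Qed.

(** The value is - 3 / A^2, with the amplitude [A] of [v_Gamma_branch]. *)
Lemma is_derive_v_Gamma u : 0 < u < 2 * pi ->
  is_derive u 1 (@v_Gamma R) (- 3 / (sin (u / 2) ^+ 2 + 9 * cos (u / 2) ^+ 2)).
Proof.
move=> /andP[u0 u2]; have pi0 := @pi_gt0 R.
have sin0 : 0 < sin (u / 2) by apply: sin_gt0_pi; lra.
pose f x : R := 2 * pi + 2 * atan (3 * (cos (x / 2) / sin (x / 2))).
have half x : is_derive x 1 (fun x : R => x / 2) 2^-1.
  by apply: is_derive_eq; rewrite /GRing.scale/=; ring.
have dc : is_derive u 1 (fun x => cos (x / 2)) (- sin (u / 2) * 2^-1).
  exact: (@is_derive1_comp _ (@cos R) (fun x : R => x / 2) u).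
have ds : is_derive u 1 (fun x => sin (x / 2)) (cos (u / 2) * 2^-1).
  exact: (@is_derive1_comp _ (@sin R) (fun x : R => x / 2) u).
have s0 : sin (u / 2) != 0 by rewrite gt_eqF.
have dV : is_derive u 1 (fun x => (sin (x / 2))^-1)
    (- (sin (u / 2)) ^- 2 *: (cos (u / 2) * 2^-1)).
  exact: (@is_deriveV _ (fun x => sin (x / 2))).
have dM : is_derive u 1 (fun x => 3 * (cos (x / 2) / sin (x / 2)))
    (- 3 / (2 * sin (u / 2) ^+ 2)).
  apply: is_derive_eq; rewrite /GRing.scale/=.
  transitivity (- 3 * (cos (u / 2) ^+ 2 + sin (u / 2) ^+ 2) /
    (2 * sin (u / 2) ^+ 2)); first by field.
  by rewrite cos2Dsin2 mulr1.
have dA : is_derive u 1 (fun x => atan (3 * (cos (x / 2) / sin (x / 2))))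
    ((1 + (3 * (cos (u / 2) / sin (u / 2))) ^+ 2)^-1 *
     (- 3 / (2 * sin (u / 2) ^+ 2))).
  exact: (@is_derive1_comp _ (@atan R)
    (fun x => 3 * (cos (x / 2) / sin (x / 2))) u).
apply: (@near_eq_is_derive _ _ _ f).
  near=> x; rewrite /f v_GammaE// gt_eqF// sin_gt0_pi//.
  have : 0 < x by near: x; exact: lt_nbhsr.
  have : x < 2 * pi by near: x; exact: lt_nbhsl.
  lra.
rewrite /f; apply: is_derive_eq; rewrite /GRing.scale/=.
have h : sin (u / 2) ^+ 2 + 9 * cos (u / 2) ^+ 2 != 0.
  by rewrite gt_eqF// ltr_wpDr// ?exprn_gt0// mulr_ge0// sqr_ge0.
have h2 : 1 + (3 * (cos (u / 2) / sin (u / 2))) ^+ 2 != 0.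
  by rewrite gt_eqF// ltr_wpDr// sqr_ge0.
by field; rewrite s0 h.
Unshelve. all: by end_near. Qed.

Lemma continuous_v_Gamma u : 0 < u < 2 * pi -> {for u, continuous (@v_Gamma R)}.
Proof.
move=> /is_derive_v_Gamma d; apply: differentiable_continuous.
by apply/derivable1_diffP; exact: (@ex_derive _ _ _ _ _ _ _ d).
Qed.

End Trigonometry.

Lemma cvg_ext (R : realType) (u v : nat -> R) (l : R) :
  (forall n, u n = v n) -> v n @[n --> \oo] --> l -> u n @[n --> \oo] --> l.
Proof. by move=> /funext ->. Qed.

Lemma cvg_sqr (R : realType) (u : nat -> R) (l : R) :
  u n @[n --> \oo] --> l -> u n ^+ 2 @[n --> \oo] --> l ^+ 2.
Proof.
move=> ul; rewrite expr2; apply: (@cvg_ext _ _ (fun n => u n * u n)) => //.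
exact: cvgM.
Qed.

(** * Integration over q_1 *)

Section InnerIntegral.
Context {R : realType}.
Local Notation mu := (@lebesgue_measure R).
Implicit Types (a p q x s M : R) (h : R -> R).

(** This is |e^(i x) (p + i q) - 1|^2; for p + i q = S(u, v) it is |X - 1|^2 at the angles (x, u,
    v). *)
Definition kinetic p q x : R :=
  (p * cos x - q * sin x - 1) ^+ 2 + (p * sin x + q * cos x) ^+ 2.

(** Here and below [a] stands for sqrt z. *)
Definition inner_integral a p q h : \bar R :=
  (\int[mu]_(x in `[0%R, (2 * pi)%R[)
     (h x * expR (- (a ^+ 2 / 2) * kinetic p q x))%:E)%E.

Definition radius p q : R := Num.sqrt (p ^+ 2 + q ^+ 2).

(** The integrand after x = s / a - arg (p + i q), which turns p + i q onto the positive real axis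
    at s = 0. The indicator keeps exactly one period. *)
Definition rescaled a p q h s : R :=
  h (s / a - polar_arg p q) *
  expR (- (a ^+ 2 / 2) * ((radius p q * cos (s / a) - 1) ^+ 2 +
                          (radius p q * sin (s / a)) ^+ 2)) *
  \1_(`[- pi * a, pi * a[%classic) s.

Lemma measurable_kinetic p q : measurable_fun [set: R] (kinetic p q).
Proof.
apply: measurable_funD; apply: measurable_funX.
- apply: measurable_funB => //; apply: measurable_funB.
  + by apply: measurable_funM => //; exact: (continuous_measurable_fun (@continuous_cos R)).
  + by apply: measurable_funM => //; exact: (continuous_measurable_fun (@continuous_sin R)).
- apply: measurable_funD.
  + by apply: measurable_funM => //; exact: (continuous_measurable_fun (@continuous_sin R)).
  + by apply: measurable_funM => //; exact: (continuous_measurable_fun (@continuous_cos R)).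
Qed.

Section fixed.
Variables (a p q M : R) (h : R -> R).
Hypotheses (a0 : 0 < a) (mh : measurable_fun setT h) (h0 : forall x, 0 <= h x).
Hypothesis hT : forall x, h (x + 2 * pi) = h x.

Lemma measurable_rescaled : measurable_fun [set: R] (rescaled a p q h).
Proof.
have ma : measurable_fun [set: R] (fun s => s / a) by exact: measurable_funM.
apply: measurable_funM; last exact: measurable_indic.
apply: measurable_funM.
  by apply: (measurableT_comp mh); exact: measurable_funB.
apply: measurableT_comp => //; apply: measurable_funM => //.
apply: measurable_funD; apply: measurable_funX.
- apply: measurable_funB => //; apply: measurable_funM => //.
  by apply: (measurableT_comp (continuous_measurable_fun (@continuous_cos R))).
- apply: measurable_funM => //.
  by apply: (measurableT_comp (continuous_measurable_fun (@continuous_sin R))).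
Qed.

Lemma rescaled_ge0 s : 0 <= rescaled a p q h s.
Proof. by rewrite /rescaled !mulr_ge0// expR_ge0. Qed.

Lemma inner_integral_rescaled :
  (a%:E * inner_integral a p q h = \int[mu]_s (rescaled a p q h s)%:E)%E.
Proof.
pose f x : \bar R := (h x * expR (- (a ^+ 2 / 2) * kinetic p q x))%:E.
have mf : measurable_fun setT f.
  apply/measurable_EFinP; apply: measurable_funM => //.
  apply: measurableT_comp => //; apply: measurable_funM => //.
  exact: measurable_kinetic.
have f0 x : (0 <= f x)%E by rewrite lee_fin mulr_ge0// expR_ge0.
have fT x : f (x + 2 * pi) = f x.
  rewrite /f hT /kinetic [2 * pi]mulr_natl.
  by rewrite (@cosD2pi R) (@sinD2pi R).
have T0 : 0 < 2 * pi :> R by rewrite mulr_gt0// pi_gt0.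
have [pE qE] := polar_argP p q; rewrite -/(radius p q) in pE qE.
have kE x : kinetic p q (x - polar_arg p q) =
    (radius p q * cos x - 1) ^+ 2 + (radius p q * sin x) ^+ 2.
  rewrite /kinetic; move: (radius p q) (polar_arg p q) pE qE => r al pE qE.
  have cE : cos x = cos al * cos (x - al) - sin al * sin (x - al).
    by rewrite -cosD; congr cos; ring.
  have sE : sin x = sin al * cos (x - al) + cos al * sin (x - al).
    by rewrite -sinD; congr sin; ring.
  rewrite cE sE pE qE; ring.
set al := polar_arg p q in pE qE kE.
rewrite /inner_integral -/f.
(* By periodicity the window is recentred at the angle - al, so that after translation and scaling
   it is symmetric about s = 0. *)
rewrite -(@integral_period_window _ (2 * pi) f T0 mf f0 fT (- pi - al)).
have -> : - pi - al + 2 * pi = pi - al by ring.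
rewrite -[X in (a%:E * X)%E](@integral_translate_itv _ f mf f0 (- pi) pi (- al)).
rewrite integral_mkcond [X in (a%:E * X)%E](@ge0_integral_affine _ a^-1 0) ?invr_gt0//; last 2 first.
- have mD : measurable (`[- pi, pi[ : set R) by exact: measurable_itv.
  apply: (measurable_restrictT _ mD).1; apply: measurable_funTS.
  by apply: (measurableT_comp mf); exact: measurable_funD.
- by move=> x; rewrite patchE; case: ifP.
rewrite muleA -EFinM mulfV ?gt_eqF// mul1e.
apply: eq_integral => s _.
rewrite addr0 patchE /f kE mulrC /rescaled indicE -/al.
have -> : (s / a \in `[- pi, pi[%classic) = (s \in `[- pi * a, pi * a[%classic).
  by rewrite !mem_setE !in_itv/= ler_pdivlMr// ltr_pdivrMr.
by case: ifPn => _; rewrite ?mulr1 ?mulr0//.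
Qed.

Hypothesis hM : forall x, h x <= M.

(** [sqr_dist1_polar_ge] splits the exponent into two halves. The angular half is a Gaussian in [s]
    independent of [a]; the radial half is kept, since it dominates the later integration over (u,
    v). *)
Lemma rescaled_le s : rescaled a p q h s <=
  M * expR (- (a ^+ 2 / 4) * (radius p q - 1) ^+ 2) *
  expR (- ((4 * pi ^+ 2)^-1 * s ^+ 2)).
Proof.
have M0 : 0 <= M by exact: le_trans (hM 0).
rewrite /rescaled indicE; case: (boolP (s \in _)) => [|_]; last first.
  by rewrite mulr0 !mulr_ge0// expR_ge0.
rewrite mem_setE in_itv/= => /andP[sl sr]; rewrite mulr1 -mulrA -expRD.
apply: ler_pM => //.
rewrite ler_expR.
have sa : `|s / a| <= pi.
  rewrite ler_norml ler_pdivlMr// ler_pdivrMr// sl; exact: ltW.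
have := sqr_dist1_polar_ge (sqrtr_ge0 (p ^+ 2 + q ^+ 2)) sa.
rewrite -/(radius p q); set X := (_ - 1) ^+ 2; set E := (_ + _ in X in _ <= X) => hE.
have : 0 <= a ^+ 2 / 2 by rewrite divr_ge0 ?sqr_ge0.
move=> /ler_wpM2l hE2; have := hE2 _ _ hE.
have -> : a ^+ 2 / 2 * (2^-1 * X + 2^-1 * (s / a / pi) ^+ 2) =
  a ^+ 2 / 4 * X + (4 * pi ^+ 2)^-1 * s ^+ 2.
  have a1 : a != 0 by rewrite gt_eqF.
  field_pi R.
move=> H; suff : - (a ^+ 2 / 2) * E <=
    - (a ^+ 2 / 4) * X - (4 * pi ^+ 2)^-1 * s ^+ 2 by [].
by rewrite !mulNr -opprD lerN2.
Qed.

Definition inner_bound : R := Num.sqrt (pi / (4 * pi ^+ 2)^-1).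

Lemma inner_integral_le : (a%:E * inner_integral a p q h <=
  (M * expR (- (a ^+ 2 / 4) * (radius p q - 1) ^+ 2) * inner_bound)%:E)%E.
Proof.
have M0 : 0 <= M by exact: le_trans (hM 0).
have c0 : 0 < (4 * pi ^+ 2)^-1 :> R by rewrite invr_gt0 mulr_gt0// exprn_gt0// pi_gt0.
rewrite inner_integral_rescaled /inner_bound EFinM -gauss_integral_scaled//.
rewrite -ge0_integralZl_EFin//; last 2 first.
- by apply/measurable_EFinP; exact: measurable_gauss_scaled.
- by rewrite mulr_ge0// expR_ge0.
apply: ge0_le_integral => //.
- by move=> x _; rewrite lee_fin rescaled_ge0.
- by apply/measurable_EFinP; exact: measurable_rescaled.
- by apply: measurable_funeM; apply/measurable_EFinP; exact: measurable_gauss_scaled.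
- by move=> x _; rewrite -EFinM lee_fin rescaled_le.
Qed.

End fixed.

(** Let r be the radius. As a (r - 1) tends to k, the exponent tends to - (k^2 + s^2) / 2, and the
    Gaussian in [s] integrates to sqrt (2 pi). *)
Lemma inner_integral_cvg (a p q : nat -> R) (h : nat -> R -> R) (M k L : R) :
  (forall n, 0 < a n) -> a n @[n --> \oo] --> +oo ->
  (forall n, measurable_fun setT (h n)) -> (forall n x, 0 <= h n x) ->
  (forall n x, h n (x + 2 * pi) = h n x) -> (forall n x, h n x <= M) ->
  a n * (radius (p n) (q n) - 1) @[n --> \oo] --> k ->
  (forall s, h n (s / a n - polar_arg (p n) (q n)) @[n --> \oo] --> L) ->
  ((a n)%:E * inner_integral (a n) (p n) (q n) (h n))%E @[n --> \oo] -->
  (L * expR (- (k ^+ 2 / 2)) * Num.sqrt (2 * pi))%:E.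
Proof.
move=> a0 aoo mh h0 hT hM kn hL.
have M0 : 0 <= M by exact: le_trans (hM 0%N 0).
have c0 : 0 < (4 * pi ^+ 2)^-1 :> R by rewrite invr_gt0 mulr_gt0// exprn_gt0// pi_gt0.
(* Convergence of a (r - 1) forces r to tend to 1, because [a] tends to infinity. *)
have rn : radius (p n) (q n) @[n --> \oo] --> (1 : R).
  rewrite -[X in _ --> X]add0r -(mul0r k).
  apply: (@cvg_ext _ _ (fun n => (a n)^-1 * (a n * (radius (p n) (q n) - 1)) + 1)).
    by move=> n; rewrite mulKf ?gt_eqF// subrK.
  by apply: cvgD (cvg_cst _); apply: cvgM kn; exact: cvgV_pinfty.
have pw s : rescaled (a n) (p n) (q n) (h n) s @[n --> \oo] -->
    L * expR (- 2^-1 * (k ^+ 2 + 1 * (2 * (s / 2)) ^+ 2)) * 1.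
  apply: cvgM; last first.
    have ev : \forall n \near \oo, `|s| / pi < a n.
      by move/cvgryPgt : aoo; exact.
    apply: cvg_near_cst; near=> n.
    rewrite indicE mem_set//= in_itv/=; apply/andP.
    have : `|s| < pi * a n.
      by rewrite mulrC -ltr_pdivrMr ?pi_gt0//; near: n.
    by rewrite ltr_norml mulNr => /andP[/ltW].
  apply: cvgM; first exact: hL.
  apply: (@cvg_comp _ _ _ _ expR); last exact: continuous_expR.
  (* The factor a^2 is distributed so that only a (r - 1) and a sin (s / 2 / a), whose limits are
     known, appear. *)
  apply: (@cvg_ext _ _ (fun n => - 2^-1 *
    ((a n * (radius (p n) (q n) - 1)) ^+ 2 +
     radius (p n) (q n) * (2 * (a n * sin (s / 2 / a n))) ^+ 2))).
    move=> n; rewrite sqr_dist1_polar.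
    have -> : s / a n / 2 = s / 2 / a n by rewrite mulrAC.
    by field.
  apply: cvgMr; apply: cvgD; first exact: cvg_sqr.
  by apply: cvgM => //; apply: cvg_sqr; apply: cvgMr; exact: cvg_sin_scaled.
have -> : (L * expR (- (k ^+ 2 / 2)) * Num.sqrt (2 * pi))%:E =
    (\int[mu]_s (L * expR (- 2^-1 * (k ^+ 2 + 1 * (2 * (s / 2)) ^+ 2)) * 1)%:E)%E.
  have L0 : 0 <= L.
    rewrite -(cvg_lim (@Rhausdorff R) (hL 0)).
    by apply: limr_ge; [exact: cvgP (hL 0)|apply: nearW => n; exact: h0].
  transitivity ((L * expR (- (k ^+ 2 / 2)))%:E *
      \int[mu]_s (expR (- (2^-1 * s ^+ 2)))%:E)%E.
    by rewrite gauss_integral_scaled ?invr_gt0// invrK -EFinM [pi * 2]mulrC.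
  rewrite -ge0_integralZl_EFin//; last 2 first.
  - by apply/measurable_EFinP; exact: measurable_gauss_scaled.
  - by rewrite mulr_ge0// expR_ge0.
  apply: eq_integral => s _; rewrite mulr1 -EFinM -mulrA -expRD.
  by congr (_ * expR _)%:E; field.
under eq_cvg do rewrite inner_integral_rescaled//.
have := @dominated_convergence _ _ _ mu setT measurableT
  (fun n s => (rescaled (a n) (p n) (q n) (h n) s)%:E)
  (fun s => (L * expR (- 2^-1 * (k ^+ 2 + 1 * (2 * (s / 2)) ^+ 2)) * 1)%:E)
  (fun s => M%:E * (expR (- ((4 * pi ^+ 2)^-1 * s ^+ 2)))%:E)%E.
case.
- by move=> n; apply/measurable_EFinP; exact: measurable_rescaled.
- apply/measurable_EFinP; apply: measurable_funM => //; apply: measurable_funM => //.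
  apply: measurableT_comp => //; apply: measurable_funM => //.
  apply: measurable_funD => //; apply: measurable_funM => //.
  by apply: measurable_funX; apply: measurable_funM => //; exact: measurable_funM.
- by apply: aeW => s _; apply/fine_cvgP; split; [exact: nearW|exact: pw].
- by apply: integrableZl => //; exact: integrable_gauss_scaled.
- apply: aeW => s n _; rewrite gee0_abs ?lee_fin ?rescaled_ge0//.
  have := rescaled_le (p n) (q n) (a0 n) (h0 n) (hM n) s.
  move=> /le_trans; apply; rewrite ler_pM2r ?expR_gt0// -[leRHS]mulr1 ler_wpM2l// -expR0 ler_expR.
  by rewrite mulNr oppr_le0 mulr_ge0 ?sqr_ge0// divr_ge0 ?sqr_ge0.
- by [].
Unshelve. all: by end_near. Qed.

Lemma polar_arg_cvg (p q : nat -> R) (p0 q0 : R) : 0 < p0 ->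
  p n @[n --> \oo] --> p0 -> q n @[n --> \oo] --> q0 ->
  polar_arg (p n) (q n) @[n --> \oo] --> atan (q0 / p0).
Proof.
move=> p0_gt0 pn qn.
have : atan (q n / p n) @[n --> \oo] --> atan (q0 / p0).
  apply: (@cvg_comp _ _ _ (fun n => q n / p n) atan); last exact: continuous_atan.
  by apply: cvgM => //; apply: cvgV => //; rewrite gt_eqF.
apply: cvg_trans; apply: near_eq_cvg; near=> n.
rewrite /polar_arg ifT//; near: n.
by apply: (cvgr_gt p0).
Unshelve. all: by end_near. Qed.

End InnerIntegral.

(** * Dominated convergence for iterated integrals *)

Section DominatedIterated.
Context {R : realType}.
Local Notation mu := (@lebesgue_measure R).

Lemma tonelli_R2 (g : R * R -> \bar R) : measurable_fun [set: R * R] g ->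
  (forall p, (0 <= g p)%E) ->
  (\int[(mu \x mu)%E]_p g p = \int[mu]_u \int[mu]_v g (u, v))%E.
Proof.
exact: (@fubini_tonelli1 _ _ (measurableTypeR R) (measurableTypeR R) R mu mu g).
Qed.

(** A bound of product form is integrable by Tonelli, so dominated convergence applies in the plane,
    and the integrals are then iterated again. *)
Lemma iterated_dominated_cvg (r : nat -> R * R -> \bar R) (l : R * R -> \bar R)
    (h1 h2 : R -> R) :
  (forall n, measurable_fun [set: R * R] (r n)) ->
  (forall n p, (0 <= r n p <= (h1 p.1 * h2 p.2)%:E)%E) ->
  (forall x, 0 <= h1 x) -> (forall x, 0 <= h2 x) ->
  mu.-integrable setT (EFin \o h1) -> mu.-integrable setT (EFin \o h2) ->
  (forall p, r n p @[n --> \oo] --> l p) ->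
  (\int[mu]_u \int[mu]_v r n (u, v))%E @[n --> \oo] -->
  (\int[mu]_u \int[mu]_v l (u, v))%E.
Proof.
move=> mr rb h10 h20 i1 i2 rl.
have r0 n p : (0 <= r n p)%E by have /andP[] := rb n p.
have ml : measurable_fun [set: R * R] l.
  by apply: (emeasurable_fun_cvg r) => // p _; exact: rl.
have l0 p : (0 <= l p)%E.
  rewrite -(cvg_lim (@ereal_hausdorff R) (rl p)).
  by apply: lime_ge; [exact: cvgP (rl p)|apply: nearW => n; exact: r0].
have mh1 : measurable_fun setT h1 by apply/measurable_EFinP; exact: (measurable_int _ i1).
have mh2 : measurable_fun setT h2 by apply/measurable_EFinP; exact: (measurable_int _ i2).
pose g (p : R * R) := (h1 p.1 * h2 p.2)%:E.
have mg : measurable_fun [set: R * R] g.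
  apply/measurable_EFinP; apply: measurable_funM.
  - exact: (measurableT_comp mh1 measurable_fst).
  - exact: (measurableT_comp mh2 measurable_snd).
have g0 p : (0 <= g p)%E by rewrite lee_fin mulr_ge0.
have ig : (mu \x mu)%E.-integrable setT g.
  apply/integrableP; split => //.
  under eq_integral do rewrite gee0_abs//.
  rewrite tonelli_R2// /g/=.
  under eq_integral => x _.
    under eq_integral do rewrite EFinM.
    rewrite ge0_integralZl_EFin//; last 2 first.
    - by move=> y _; rewrite lee_fin.
    - exact/measurable_EFinP.
    over.
  have fin2 : (\int[mu]_x (h2 x)%:E)%E \is a fin_num.
    exact: integrable_fin_num.
  have i2_ge0 : (0 <= \int[mu]_x (h2 x)%:E)%E.
    by apply: integral_ge0 => x _; rewrite lee_fin.
  rewrite ge0_integralZr//; last 2 first.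
  - exact/measurable_EFinP.
  - by move=> x _; rewrite lee_fin.
  by rewrite ltey_eq fin_numM// integrable_fin_num.
have := @dominated_convergence _ _ _ (mu \x mu)%E setT measurableT r l g.
case => //.
- by apply: aeW => p _; exact: rl.
- apply: aeW => p n _; rewrite gee0_abs//.
  by have /andP[] := rb n p.
move=> _ _; rewrite tonelli_R2//; apply: cvg_trans.
by apply: near_eq_cvg; apply: nearW => n; rewrite /= tonelli_R2.
Qed.

End DominatedIterated.

Lemma cvg_continuous_R3 {R : realType} (F : R * R * R -> R) (x y z : nat -> R)
    (x0 y0 z0 : R) : continuous F ->
  x n @[n --> \oo] --> x0 -> y n @[n --> \oo] --> y0 ->
  z n @[n --> \oo] --> z0 -> F (x n, y n, z n) @[n --> \oo] --> F (x0, y0, z0).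
Proof.
move=> cF xn yn zn.
have xyz : (x n, y n, z n) @[n --> \oo] --> (x0, y0, z0).
  exact: (cvg_pair (cvg_pair xn yn) zn).
exact: (cvg_comp _ _ xyz (cF _)).
Qed.

(** * The q_1 integral as a function of (u, v) *)

Section OuterIntegral.
Context {R : realType}.
Local Notation mu := (@lebesgue_measure R).
Variables (F : R * R * R -> R) (M : R).
Hypotheses (cF : continuous F) (F0 : forall x, 0 <= F x) (FM : forall x, F x <= M).
Hypothesis FT : forall x u v, F (x + 2 * pi, u, v) = F (x, u, v).

Definition slice_integral (a : R) (p : R * R) : \bar R :=
  inner_integral a (arm_re p.1 p.2) (arm_im p.1 p.2) (fun x => F (x, p.1, p.2)).

Lemma measurable_slice u v : measurable_fun [set: R] (fun x => F (x, u, v)).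
Proof.
apply: (measurableT_comp (continuous_measurable_R3 cF)).
by apply: measurable_fun_pair => //; exact: measurable_fun_pair.
Qed.

Lemma measurable_slice_integral a : measurable_fun [set: R * R] (slice_integral a).
Proof.
pose f (y : (R * R) * R) : \bar R := (F (y.2, y.1.1, y.1.2) *
  expR (- (a ^+ 2 / 2) * kinetic (arm_re y.1.1 y.1.2) (arm_im y.1.1 y.1.2) y.2) *
  \1_(`[0, 2 * pi[%classic : set R) y.2)%:E.
have m1 : measurable_fun [set: R * R * R] (fun y : (R * R) * R => y.1.1).
  exact: (measurableT_comp measurable_fst measurable_fst).
have m2 : measurable_fun [set: R * R * R] (fun y : (R * R) * R => y.1.2).
  exact: (measurableT_comp measurable_snd measurable_fst).
have m3 : measurable_fun [set: R * R * R] (fun y : (R * R) * R => y.2).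
  exact: measurable_snd.
have mc (g : R * R * R -> R) : measurable_fun setT g -> measurable_fun setT (cos \o g).
  by move=> mg; apply: measurableT_comp mg; exact: (continuous_measurable_fun (@continuous_cos R)).
have ms (g : R * R * R -> R) : measurable_fun setT g -> measurable_fun setT (sin \o g).
  by move=> mg; apply: measurableT_comp mg; exact: (continuous_measurable_fun (@continuous_sin R)).
have mre : measurable_fun [set: R * R * R] (fun y => arm_re y.1.1 y.1.2).
  apply: measurable_funD; first by apply: measurable_funD => //; exact: mc.
  by apply: measurable_funM => //; apply: mc; exact: measurable_funD.
have mim : measurable_fun [set: R * R * R] (fun y => arm_im y.1.1 y.1.2).
  apply: measurable_funD; first exact: ms.
  by apply: measurable_funM => //; apply: ms; exact: measurable_funD.
have mf : measurable_fun setT f.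
  apply/measurable_EFinP; apply: measurable_funM; last first.
    by apply: measurableT_comp => //; exact: measurable_indic.
  apply: measurable_funM.
    apply: (measurableT_comp (continuous_measurable_R3 cF)).
    apply: measurable_fun_pair => //; exact: measurable_fun_pair.
  apply: measurableT_comp => //; apply: measurable_funM => //.
  apply: measurable_funD; apply: measurable_funX.
  - apply: measurable_funB => //; apply: measurable_funB.
    + by apply: measurable_funM => //; exact: mc.
    + by apply: measurable_funM => //; exact: ms.
  - apply: measurable_funD.
    + by apply: measurable_funM => //; exact: ms.
    + by apply: measurable_funM => //; exact: mc.
have f0 y : (0 <= f y)%E by rewrite lee_fin !mulr_ge0// expR_ge0.
have := measurable_fun_fubini_tonelli_F (m2 := mu) f mf f0.
congr measurable_fun; apply/funext => p.
rewrite /slice_integral /inner_integral integral_mkcond.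
apply: eq_integral => x _; rewrite patchE /f/= indicE.
by case: ifPn => _; rewrite ?mulr1 ?mulr0.
Qed.

Lemma slice_integral_le a p : 0 < a -> (a%:E * slice_integral a p <=
  (M * expR (- (a ^+ 2 / 4) *
      (radius (arm_re p.1 p.2) (arm_im p.1 p.2) - 1) ^+ 2) * @inner_bound R)%:E)%E.
Proof.
by move=> a0; apply: inner_integral_le => //; exact: measurable_slice.
Qed.

Lemma slice_integral_ge0 a p : (0 <= slice_integral a p)%E.
Proof.
by apply: integral_ge0 => x _; rewrite lee_fin mulr_ge0// expR_ge0.
Qed.

(** [k] is the limit of a (rho - 1). The mass concentrates at q_1 = - arg S(u0, v0); a positive real
    part of S(u0, v0) makes this argument an atan that is continuous at the limit. *)
Lemma slice_integral_cvg (a u v : nat -> R) (k u0 v0 : R) :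
  (forall n, 0 < a n) -> a n @[n --> \oo] --> +oo ->
  u n @[n --> \oo] --> u0 -> v n @[n --> \oo] --> v0 -> 0 < arm_re u0 v0 ->
  a n * (radius (arm_re (u n) (v n)) (arm_im (u n) (v n)) - 1) @[n --> \oo] --> k ->
  ((a n)%:E * slice_integral (a n) (u n, v n))%E @[n --> \oo] -->
  (F (- atan (arm_im u0 v0 / arm_re u0 v0), u0, v0) *
   expR (- (k ^+ 2 / 2)) * Num.sqrt (2 * pi))%:E.
Proof.
move=> a0 aoo un vn re0 kn.
have cos_cvg (f : nat -> R) l : f n @[n --> \oo] --> l -> cos (f n) @[n --> \oo] --> cos l.
  by move=> fl; exact: (cvg_comp _ _ fl (@continuous_cos R l)).
have sin_cvg (f : nat -> R) l : f n @[n --> \oo] --> l -> sin (f n) @[n --> \oo] --> sin l.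
  by move=> fl; exact: (cvg_comp _ _ fl (@continuous_sin R l)).
have ren : arm_re (u n) (v n) @[n --> \oo] --> arm_re u0 v0.
  apply: cvgD; first by apply: cvgD; [exact: cvg_cst|exact: cos_cvg].
  by apply: cvgMr; apply: cos_cvg; exact: cvgD.
have imn : arm_im (u n) (v n) @[n --> \oo] --> arm_im u0 v0.
  apply: cvgD; first exact: sin_cvg.
  by apply: cvgMr; apply: sin_cvg; exact: cvgD.
apply: (inner_integral_cvg (M := M)) => //.
- by move=> n; exact: measurable_slice.
- move=> s; have argn := polar_arg_cvg re0 ren imn.
  have xn : s / a n - polar_arg (arm_re (u n) (v n)) (arm_im (u n) (v n))
      @[n --> \oo] --> - atan (arm_im u0 v0 / arm_re u0 v0).
    rewrite -[X in _ --> X]add0r; apply: cvgB => //.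
    by rewrite -(mulr0 s); apply: cvgMr; exact: cvgV_pinfty.
  exact: (cvg_continuous_R3 cF xn un vn).
Qed.

End OuterIntegral.

(** * Rescaling of u and v *)

Section Rescaling.
Context {R : realType}.
Local Notation mu := (@lebesgue_measure R).

Lemma ge0_integral_rescale (c d : R) (D : set R) (f : R -> \bar R) : 0 < c ->
  measurable D -> measurable_fun setT f -> (forall x, (0 <= f x)%E) ->
  (c%:E * \int[mu]_(x in D) f x =
   \int[mu]_y (f (y / c + d)%R * (\1_D (y / c + d)%R)%:E))%E.
Proof.
move=> c0 mD mf f0.
rewrite integral_mkcond [X in (c%:E * X)%E](@ge0_integral_affine _ c^-1 d) ?invr_gt0//; last 2 first.
- exact: (measurable_restrictT _ mD).1 (measurable_funTS mf).
- by move=> x; rewrite patchE; case: ifP.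
rewrite muleA -EFinM mulfV ?gt_eqF// mul1e; apply: eq_integral => y _.
rewrite patchE indicE [c^-1 * y]mulrC.
by case: ifPn => _; rewrite ?mule1 ?mule0.
Qed.

Lemma measurable_section_integral (s : R * R -> \bar R) (D : set R) :
  measurable D -> measurable_fun [set: R * R] s -> (forall p, (0 <= s p)%E) ->
  measurable_fun [set: R] (fun u => \int[mu]_(v in D) s (u, v))%E.
Proof.
move=> mD ms s0.
pose t (p : R * R) : \bar R := (s p * (\1_D p.2)%:E)%E.
have mt : measurable_fun [set: R * R] t.
  apply: emeasurable_funM => //; apply/measurable_EFinP.
  by apply: (measurableT_comp _ measurable_snd); exact: measurable_indic.
have t0 p : (0 <= t p)%E by rewrite mule_ge0// lee_fin.
have := @measurable_fun_fubini_tonelli_F _ _ (measurableTypeR R)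
  (measurableTypeR R) R mu t mt t0.
congr measurable_fun; apply/funext => u.
rewrite [RHS]integral_mkcond; apply: eq_integral => v _.
by rewrite patchE /t indicE/=; case: ifPn => _; rewrite ?mule1 ?mule0.
Qed.

(** The centre [d] of the second variable may depend on the first: along the curve, [v] is measured
    from [v_Gamma u]. *)
Lemma ge0_integral_rescale2 (b1 b2 : R) (d : R -> R) (D1 D2 : set R)
    (s : R * R -> \bar R) : 0 < b1 -> 0 < b2 -> measurable D1 -> measurable D2 ->
  measurable_fun setT d -> measurable_fun [set: R * R] s ->
  (forall p, (0 <= s p)%E) ->
  ((b1 * b2)%:E * \int[mu]_(u in D1) \int[mu]_(v in D2) s (u, v) =
   \int[mu]_x \int[mu]_y (s (x / b1, y / b2 + d (x / b1))%R *
     (\1_D1 (x / b1) * \1_D2 (y / b2 + d (x / b1)))%:E))%E.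
Proof.
move=> b10 b20 mD1 mD2 md ms s0.
have msec := measurable_section_integral mD2 ms s0.
have sec0 u : (0 <= \int[mu]_(v in D2) s (u, v))%E by exact: integral_ge0.
rewrite EFinM -muleA -ge0_integralZl_EFin ?(ltW b20)//; last exact: measurable_funTS.
rewrite (ge0_integral_rescale 0 b10 mD1); last 2 first.
- exact: measurable_funeM.
- by move=> u; rewrite mule_ge0// lee_fin ltW.
apply: eq_integral => x _; rewrite addr0.
rewrite (ge0_integral_rescale (d (x / b1)) b20 mD2)//; last first.
  by apply: (measurableT_comp ms); exact: measurable_fun_pair.
rewrite -ge0_integralZr//; last 2 first.
- apply: emeasurable_funM.
    apply: (measurableT_comp ms); apply: measurable_fun_pair => //.
    by apply: measurable_funD => //; exact: measurable_funM.
  apply/measurable_EFinP; apply: (measurableT_comp (measurable_indic mD2)).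
  by apply: measurable_funD => //; exact: measurable_funM.
- by move=> y _; rewrite mule_ge0// lee_fin.
by apply: eq_integral => y _; rewrite -muleA -EFinM [(\1_D1 _ * _)%R]mulrC.
Qed.

Lemma ge0_iterated_integralZl (c : R) (s : R * R -> \bar R) : 0 <= c ->
  measurable_fun [set: R * R] s -> (forall p, (0 <= s p)%E) ->
  (c%:E * \int[mu]_x \int[mu]_y s (x, y) =
   \int[mu]_x \int[mu]_y (c%:E * s (x, y)))%E.
Proof.
move=> c0 ms s0.
rewrite -ge0_integralZl_EFin//; last 2 first.
- by move=> x _; exact: integral_ge0.
- exact: (measurable_section_integral measurableT ms s0).
apply: eq_integral => x _; rewrite -ge0_integralZl_EFin//.
by apply: (measurableT_comp ms); exact: measurable_fun_pair.
Qed.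

End Rescaling.

(** * Estimates and limits for rho - 1 *)

Section RadiusEstimates.
Context {R : realType}.
Implicit Types u v e t : R.

(** Since rho^2 <= 5^2 + 3^2, rho <= 6 and (rho + 1)^2 <= 49; the factorization rho^2 - 1 = (rho -
    1) (rho + 1) then passes from the trigonometric polynomial rho^2 to rho. *)
Lemma radius_sub1_ge u v :
  (arm_sqr u v - 1) ^+ 2 / 49 <= (radius (arm_re u v) (arm_im u v) - 1) ^+ 2.
Proof.
rewrite /radius -/(arm_sqr u v); set w := Num.sqrt _.
have w0 : 0 <= w by exact: sqrtr_ge0.
have w2 : w ^+ 2 = arm_sqr u v by rewrite sqr_sqrtr// addr_ge0// sqr_ge0.
have w6 : w <= 6.
  rewrite -(@ler_pXn2r _ 2)// ?nnegrE// w2 /arm_sqr.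
  have h1 : arm_re u v ^+ 2 <= 5 ^+ 2.
    rewrite -real_normK ?num_real// ler_pXn2r ?nnegrE// ler_norml /arm_re.
    have := cos_geN1 u; have := cos_le1 u; have := cos_geN1 (u + v).
    have := cos_le1 (u + v); lra.
  have h2 : arm_im u v ^+ 2 <= 3 ^+ 2.
    rewrite -real_normK ?num_real// ler_pXn2r ?nnegrE// ler_norml /arm_im.
    have := sin_geN1 u; have := sin_le1 u; have := sin_geN1 (u + v).
    have := sin_le1 (u + v); lra.
  lra.
rewrite -w2 ler_pdivrMr//.
have -> : (w ^+ 2 - 1) ^+ 2 = (w - 1) ^+ 2 * (w + 1) ^+ 2 by ring.
apply: ler_wpM2l; first exact: sqr_ge0.
have -> : 49 = 7 ^+ 2 :> R by ring.
by rewrite ler_pXn2r ?nnegrE//; lra.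
Qed.

(** a (sqrt w - 1) = a (w - 1) / (sqrt w + 1), and sqrt w tends to 1. *)
Lemma sqrt_sub1_cvg (a w : nat -> R) (k : R) : (forall n, 0 < a n) ->
  a n @[n --> \oo] --> +oo -> (forall n, 0 <= w n) ->
  a n * (w n - 1) @[n --> \oo] --> k ->
  a n * (Num.sqrt (w n) - 1) @[n --> \oo] --> k / 2.
Proof.
move=> a0 aoo w0 kn.
have wn : w n @[n --> \oo] --> (1 : R).
  rewrite -[X in _ --> X]add0r -(mul0r k).
  apply: (@cvg_ext _ _ (fun n => (a n)^-1 * (a n * (w n - 1)) + 1)).
    by move=> n; rewrite mulKf ?gt_eqF// subrK.
  by apply: cvgD (cvg_cst _); apply: cvgM kn; exact: cvgV_pinfty.
have sn : Num.sqrt (w n) @[n --> \oo] --> (1 : R).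
  rewrite -[X in _ --> X]sqrtr1; exact: (cvg_comp _ _ wn (@sqrt_continuous R 1)).
apply: (@cvg_ext _ _ (fun n => a n * (w n - 1) * (Num.sqrt (w n) + 1)^-1)).
  move=> n; rewrite -{2}[w n]sqr_sqrtr//; have := sqrtr_ge0 (w n).
  by set x := Num.sqrt _ => x0; field; rewrite gt_eqF// ltr_wpDl.
apply: cvgM => //; apply: cvgV; first by rewrite gt_eqF.
have -> : 2 = 1 + 1 :> R by ring.
exact: cvgD sn (cvg_cst _).
Qed.

Lemma sqrt_pinfty (a : nat -> R) : a n @[n --> \oo] --> +oo ->
  Num.sqrt (a n) @[n --> \oo] --> +oo.
Proof.
move=> /cvgryPgt aoo; apply/cvgryPgt => A; have := aoo (A ^+ 2).
apply: filterS => n An; have [A0|A0] := leP 0 A.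
  rewrite -(@ltr_pXn2r _ 2)// ?nnegrE ?sqrtr_ge0// sqr_sqrtr//.
  by apply: ltW; apply: le_lt_trans An; exact: sqr_ge0.
by rewrite (lt_le_trans A0)// sqrtr_ge0.
Qed.

Lemma v_Gamma_gtpi u : 0 < u < 2 * pi -> pi < v_Gamma u.
Proof.
move=> /andP[u0 u2]; have pi0 := @pi_gt0 R.
have s0 : 0 < sin (u / 2) by apply: sin_gt0_pi; lra.
rewrite v_GammaE ?gt_eqF//; have := atan_gtNpi2 (3 * (cos (u / 2) / sin (u / 2))); lra.
Qed.

(** Comparing atan (3 cot (u / 2)) with - pi / 3 amounts to the sign of sin (u / 2 + pi / 3), which
    changes at u = 4 pi / 3. There the curve crosses the side v = 4 pi / 3 of the box. *)
Lemma v_Gamma_cmp u : 0 < u < 2 * pi ->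
  (4 * pi / 3 < u -> v_Gamma u < 4 * pi / 3) /\
  (u < 4 * pi / 3 -> 4 * pi / 3 < v_Gamma u).
Proof.
move=> /andP[u0 u2]; have pi0 := @pi_gt0 R.
have s0 : 0 < sin (u / 2) by apply: sin_gt0_pi; lra.
have q3 : 0 < Num.sqrt 3 :> R by rewrite sqrtr_gt0.
have q33 : Num.sqrt 3 * Num.sqrt 3 = 3 :> R by rewrite -expr2 sqr_sqrtr.
have E : sin (u / 2 + pi / 3) = (sin (u / 2) + Num.sqrt 3 * cos (u / 2)) / 2.
  by rewrite sinD cos_pi3 sin_pi3; field.
have aE : - (pi / 3) = atan (- Num.sqrt 3) :> R by rewrite atanN atan_sqrt3.
rewrite v_GammaE ?gt_eqF//; split => h.
- suff : atan (3 * (cos (u / 2) / sin (u / 2))) < - (pi / 3) by lra.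
  rewrite aE; apply: lt_atan; rewrite mulrA ltr_pdivrMr//.
  have : 0 < sin (u / 2 + pi / 3 - pi) by apply: sin_gt0_pi; lra.
  rewrite sinB cospi sinpi mulr0 subr0 mulrN1 E => h2.
  have : 0 < Num.sqrt 3 * (- ((sin (u / 2) + Num.sqrt 3 * cos (u / 2)) / 2)).
    exact: mulr_gt0.
  have -> : 3 * cos (u / 2) = Num.sqrt 3 * Num.sqrt 3 * cos (u / 2) by rewrite q33.
  lra.
- suff : - (pi / 3) < atan (3 * (cos (u / 2) / sin (u / 2))) by lra.
  rewrite aE; apply: lt_atan; rewrite mulrA ltr_pdivlMr//.
  have : 0 < sin (u / 2 + pi / 3) by apply: sin_gt0_pi; lra.
  rewrite E => h2.
  have : 0 < Num.sqrt 3 * ((sin (u / 2) + Num.sqrt 3 * cos (u / 2)) / 2).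
    exact: mulr_gt0.
  have -> : 3 * cos (u / 2) = Num.sqrt 3 * Num.sqrt 3 * cos (u / 2) by rewrite q33.
  lra.
Qed.

Lemma arm_on_Gamma u : pi <= u <= 3 * pi / 2 ->
  arm_re u (v_Gamma u) = - cos (v_Gamma u) /\
  arm_im u (v_Gamma u) = - sin (v_Gamma u).
Proof.
move=> uI; have [A [f [_ _ _ [_ _ LE]]]] := v_Gamma_branch uI.
by rewrite arm_reE arm_imE LE subrr mul0r sin0 !(mulr0, mul0r) !addr0.
Qed.

(** On the curve S = e^(i (v - pi)), and v - pi lies in ]0, pi / 3[, inside the range of atan. *)
Lemma arg_on_Gamma u : 4 * pi / 3 < u <= 3 * pi / 2 ->
  0 < arm_re u (v_Gamma u) /\
  atan (arm_im u (v_Gamma u) / arm_re u (v_Gamma u)) = v_Gamma u - pi.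
Proof.
move=> /andP[u1 u2]; have pi0 := @pi_gt0 R.
have [-> ->] : arm_re u (v_Gamma u) = - cos (v_Gamma u) /\
  arm_im u (v_Gamma u) = - sin (v_Gamma u) by apply: arm_on_Gamma; lra.
have v1 : pi < v_Gamma u by apply: v_Gamma_gtpi; lra.
have v2 : v_Gamma u < 4 * pi / 3 by apply: (v_Gamma_cmp _).1 => //; lra.
have cE : - cos (v_Gamma u) = cos (v_Gamma u - pi).
  by rewrite cosB cospi sinpi; ring.
have sE : - sin (v_Gamma u) = sin (v_Gamma u - pi).
  by rewrite sinB cospi sinpi; ring.
rewrite cE sE; split; first by apply: cos_gt0_pihalf; lra.
by apply: tanK; rewrite in_itv/=; lra.
Qed.

(** (u + v) / 2 lies in [pi, 17 pi / 12], so its cosine stays at distance at least cos (5 pi / 12)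
    from 0. The other factor is [A] times the sine of (v - v_Gamma u) / 2, an angle of modulus at
    most pi / 2, to which Jordan's inequality applies. *)
Lemma arm_sqr_regular_ge u v : pi <= u <= 3 * pi / 2 -> pi <= v <= 4 * pi / 3 ->
  (8 * cos (5 * pi / 12) / pi * (v - v_Gamma u)) ^+ 2 <= (arm_sqr u v - 1) ^+ 2.
Proof.
move=> uI vI; have pi0 := @pi_gt0 R.
have [A [f [vE fI A1 [_ _ LE]]]] := v_Gamma_branch uI.
rewrite arm_sqrE LE addrAC subrr add0r.
set c0 := cos (5 * pi / 12).
have c0_ge0 : 0 <= c0 by apply: cos_ge0_pihalf; lra.
have c1 : c0 <= - cos ((u + v) / 2).
  have -> : - cos ((u + v) / 2) = cos ((u + v) / 2 - pi).
    by rewrite cosB cospi sinpi; ring.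
  have [->//|ne] := eqVneq ((u + v) / 2 - pi) (5 * pi / 12).
  by rewrite ltW// ltr_cos ?in_itv/= ?lt_neqAle ?ne/=; lra.
have s1 : (2 / pi * ((v - v_Gamma u) / 2)) ^+ 2 <= sin ((v - v_Gamma u) / 2) ^+ 2.
  by apply: sqr_sin_ge; rewrite ler_norml vE; lra.
have -> : 8 * c0 / pi * (v - v_Gamma u) =
  8 * c0 * (2 / pi * ((v - v_Gamma u) / 2)) by field_pi R.
have -> : 8 * cos ((u + v) / 2) * (A * sin ((v - v_Gamma u) / 2)) =
  (8 * cos ((u + v) / 2) * A) * sin ((v - v_Gamma u) / 2) by ring.
move: s1; set x := 2 / pi * _; set y := sin _ => s1.
rewrite [(8 * c0 * x) ^+ 2]exprMn [(_ * y) ^+ 2]exprMn.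
apply: ler_pM => //; try exact: sqr_ge0.
rewrite -(sqrrN (8 * _ * A)) -mulNr -mulrN ler_pXn2r ?nnegrE ?mulr_ge0//.
- rewrite -[X in X <= _]mulr1; apply: ler_pM => //; first exact: mulr_ge0.
  by rewrite ler_pM2l.
- exact: le_trans c1.
- exact: le_trans A1.
Qed.

Lemma arm_sqr_regular_cvg (a : nat -> R) u t : (forall n, 0 < a n) ->
  a n @[n --> \oo] --> +oo -> pi <= u <= 3 * pi / 2 ->
  a n * (arm_sqr u (t / a n + v_Gamma u) - 1) @[n --> \oo] --> 4 * t * sin u.
Proof.
move=> a0 aoo uI; have [A [f [vE fI A1 [Ac As LE]]]] := v_Gamma_branch uI.
apply: (@cvg_ext _ _ (fun n => 8 * cos ((u + (t / a n + v_Gamma u)) / 2) *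
    (A * (a n * sin (t / 2 / a n))))).
  move=> n; rewrite arm_sqrE LE.
  have -> : (t / a n + v_Gamma u - v_Gamma u) / 2 = t / 2 / a n.
    by rewrite addrK mulrAC.
  ring.
have -> : 4 * t * sin u = 8 * cos ((u + (0 + v_Gamma u)) / 2) * (A * (t / 2)).
  rewrite vE add0r; have -> : (u + (2 * pi - 2 * f)) / 2 = (u / 2 - f) + pi by field.
  rewrite cosDpi cosB.
  have -> : sin u = 2 * sin (u / 2) * cos (u / 2).
    have {1}-> : u = u / 2 + u / 2 by field.
    by rewrite sinD; ring.
  (* A cos (u / 2 - f) is expanded, and the phase relations turn it into - 2 sin (u / 2) cos (u / 2)
     = - sin u: this is the slope of rho^2 across the curve. *)
  transitivity (- 4 * t * (cos (u / 2) * (A * cos f) + sin (u / 2) * (A * sin f))).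
    rewrite Ac As; ring.
  by field.
apply: cvgM; last by apply: cvgMr; exact: cvg_sin_scaled.
apply: cvgMr.
have h : (u + (t / a n + v_Gamma u)) / 2 @[n --> \oo] -->
    (u + (0 + v_Gamma u)) / 2.
  apply: cvgMl; apply: cvgD; first exact: cvg_cst.
  apply: cvgD; last exact: cvg_cst.
  by rewrite -(mulr0 t); apply: cvgMr; exact: cvgV_pinfty.
exact: (cvg_comp _ _ h (@continuous_cos R _)).
Qed.

Lemma arm_sqr_crossing_cvg (a : nat -> R) x y : (forall n, 0 < a n) ->
  a n @[n --> \oo] --> +oo ->
  a n ^+ 2 * (arm_sqr (x / a n) (y / a n + pi) - 1) @[n --> \oo] -->
  2 * (x ^+ 2 + 4 * x * y + 3 * y ^+ 2).
Proof.
move=> a0 aoo.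
have -> : 2 * (x ^+ 2 + 4 * x * y + 3 * y ^+ 2) =
  8 * ((x + y) / 2) * ((x + y) / 2 + 2 * cos 0 * (y / 2)).
  by rewrite cos0; field.
apply: (@cvg_ext _ _ (fun n => 8 * (a n * sin ((x + y) / 2 / a n)) *
    (a n * sin ((x + y) / 2 / a n) + 2 * cos (x / 2 / a n) *
      (a n * sin (y / 2 / a n))))).
  move=> n; rewrite [_ + pi]addrC arm_sqr_crossing.
  have -> : (x / a n + y / a n) / 2 = (x + y) / 2 / a n by ring.
  have -> : x / a n / 2 = x / 2 / a n by ring.
  have -> : y / a n / 2 = y / 2 / a n by ring.
  ring.
have h : x / 2 / a n @[n --> \oo] --> (0 : R).
  by rewrite -(mulr0 (x / 2)); apply: cvgMr; exact: cvgV_pinfty.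
apply: cvgM; first by apply: cvgMr; exact: cvg_sin_scaled.
apply: cvgD; first exact: cvg_sin_scaled.
apply: cvgM; last exact: cvg_sin_scaled.
by apply: cvgMr; exact: (cvg_comp _ _ h (@continuous_cos R _)).
Qed.

End RadiusEstimates.

Lemma indic_in {R : realType} (A : set R) z : A z -> \1_A z = 1 :> R.
Proof. by move=> Az; rewrite indicE mem_set. Qed.

Lemma indic_out {R : realType} (A : set R) z : ~ A z -> \1_A z = 0 :> R.
Proof. by move=> Az; rewrite indicE memNset. Qed.

(** * Limits of the rescaled integrals over the two regions *)

Section Asymptotics.
Context {R : realType}.
Local Notation mu := (@lebesgue_measure R).
Variables (F : R * R * R -> R) (M : R).
Hypotheses (cF : continuous F) (F0 : forall x, 0 <= F x) (FM : forall x, F x <= M).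
Hypothesis FT : forall x u v, F (x + 2 * pi, u, v) = F (x, u, v).

Lemma inner_bound_ge0 : 0 <= @inner_bound R.
Proof. exact: sqrtr_ge0. Qed.

Let M0 : 0 <= M. Proof. exact: le_trans (FM (0, 0, 0)). Qed.

(** Common skeleton of both regimes. The prefactor z = a^2 is [a], spent on the q_1 integral, times
    the Jacobian b1 b2, which factors as (sqrt a) (sqrt a) at the corner and as 1 times a along the
    curve. *)
Lemma rescaled_slices_cvg (a b1 b2 : nat -> R) (d : R -> R) (D1 D2 : set R)
    (h1 h2 : R -> R) (l : R * R -> \bar R) :
  (forall n, 0 < a n) -> (forall n, 0 < b1 n) -> (forall n, 0 < b2 n) ->
  (forall n, a n ^+ 2 = a n * (b1 n * b2 n)) ->
  measurable D1 -> measurable D2 -> measurable_fun setT d ->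
  (forall x, 0 <= h1 x) -> (forall x, 0 <= h2 x) ->
  mu.-integrable setT (EFin \o h1) -> mu.-integrable setT (EFin \o h2) ->
  (forall n x y, D1 (x / b1 n) -> D2 (y / b2 n + d (x / b1 n)) ->
    ((a n)%:E * slice_integral F (a n) (x / b1 n, y / b2 n + d (x / b1 n))%R <=
     (h1 x * h2 y)%:E)%E) ->
  (forall x y, ((a n)%:E * slice_integral F (a n) (x / b1 n, y / b2 n + d (x / b1 n))%R *
     (\1_D1 (x / b1 n) * \1_D2 (y / b2 n + d (x / b1 n)))%R%:E)%E
     @[n --> \oo] --> l (x, y)) ->
  ((a n ^+ 2)%:E * \int[mu]_(u in D1) \int[mu]_(v in D2)
     slice_integral F (a n) (u, v))%E @[n --> \oo] -->
  (\int[mu]_x \int[mu]_y l (x, y))%E.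
Proof.
move=> a0 b10 b20 aE mD1 mD2 md h10 h20 i1 i2 bd lim.
pose r n (p : R * R) : \bar R := ((a n)%:E *
  slice_integral F (a n) (p.1 / b1 n, p.2 / b2 n + d (p.1 / b1 n))%R *
     (\1_D1 (p.1 / b1 n) * \1_D2 (p.2 / b2 n + d (p.1 / b1 n)))%R%:E)%E.
have s0 := slice_integral_ge0 F0.
have mx n : measurable_fun [set: R * R] (fun p : R * R => p.1 / b1 n).
  by apply: (measurable_funM measurable_fst).
have my n : measurable_fun [set: R * R]
    (fun p : R * R => p.2 / b2 n + d (p.1 / b1 n)).
  apply: measurable_funD; first by apply: (measurable_funM measurable_snd).
  exact: (measurableT_comp md (mx n)).
have mr n : measurable_fun [set: R * R] (r n).
  apply: emeasurable_funM.
    apply: measurable_funeM.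
    apply: (measurableT_comp (measurable_slice_integral cF F0 (a n))).
    exact: measurable_fun_pair.
  apply/measurable_EFinP; apply: measurable_funM.
  - exact: (measurableT_comp (measurable_indic mD1) (mx n)).
  - exact: (measurableT_comp (measurable_indic mD2) (my n)).
have rE n : ((a n ^+ 2)%:E * \int[mu]_(u in D1) \int[mu]_(v in D2)
     slice_integral F (a n) (u, v) = \int[mu]_x \int[mu]_y r n (x, y))%E.
  rewrite aE EFinM -muleA.
  rewrite (ge0_integral_rescale2 (b10 n) (b20 n) mD1 mD2 md)//; last first.
    exact: measurable_slice_integral.
  pose s (p : R * R) : \bar R :=
    (slice_integral F (a n) (p.1 / b1 n, p.2 / b2 n + d (p.1 / b1 n))%R *
     (\1_D1 (p.1 / b1 n) * \1_D2 (p.2 / b2 n + d (p.1 / b1 n)))%R%:E)%E.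
  have ms : measurable_fun [set: R * R] s.
    apply: emeasurable_funM.
      apply: (measurableT_comp (measurable_slice_integral cF F0 (a n))).
      exact: measurable_fun_pair.
    apply/measurable_EFinP; apply: measurable_funM.
    - exact: (measurableT_comp (measurable_indic mD1) (mx n)).
    - exact: (measurableT_comp (measurable_indic mD2) (my n)).
  have s_ge0 p : (0 <= s p)%E by rewrite mule_ge0// lee_fin mulr_ge0.
  rewrite (ge0_iterated_integralZl (ltW (a0 n)) ms s_ge0).
  by apply: eq_integral => x _; apply: eq_integral => y _; rewrite /r/= muleA.
rewrite (_ : (fun n => _) = (fun n => \int[mu]_x \int[mu]_y r n (x, y))%E); last first.
  by apply/funext => n; exact: rE.
apply: (iterated_dominated_cvg mr _ h10 h20 i1 i2); last by move=> [x y]; exact: lim.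
move=> n [x y]; rewrite /r/=; apply/andP; split.
  by rewrite !mule_ge0// ?lee_fin ?mulr_ge0// ltW.
rewrite !indicE; case: (boolP (x / b1 n \in D1)) => [|_]; last first.
  by rewrite mul0r mule0 lee_fin mulr_ge0.
case: (boolP (_ \in D2)) => [|_]; last first.
  by rewrite mulr0 mule0 lee_fin mulr_ge0.
by rewrite mulr1 mule1 => /set_mem D2y /set_mem D1x; exact: bd.
Qed.

Lemma fold_cvg (a : nat -> R) : (forall n, 0 < a n) -> a n @[n --> \oo] --> +oo ->
  ((a n ^+ 2)%:E * \int[mu]_(u in `[0%R, pi[) \int[mu]_(v in `[pi, (4 * pi / 3)%R])
     slice_integral F (a n) (u, v))%E @[n --> \oo] -->
  (\int[mu]_x \int[mu]_y (F (0, 0, pi) *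
     expR (- ((x ^+ 2 + 4 * x * y + 3 * y ^+ 2) ^+ 2 / 2)) * Num.sqrt (2 * pi) *
     (\1_(`[0%R, +oo[%classic) x * \1_(`[0%R, +oo[%classic) y))%:E)%E.
Proof.
move=> a0 aoo; have pi0 := @pi_gt0 R.
pose b n := Num.sqrt (a n).
have b0 n : 0 < b n by rewrite sqrtr_gt0.
have bb n : b n ^+ 2 = a n by rewrite sqr_sqrtr// ltW.
have boo : b n @[n --> \oo] --> +oo by exact: sqrt_pinfty.
(* [c] is hidden behind an equation so that arithmetic treats it as an atom. Its value is (2 /
   pi^2)^2 / (4 * 49), from [arm_sqr_crossing_ge], the exponent a^2 / 4 and [radius_sub1_ge]. *)
have [c c0 cE] : exists2 c : R, 0 < c & c = 1 / (49 * pi ^+ 4).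
  by eexists; [|reflexivity]; rewrite divr_gt0// mulr_gt0// exprn_gt0.
pose C := M * @inner_bound R * expR (2 * c).
have C0 : 0 <= C by rewrite !mulr_ge0 ?expR_ge0 ?inner_bound_ge0.
have i2 : mu.-integrable setT (EFin \o (fun x => expR (- (2 * c * x ^+ 2)))).
  by apply: integrable_gauss_scaled; exact: mulr_gt0.
have D1E n x : (`[0, pi[%classic : set R) (x / b n) -> 0 <= x /\ x / b n <= pi.
  rewrite /= in_itv/= => /andP[x0 /ltW xp]; split => //.
  by move: x0; rewrite ler_pdivlMr// mul0r.
have D2E n y : (`[pi, 4 * pi / 3]%classic : set R) (y / b n + pi) ->
    0 <= y /\ y / b n <= pi / 3.
  rewrite /= in_itv/= => /andP[y0 yp]; split; last by lra.
  by move: y0; rewrite lerDr ler_pdivlMr// mul0r.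
have := @rescaled_slices_cvg a b b (fun=> pi) `[0, pi[%classic `[pi, 4 * pi / 3]%classic
  (fun x => C * expR (- (2 * c * x ^+ 2))) (fun y => expR (- (2 * c * y ^+ 2)))
  (fun p => (F (0, 0, pi) *
     expR (- ((p.1 ^+ 2 + 4 * p.1 * p.2 + 3 * p.2 ^+ 2) ^+ 2 / 2)) * Num.sqrt (2 * pi) *
     (\1_(`[0%R, +oo[%classic) p.1 * \1_(`[0%R, +oo[%classic) p.2))%:E).
apply => //.
- by move=> n; rewrite -expr2 bb expr2.
- by move=> x; rewrite mulr_ge0// expR_ge0.
- rewrite (_ : EFin \o _ = (fun x => C%:E * (expR (- (2 * c * x ^+ 2)))%:E)%E)//.
  exact: integrableZl.
- move=> n x y /D1E[x0 xp] /D2E[y0 yp].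
  apply: (le_trans (slice_integral_le cF F0 FM FT _ (a0 n))).
  rewrite lee_fin/= mulrAC /C -(mulrA _ (expR (2 * c))) -[X in _ <= X]mulrA.
  apply: ler_wpM2l; first by rewrite mulr_ge0 ?inner_bound_ge0.
  rewrite -!expRD ler_expR.
  have u0 : 0 <= x / b n by rewrite divr_ge0// ltW.
  have v0 : 0 <= y / b n by rewrite divr_ge0// ltW.
  have uI : 0 <= x / b n <= pi by rewrite u0.
  have vI : 0 <= y / b n <= pi / 3 by rewrite v0.
  have := arm_sqr_crossing_ge uI vI; rewrite [pi + _]addrC.
  have := radius_sub1_ge (x / b n) (y / b n + pi).
  set W := arm_sqr _ _; set r := (radius _ _ - 1) ^+ 2.
  have -> : 2 / pi ^+ 2 * (x / b n + y / b n) ^+ 2 = 2 / pi ^+ 2 * (x + y) ^+ 2 / a n.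
    by rewrite -mulrDl exprMn exprVn bb mulrA.
  set q := 2 / pi ^+ 2 * (x + y) ^+ 2 => hr hW.
  have q0 : 0 <= q / a n.
    by rewrite divr_ge0 ?(ltW (a0 n))// mulr_ge0 ?sqr_ge0// divr_ge0// sqr_ge0.
  have h1 : (q / a n) ^+ 2 <= (W - 1) ^+ 2 by rewrite ler_pXn2r ?nnegrE//; lra.
  have h2 : q ^+ 2 / 196 <= a n ^+ 2 / 4 * r.
    have -> : q ^+ 2 / 196 = a n ^+ 2 / 4 * ((q / a n) ^+ 2 / 49).
      by field; rewrite gt_eqF.
    apply: ler_wpM2l; first by rewrite divr_ge0// sqr_ge0.
    by apply: le_trans hr; lra.
  have h3 : q ^+ 2 / 196 = c * (x + y) ^+ 4 by rewrite /q cE; field_pi R.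
  (* In the quadrant (x + y)^4 >= x^4 + y^4, and x^4 >= 2 x^2 - 1 replaces the quartic exponent by a
     Gaussian one that separates [x] from [y]. The two constants -1 account for the factor expR (2
     c) in [C]. *)
  have h4 : c * (2 * x ^+ 2 - 1 + (2 * y ^+ 2 - 1)) <= c * (x + y) ^+ 4.
    rewrite ler_pM2l//.
    have p1 := mulr_ge0 x0 y0; have p2 := sqr_ge0 (x ^+ 2 - 1).
    have p3 := sqr_ge0 (y ^+ 2 - 1); have p4 := mulr_ge0 p1 (sqr_ge0 x).
    have p5 := mulr_ge0 p1 (sqr_ge0 y); have p6 := sqr_ge0 (x * y).
    lra.
  lra.
- move=> x y /=.
  have [x0|x0] := leP 0 x; last first.
    rewrite (indic_out (z := x)) ?mul0r ?mulr0; last first.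
      by rewrite /= in_itv/= andbT leNgt x0.
    apply: cvg_near_cst; apply: nearW => n.
    rewrite (indic_out (z := x / b n)) ?mul0r ?mule0// => /D1E[x1 _].
    by move: x0; rewrite ltNge x1.
  have [y0|y0] := leP 0 y; last first.
    rewrite (indic_out (z := y)) ?mulr0; last first.
      by rewrite /= in_itv/= andbT leNgt y0.
    apply: cvg_near_cst; apply: nearW => n.
    rewrite (indic_out (z := y / b n + pi)) ?mulr0 ?mule0// => /D2E[y1 _].
    by move: y0; rewrite ltNge y1.
  rewrite (indic_in (z := x)) ?(indic_in (z := y)) ?mulr1; last 2 first.
  - by rewrite /= in_itv/= y0.
  - by rewrite /= in_itv/= x0.
  have xb : x / b n @[n --> \oo] --> (0 : R).
    by rewrite -(mulr0 x); apply: cvgMr; exact: cvgV_pinfty.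
  have yb : y / b n + pi @[n --> \oo] --> (pi : R).
    rewrite -[X in _ --> X]add0r; apply: cvgD (cvg_cst _).
    by rewrite -(mulr0 y); apply: cvgMr; exact: cvgV_pinfty.
  (* S(0, pi) = 1, so the limiting first angle is 0, as in [q0]. *)
  have re : arm_re 0 pi = 1 :> R by rewrite /arm_re add0r cos0 cospi; ring.
  have im : arm_im 0 pi = 0 :> R by rewrite /arm_im add0r sin0 sinpi; ring.
  have rad : a n * (radius (arm_re (x / b n) (y / b n + pi))
      (arm_im (x / b n) (y / b n + pi)) - 1) @[n --> \oo] -->
      x ^+ 2 + 4 * x * y + 3 * y ^+ 2.
    have -> : x ^+ 2 + 4 * x * y + 3 * y ^+ 2 =
      2 * (x ^+ 2 + 4 * x * y + 3 * y ^+ 2) / 2 by field.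
    apply: sqrt_sub1_cvg => //.
      by move=> n; rewrite addr_ge0// sqr_ge0.
    apply: (@cvg_ext _ _ (fun n =>
        b n ^+ 2 * (arm_sqr (x / b n) (y / b n + pi) - 1))).
      by move=> n; rewrite bb.
    exact: arm_sqr_crossing_cvg.
  have re0 : 0 < arm_re 0 pi :> R by rewrite re.
  have := slice_integral_cvg cF F0 FM FT a0 aoo xb yb re0 rad.
  rewrite im mul0r atan0 oppr0; apply: cvg_trans; apply: near_eq_cvg; near=> n.
  rewrite (indic_in (z := x / b n)) ?(indic_in (z := y / b n + pi)).
  - by rewrite mulr1 mule1.
  - rewrite /= in_itv/= lerDr divr_ge0 ?(ltW (b0 n))//=; near: n.
    by apply: (cvgr_le _ yb); lra.
  - rewrite /= in_itv/= divr_ge0 ?(ltW (b0 n))//=; near: n.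
    exact: (cvgr_lt _ xb).
Unshelve. all: by end_near. Qed.

(** At u = 4 pi / 3 the curve sits on the side v = 4 pi / 3 and only half of the rescaled [v] line
    stays in the box, so the pointwise limit has another form there. This null point is left out. *)
Definition regular_angles : set R := `[pi, 4 * pi / 3[ `|` `]4 * pi / 3, 3 * pi / 2].

Lemma regular_cvg (a : nat -> R) : (forall n, 0 < a n) -> a n @[n --> \oo] --> +oo ->
  ((a n ^+ 2)%:E * \int[mu]_(u in regular_angles) \int[mu]_(v in `[pi, (4 * pi / 3)%R])
     slice_integral F (a n) (u, v))%E @[n --> \oo] -->
  (\int[mu]_x \int[mu]_y (F (pi - v_Gamma x, x, v_Gamma x) *
     expR (- ((2 * y * sin x) ^+ 2 / 2)) * Num.sqrt (2 * pi) *
     \1_(`](4 * pi / 3)%R, (3 * pi / 2)%R]%classic) x)%:E)%E.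
Proof.
move=> a0 aoo; have pi0 := @pi_gt0 R.
have [c0 c0_gt0 c0E] : exists2 c : R, 0 < c & c = cos (5 * pi / 12).
  by eexists; [|reflexivity]; apply: cos_gt0_pihalf; lra.
(* The value is (8 c0 / pi)^2 / (4 * 49), from [arm_sqr_regular_ge], the exponent a^2 / 4 and
   [radius_sub1_ge]. *)
have [c c_gt0 cE] : exists2 c : R, 0 < c & c = 16 * c0 ^+ 2 / (49 * pi ^+ 2).
  by eexists; [|reflexivity]; rewrite divr_gt0// mulr_gt0// exprn_gt0.
pose C := M * @inner_bound R.
have C0 : 0 <= C by rewrite mulr_ge0 ?inner_bound_ge0.
(* [v_Gamma] is continuous on ]0, 2 pi[; extension by 0 gives a function measurable on the whole
   line. *)
pose d : R -> R := (@v_Gamma R) \_ `]0, 2 * pi[%classic.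
have dE u : 0 < u < 2 * pi -> d u = v_Gamma u.
  by move=> uI; rewrite /d patchE mem_set//= in_itv.
have md : measurable_fun setT d.
  have mD : measurable (`]0, 2 * pi[%classic : set R) by exact: measurable_itv.
  apply: (measurable_restrictT _ mD).1.
  apply: open_continuous_measurable_fun; first exact: interval_open.
  by move=> u /set_mem; rewrite /= in_itv/=; exact: continuous_v_Gamma.
have D1E x : regular_angles x -> pi <= x <= 3 * pi / 2.
  by rewrite /regular_angles/= => -[]/=; rewrite in_itv/=; lra.
have mD1 : measurable regular_angles by apply: measurableU; exact: measurable_itv.
have := @rescaled_slices_cvg a (fun=> 1) a d regular_angles `[pi, 4 * pi / 3]%classic
  (fun x => C * \1_(`[pi, 3 * pi / 2]%classic : set R) x) (fun y => expR (- (c * y ^+ 2)))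
  (fun p => (F (pi - v_Gamma p.1, p.1, v_Gamma p.1) *
     expR (- ((2 * p.2 * sin p.1) ^+ 2 / 2)) * Num.sqrt (2 * pi) *
     \1_(`](4 * pi / 3)%R, (3 * pi / 2)%R]%classic) p.1)%:E).
apply => //.
- by move=> n; rewrite mul1r expr2.
- by move=> x; rewrite mulr_ge0.
- exact: (integrableZl measurableT C (integrable_indic_itv _ _ _ _)).
- exact: integrable_gauss_scaled.
- move=> n x y; rewrite divr1 => /D1E xI; rewrite dE; last by lra.
  rewrite /= in_itv/= => yI.
  apply: (le_trans (slice_integral_le cF F0 FM FT _ (a0 n))).
  rewrite indic_in; last by rewrite /= in_itv.
  rewrite lee_fin/= mulr1 mulrAC; apply: ler_wpM2l => //; rewrite ler_expR.
  have := arm_sqr_regular_ge xI yI; have := radius_sub1_ge x (y / a n + v_Gamma x).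
  rewrite addrK -c0E; set W := arm_sqr _ _; set r := (radius _ _ - 1) ^+ 2.
  move=> hr hW; rewrite mulNr lerN2.
  have -> : c * y ^+ 2 = a n ^+ 2 / 4 * ((8 * c0 / pi * (y / a n)) ^+ 2 / 49).
    have an0 : a n != 0 by rewrite gt_eqF.
    by rewrite cE; field_pi R.
  apply: ler_wpM2l; first by rewrite divr_ge0// sqr_ge0.
  by apply: le_trans hr; rewrite ler_pM2r// invr_gt0.
- move=> x y /=; rewrite divr1.
  have [|xD] := pselect (regular_angles x); last first.
    rewrite (indic_out (z := x)) ?mulr0; last by move=> h; apply: xD; right.
    apply: cvg_near_cst; apply: nearW => n.
    by rewrite (indic_out xD) mul0r mule0.
  move=> xD; have xI := D1E _ xD; rewrite dE; last by lra.
  have yv : y / a n + v_Gamma x @[n --> \oo] --> v_Gamma x.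
    rewrite -[X in _ --> X]add0r; apply: cvgD (cvg_cst _).
    by rewrite -(mulr0 y); apply: cvgMr; exact: cvgV_pinfty.
  have x02 : 0 < x < 2 * pi by lra.
  (* For u < 4 pi / 3 the rescaled [v] tends to v_Gamma u > 4 pi / 3, above the box, so the
     indicator is eventually 0. *)
  case: (xD) => /= xJ; move: (xJ); rewrite in_itv/= => /andP[x1 x2].
    rewrite (indic_out (z := x)) ?mulr0; last by rewrite /= in_itv/=; lra.
    apply: cvg_near_cst; near=> n.
    rewrite (indic_out (z := y / a n + v_Gamma x)) ?mulr0 ?mule0//.
    rewrite /= in_itv/= => /andP[_]; apply/negP; rewrite -ltNge; near: n.
    by apply: (cvgr_gt _ yv); exact: (v_Gamma_cmp x02).2.
  have xJ' : 4 * pi / 3 < x <= 3 * pi / 2 by rewrite x1.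
  have [re0 arg] := arg_on_Gamma xJ'.
  have rad : a n * (radius (arm_re x (y / a n + v_Gamma x))
      (arm_im x (y / a n + v_Gamma x)) - 1) @[n --> \oo] --> 2 * y * sin x.
    have -> : 2 * y * sin x = 4 * y * sin x / 2 by field.
    apply: sqrt_sub1_cvg => //.
      by move=> n; rewrite addr_ge0// sqr_ge0.
    exact: arm_sqr_regular_cvg.
  have xx : (fun _ : nat => x) n @[n --> \oo] --> x by exact: cvg_cst.
  have := slice_integral_cvg cF F0 FM FT a0 aoo xx yv re0 rad.
  rewrite arg opprB indic_in// mulr1; apply: cvg_trans; apply: near_eq_cvg; near=> n.
  rewrite (indic_in xD) indic_in ?mulr1 ?mule1//.
  rewrite /= in_itv/=; apply/andP; split; near: n.
  - by apply: (cvgr_ge _ yv); exact: v_Gamma_gtpi.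
  - by apply: (cvgr_le _ yv); exact: (v_Gamma_cmp x02).1.
Unshelve. all: by end_near. Qed.

End Asymptotics.

(** * The fold integral *)

Section FoldConstant.
Context {R : realType}.
Local Notation mu := (@lebesgue_measure R).

Lemma cvg_integral0_gauss :
  gauss_integral_proof.integral0_gauss x @[x --> +oo] --> (Num.sqrt pi / 2 : R).
Proof.
have : Num.sqrt (gauss_integral_proof.integral0_gauss x ^+ 2) @[x --> +oo] -->
    Num.sqrt (pi / 4 : R).
  apply: continuous_cvg; first exact: sqrt_continuous.
  exact: gauss_integral_proof.cvg_integral0_gauss_sqr.
have -> : Num.sqrt (pi / 4) = Num.sqrt pi / 2 :> R.
  by rewrite sqrtrM ?pi_ge0// sqrtrV// (_ : 4 = 2 ^+ 2) ?sqrtr_sqr ?ger0_norm//; ring.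
apply: cvg_trans; apply: near_eq_cvg; apply: nearW => x /=.
by rewrite sqrtr_sqr ger0_norm// gauss_integral_proof.integral0_gauss_ge0.
Qed.

(** The substitution t = k x^2, through the primitive G (k x^2) / (2 k) where G is the integral of
    exp (- t^2) from 0. *)
Lemma integral_quartic (k : R) : 0 < k ->
  (\int[mu]_(x in `[0%R, +oo[) (x * gauss_fun (k * x ^+ 2))%:E =
   (Num.sqrt pi / (4 * k))%:E)%E.
Proof.
move=> k0; pose G := @gauss_integral_proof.integral0_gauss R.
pose F (x : R) := (2 * k)^-1 * G (k * x ^+ 2).
have G0 : G 0 = 0.
  rewrite /G /gauss_integral_proof.integral0_gauss set_itv1.
  exact: Rintegral_set1.
have dG (x : R) : 0 < x -> is_derive x 1 G (gauss_fun x).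
  move=> x0; have [] := @continuous_FTC1_closed R gauss_fun 0 x (x + 1).
  - by rewrite ltrDl.
  - by apply: integrableS (@integrableT_gauss R).
  - exact: x0.
  - exact: continuous_gauss_fun.
  by move=> d <-; rewrite derive1E; apply: DeriveDef.
have dsq (x : R) : is_derive x 1 (fun x : R => k * x ^+ 2) (2 * k * x).
  by apply: is_derive_eq; rewrite /GRing.scale/=; ring.
have dF (x : R) : 0 < x -> is_derive x 1 F (x * gauss_fun (k * x ^+ 2)).
  move=> x0; have kx : 0 < k * x ^+ 2 by rewrite mulr_gt0// exprn_gt0.
  have dd : is_derive x 1 (G \o (fun x => k * x ^+ 2))
      (gauss_fun (k * x ^+ 2) * (2 * k * x)).
    exact: (@is_derive1_comp _ G (fun x => k * x ^+ 2) x _ _ (dG _ kx) (dsq x)).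
  rewrite /F; apply: is_derive_eq; rewrite /GRing.scale/=.
  by field; rewrite gt_eqF.
have cf : continuous (fun x : R => x * gauss_fun (k * x ^+ 2)).
  move=> x; apply: (@cvgM _ _ _ _ id) => //.
  apply: (@continuous_comp _ _ _ (fun x : R => k * x ^+ 2) gauss_fun).
    apply: differentiable_continuous; apply/derivable1_diffP.
    exact: (@ex_derive _ _ _ _ _ _ _ (dsq x)).
  exact: continuous_gauss_fun.
have xx : (x : R) ^+ 2 @[x --> +oo] --> +oo.
  apply/cvgryPge => A; near=> x.
  have x1 : 1 <= x by near: x; exact: nbhs_pinfty_ge.
  have xA : A <= x by near: x; apply: nbhs_pinfty_ge; rewrite num_real.
  by rewrite (le_trans xA)// expr2 ler_peMr// (le_trans _ x1).
rewrite (@ge0_continuous_FTC2y R _ F 0 ((2 * k)^-1 * (Num.sqrt pi / 2))).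
- rewrite /F expr0n/= mulr0 G0 mulr0 -EFinB subr0; congr EFin.
  by field; rewrite gt_eqF.
- by move=> x x0; rewrite mulr_ge0// expR_ge0.
- exact: continuous_subspaceT.
- apply: cvgMr; apply: (@cvg_comp _ _ _ (fun x : R => k * x ^+ 2) G _ +oo).
    exact: gt0_cvgMry.
  exact: cvg_integral0_gauss.
- by move=> x x0; exact: (@ex_derive _ _ _ _ _ _ _ (dF x x0)).
- rewrite /F expr0n/= mulr0 G0; apply: cvgMr.
  apply: (@cvg_comp _ _ _ (fun x : R => k * x ^+ 2) G _ (nbhs (0 : R))).
    apply: cvg_at_right_filter.
    have e0 : k * (0 : R) ^+ 2 = 0 by rewrite expr0n mulr0.
    suff : {for (0 : R), continuous (fun x : R => k * x ^+ 2)}.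
      by rewrite /prop_for /continuous_at /= e0.
    apply: differentiable_continuous; apply/derivable1_diffP; exact: (@ex_derive _ _ _ _ _ _ _ (dsq 0)).
  apply: (@parameterized_integral_cvg_left R 0 1 gauss_fun) => //.
  by apply: integrableS (@integrableT_gauss R).
- move=> x; rewrite in_itv/= andbT => x0; rewrite derive1E.
  exact: (@derive_val _ _ _ _ _ _ _ (dF x x0)).
Unshelve. all: by end_near. Qed.

(** Partial fractions: the denominator is (1 + 3 t) (1 + t), a primitive is ln ((1 + 3 t) / (1 + t))
    / 2, and the quotient in it rises from 1 to 3. *)
Lemma integral_fold_slope :
  (\int[mu]_(t in `[0%R, +oo[) ((1 + 4 * t + 3 * t ^+ 2)^-1)%:E =
   (ln 3 / 2)%:E)%E.
Proof.
pose F (t : R) := 2^-1 * (ln (1 + 3 * t) - ln (1 + t)).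
have dF (x : R) : 0 <= x -> is_derive x 1 F ((1 + 4 * x + 3 * x ^+ 2)^-1).
  move=> x0; have h1 : 0 < 1 + 3 * x by lra.
  have h2 : 0 < 1 + x by lra.
  have d1 : is_derive x 1 (fun x : R => 1 + 3 * x) 3.
    by apply: is_derive_eq; rewrite /GRing.scale/=; ring.
  have d2 : is_derive x 1 (fun x : R => 1 + x) 1.
    by apply: is_derive_eq; rewrite /GRing.scale/=; ring.
  have e1 := @is_derive1_comp _ (@ln R) _ x _ _ (is_derive1_ln h1) d1.
  have e2 := @is_derive1_comp _ (@ln R) _ x _ _ (is_derive1_ln h2) d2.
  have -> : F = 2^-1 \*: ((@ln R \o (fun x => 1 + 3 * x)) \- (@ln R \o (fun x => 1 + x))).
    by apply/funext.
  apply: is_derive_eq; rewrite /GRing.scale/=.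
  have -> : 1 + 4 * x + 3 * x ^+ 2 = (1 + 3 * x) * (1 + x) by ring.
  by field; rewrite !gt_eqF.
have cp (t : R) : 0 <= t -> 1 + 4 * t + 3 * t ^+ 2 != 0.
  by move=> t0; rewrite gt_eqF//; have := sqr_ge0 t; lra.
rewrite (@ge0_continuous_FTC2y R _ F 0 (ln 3 / 2)).
- by rewrite /F mulr0 !addr0 subrr mulr0 sube0.
- by move=> x x0; rewrite invr_ge0; have := sqr_ge0 x; lra.
- apply: continuous_in_subspaceT => x /set_mem; rewrite /= in_itv/= andbT => x0.
  apply: cvgV; first exact: cp.
  apply: cvgD.
    by apply: cvgD; [exact: cvg_cst|apply: cvgMr; exact: cvg_id].
  by apply: cvgMr; exact: exprn_continuous.
- have h : (3 - 2 * (1 + x)^-1) @[x --> +oo] --> (3 : R).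
    rewrite -[X in _ --> X]subr0; apply: cvgB; first exact: cvg_cst.
    rewrite -[X in _ --> X](mulr0 2); apply: cvgMr.
    apply/gtr0_cvgV0; first by near=> x; rewrite addr_gt0//; near: x; exact: nbhs_pinfty_gt.
    by apply/cvgryPge => A; near=> x; rewrite -lerBlDl; near: x; apply: nbhs_pinfty_ge; rewrite num_real.
  have : ln (3 - 2 * (1 + x)^-1) / 2 @[x --> +oo] --> (ln 3 / 2 : R).
    by apply: cvgMl; apply: (cvg_comp _ _ h (@continuous_ln _ _ _)).
  apply: cvg_trans; apply: near_eq_cvg; near=> x.
  have x0 : 0 < x by near: x; exact: nbhs_pinfty_gt.
  have h1 : 0 < 1 + 3 * x by lra.
  have h2 : 0 < 1 + x by lra.
  rewrite /F -ln_div ?posrE// mulrC; congr (_ * ln _).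
  by field; rewrite gt_eqF.
- by move=> x x0; exact: (@ex_derive _ _ _ _ _ _ _ (dF x (ltW x0))).
- apply: cvg_at_right_filter; apply: (@differentiable_continuous _ _ _ (0 : R) F).
  by apply/derivable1_diffP; exact: (@ex_derive _ _ _ _ _ _ _ (dF 0 (lexx 0))).
- move=> x; rewrite in_itv/= andbT => x0; rewrite derive1E.
  exact: (@derive_val _ _ _ _ _ _ _ (dF x (ltW x0))).
Unshelve. all: by end_near. Qed.

Definition fold_form (x y : R) : R := x ^+ 2 + 4 * x * y + 3 * y ^+ 2.

Let quadrant : set R := `[0, +oo[%classic.

Let m_quadrant : measurable quadrant.
Proof. exact: measurable_itv. Qed.

Lemma measurable_fold_form :
  measurable_fun [set: R * R] (fun p : R * R => fold_form p.1 p.2).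
Proof.
apply: measurable_funD.
  apply: measurable_funD; first by apply: measurable_funX; exact: measurable_fst.
  apply: measurable_funM; last exact: measurable_snd.
  by apply: measurable_funM => //; exact: measurable_fst.
by apply: measurable_funM => //; apply: measurable_funX; exact: measurable_snd.
Qed.

(** The form is homogeneous of degree 2, so y = x t turns it into x^2 p(t) with Jacobian x. After
    exchanging the order, the integral in [x] is [integral_quartic], and the integral of 1 / p that
    remains is [integral_fold_slope]. *)
Lemma integral_fold_form :
  (\int[mu]_x \int[mu]_y (expR (- (fold_form x y ^+ 2 / 2)) *
     (\1_quadrant x * \1_quadrant y))%:E = (Num.sqrt (2 * pi) * ln 3 / 8)%:E)%E.
Proof.
pose p (t : R) := 1 + 4 * t + 3 * t ^+ 2.
pose h (z : R * R) := (z.1 * expR (- ((z.1 ^+ 2 * p z.2) ^+ 2 / 2)) *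
   (\1_quadrant z.1 * \1_quadrant z.2))%:E.
have mexp (f : R * R -> R) : measurable_fun setT f ->
    measurable_fun setT (fun z => expR (- (f z ^+ 2 / 2))).
  move=> mf; apply: measurableT_comp => //; apply: measurableT_comp => //.
  by apply: measurable_funM => //; exact: measurable_funX.
have mq1 : measurable_fun [set: R * R] (fun z : R * R => \1_quadrant z.1 : R).
  exact: (measurableT_comp (measurable_indic m_quadrant) measurable_fst).
have mq2 : measurable_fun [set: R * R] (fun z : R * R => \1_quadrant z.2 : R).
  exact: (measurableT_comp (measurable_indic m_quadrant) measurable_snd).
have mp : measurable_fun [set: R * R] (fun z : R * R => p z.2).
  apply: measurable_funD.
    by apply: measurable_funD => //; apply: measurable_funM => //; exact: measurable_snd.
  by apply: measurable_funM => //; apply: measurable_funX; exact: measurable_snd.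
have mh : measurable_fun [set: R * R] h.
  apply/measurable_EFinP; apply: measurable_funM; last exact: measurable_funM.
  apply: measurable_funM; first exact: measurable_fst.
  apply: (mexp (fun z => z.1 ^+ 2 * p z.2)); apply: measurable_funM => //.
  by apply: measurable_funX; exact: measurable_fst.
have h0 z : (0 <= h z)%E.
  rewrite lee_fin /h indicE; case: (boolP (z.1 \in quadrant)); last first.
    by move=> _; rewrite mul0r mulr0.
  move=> /set_mem; rewrite /quadrant/= in_itv/= andbT => z1.
  by rewrite !mulr_ge0// expR_ge0.
have msec (c : R) (g : R -> R) : measurable_fun setT g ->
    measurable_fun setT (fun y => expR (- (fold_form c (g y) ^+ 2 / 2))).
  move=> mg; have mf := mexp _ measurable_fold_form.
  exact: (measurableT_comp mf (measurable_fun_pair (measurable_cst c) mg)).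
have inner_x (x : R) : 0 < x -> (\int[mu]_y (expR (- (fold_form x y ^+ 2 / 2)) *
     (\1_quadrant x * \1_quadrant y))%:E = \int[mu]_t h (x, t))%E.
  move=> x0; rewrite (@ge0_integral_affine _ x 0)//; last first.
    apply/measurable_EFinP; apply: measurable_funM; last first.
      by apply: measurable_funM => //; exact: measurable_indic.
    exact: (msec x id).
  rewrite -ge0_integralZl_EFin ?(ltW x0)//; last first.
    apply/measurable_EFinP; apply: measurable_funM; last first.
      apply: measurable_funM => //.
      by apply: (measurableT_comp (measurable_indic m_quadrant)); exact: measurable_affine.
    exact: (msec x _ (measurable_affine x 0)).
  apply: eq_integral => t _; rewrite -EFinM /h/= addr0 mulrA; congr (_ * expR (- (_ ^+ 2 / 2)) * (_ * _))%:E.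
    by rewrite /fold_form /p; ring.
  by rewrite !indicE !mem_setE !in_itv/= !andbT pmulr_rge0.
transitivity (\int[mu]_x \int[mu]_t h (x, t))%E.
  (* The substitution needs x > 0. The value at x = 0 is lost as a null set on one side, and on the
     other it vanishes by the factor [x] of [h]. *)
  transitivity (\int[mu]_(x in `]0%R, +oo[) \int[mu]_t h (x, t))%E; last first.
    rewrite integral_mkcond; apply: eq_integral => x _; rewrite patchE.
    case: ifPn => //; rewrite mem_setE in_itv/= andbT -leNgt => x0.
    rewrite integral0_eq// => t _; rewrite /h/=.
    have [->|xn0] := eqVneq x 0; first by rewrite !mul0r.
    rewrite (indic_out (z := x)) ?mul0r ?mulr0//.
    by rewrite /quadrant/= in_itv/= andbT; apply/negP; rewrite -ltNge lt_neqAle xn0.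
  transitivity (\int[mu]_(x in `]0%R, +oo[) (\int[mu]_y
    (expR (- (fold_form x y ^+ 2 / 2)) * (\1_quadrant x * \1_quadrant y))%:E))%E; last first.
    by apply: eq_integral => x /set_mem; rewrite /= in_itv/= andbT; exact: inner_x.
  have mA : measurable_fun setT (fun x => \int[mu]_y
      (expR (- (fold_form x y ^+ 2 / 2)) * (\1_quadrant x * \1_quadrant y))%:E)%E.
    apply: (measurable_section_integral (s := fun z : R * R =>
      (expR (- (fold_form z.1 z.2 ^+ 2 / 2)) * (\1_quadrant z.1 * \1_quadrant z.2))%:E) measurableT).
    - apply/measurable_EFinP; apply: measurable_funM; last exact: measurable_funM.
      exact: (mexp _ measurable_fold_form).
    - by move=> z; rewrite lee_fin !mulr_ge0// expR_ge0.
  rewrite integral_itv_obnd_cbnd; last exact: measurable_funTS.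
  rewrite [RHS]integral_mkcond; apply: eq_integral => x _; rewrite patchE.
  case: ifPn => //; rewrite -/quadrant => xq; rewrite integral0_eq// => y _.
  by rewrite indicE (negbTE xq) mul0r mulr0.
rewrite (@fubini_tonelli _ _ (measurableTypeR R) (measurableTypeR R) R mu mu h mh h0).
transitivity (\int[mu]_(t in quadrant) ((Num.sqrt (2 * pi) / 4)%:E * ((p t)^-1)%:E))%E; last first.
  rewrite ge0_integralZl_EFin//; last 2 first.
  - by move=> t; rewrite /quadrant/= in_itv/= andbT lee_fin invr_ge0 /p => t0; have := sqr_ge0 t; lra.
  - apply: (iffRL (measurable_EFinP _ _)); apply: subspace_continuous_measurable_fun => //.
    apply: continuous_in_subspaceT => x /set_mem; rewrite /quadrant/= in_itv/= andbT => x0.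
    apply: cvgV; first by rewrite gt_eqF// /p; have := sqr_ge0 x; lra.
    apply: cvgD.
      by apply: cvgD; [exact: cvg_cst|apply: cvgMr; exact: cvg_id].
    by apply: cvgMr; exact: exprn_continuous.

  by rewrite integral_fold_slope -EFinM; congr EFin; field.
rewrite [RHS]integral_mkcond; apply: eq_integral => t _; rewrite patchE.
case: ifPn => tq; last first.
  by rewrite integral0_eq// => x _; rewrite /h/= [X in _ * (_ * X)]indicE (negbTE tq) !mulr0.
have t0 : 0 <= t by move: tq => /set_mem; rewrite /quadrant/= in_itv/= andbT.
have p0 : 0 < p t by rewrite /p; have := sqr_ge0 t; lra.
have s2 : 0 < Num.sqrt 2 :> R by rewrite sqrtr_gt0.
have s22 : Num.sqrt 2 ^+ 2 = 2 :> R by rewrite sqr_sqrtr.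
(* [gauss_fun] is exp (- y^2), so the factor 1 / 2 of the exponent is absorbed into k = p(t) / sqrt
   2. *)
transitivity (\int[mu]_(x in quadrant) (x * gauss_fun (p t / Num.sqrt 2 * x ^+ 2))%:E)%E.
  rewrite [RHS]integral_mkcond; apply: eq_integral => x _; rewrite patchE /h/=.
  rewrite !indicE tq mulr1; case: ifPn => xq; last by rewrite mulr0.
  rewrite mulr1 /gauss_fun; congr (_ * expR (- _))%:E.
  by rewrite [in RHS]mulrAC expr_div_n s22 [p t * _]mulrC.
rewrite integral_quartic ?divr_gt0// -EFinM; congr EFin.
rewrite sqrtrM//; have -> : 2 = Num.sqrt 2 ^+ 2 :> R by rewrite s22.
rewrite sqrtr_sqr ger0_norm ?ltW//.
by field; rewrite !gt_eqF.
Qed.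

End FoldConstant.

(** * Tonelli's theorem for three factors *)

Section Tonelli3.
Context d1 d2 d3 (T1 : measurableType d1) (T2 : measurableType d2)
  (T3 : measurableType d3) (R : realType).
Variables (m1 : {sigma_finite_measure set T1 -> \bar R})
  (m2 : {sigma_finite_measure set T2 -> \bar R})
  (m3 : {sigma_finite_measure set T3 -> \bar R}).

(* The library's sigma-finite instance on [m1 \x m2] is masked by the one for
   probabilities, hence this alias. *)
Definition product2 : set (T1 * T2) -> \bar R := (m1 \x m2)%E.
HB.instance Definition _ := Measure.on product2.

Lemma product2_sigma_finite : sigma_finite setT product2.
Proof.
have /sigma_finiteP[F [TF ndF Foo]] := sigma_finiteT m1.
have /sigma_finiteP[G [TG ndG Goo]] := sigma_finiteT m2.
exists (fun n => F n `*` G n).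
  apply/seteqP; split=> // -[x y] _.
  have [n _ Fx] : (\bigcup_n F n) x by rewrite -TF.
  have [k _ Gy] : (\bigcup_n G n) y by rewrite -TG.
  exists (maxn n k) => //; split.
    by apply: (subsetPset _ _ (ndF _ _ (leq_maxl n k))).
  by apply: (subsetPset _ _ (ndG _ _ (leq_maxr n k))).
move=> k; have [? ?] := Foo k; have [? ?] := Goo k.
split; first exact: measurableX.
by rewrite /product2 product_measure1E// lte_mul_pinfty// ge0_fin_numE.
Qed.

HB.instance Definition _ := Measure_isSigmaFinite.Build _ _ _ product2
  product2_sigma_finite.

Lemma tonelli3 (g : T1 * T2 * T3 -> \bar R) :
  measurable_fun setT g -> (forall p, (0 <= g p)%E) ->
  (\int[((m1 \x m2) \x m3)%E]_p g p =
   \int[m1]_s \int[m2]_u \int[m3]_v g (s, u, v))%E.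
Proof.
move=> mg g0.
transitivity (\int[m1 \x m2]_p \int[m3]_v g (p, v))%E.
  exact: (@fubini_tonelli1 _ _ _ _ R product2 m3 g mg g0).
have mF := @measurable_fun_fubini_tonelli_F _ _ _ _ R m3 g mg g0.
rewrite (@fubini_tonelli1 _ _ _ _ R m1 m2 _ mF)//.
by move=> p; apply: integral_ge0.
Qed.

End Tonelli3.

(** * Closed forms of the limits *)

Section LimitValues.
Context {R : realType}.
Local Notation mu := (@lebesgue_measure R).

Lemma tonelli_R3 (g : R * R * R -> \bar R) :
  measurable_fun [set: R * R * R] g -> (forall p, (0 <= g p)%E) ->
  (\int[((mu \x mu) \x mu)%E]_p g p =
   \int[mu]_s \int[mu]_u \int[mu]_v g (s, u, v))%E.
Proof.
exact: (@tonelli3 _ _ _ (measurableTypeR R) (measurableTypeR R)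
  (measurableTypeR R) R mu mu mu g).
Qed.

Let quadrant : set R := `[0, +oo[%classic.

Let m_quadrant : measurable quadrant.
Proof. exact: measurable_itv. Qed.

Let fold_slice (p : R * R) : R :=
  expR (- (fold_form p.1 p.2 ^+ 2 / 2)) * (\1_quadrant p.1 * \1_quadrant p.2).

Let m_fold_slice : measurable_fun [set: R * R] fold_slice.
Proof.
apply: measurable_funM.
  apply: measurableT_comp => //; apply: measurableT_comp => //.
  apply: measurable_funM => //; apply: measurable_funX; exact: measurable_fold_form.
apply: measurable_funM.
  exact: (measurableT_comp (measurable_indic m_quadrant) measurable_fst).
exact: (measurableT_comp (measurable_indic m_quadrant) measurable_snd).
Qed.

Let fold_slice_ge0 p : 0 <= fold_slice p.
Proof. by rewrite /fold_slice !mulr_ge0// expR_ge0. Qed.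

Let mE_fold_slice : measurable_fun [set: R * R] (EFin \o fold_slice).
Proof. by apply: (iffRL (measurable_EFinP _ _)). Qed.

Let sqrt_2pi : Num.sqrt (2 * pi) * Num.sqrt (2 * pi) = 2 * pi :> R.
Proof. by rewrite -expr2 sqr_sqrtr// mulr_ge0// pi_ge0. Qed.

Lemma integral_fold_limit (c : R) : 0 <= c ->
  (\int[mu]_x \int[mu]_y (c *
     expR (- ((x ^+ 2 + 4 * x * y + 3 * y ^+ 2) ^+ 2 / 2)) * Num.sqrt (2 * pi) *
     (\1_(`[0%R, +oo[%classic) x * \1_(`[0%R, +oo[%classic) y))%:E
   = (c * (pi / 4 * ln 3))%:E)%E.
Proof.
move=> c0; transitivity (\int[mu]_x \int[mu]_y
  ((c * Num.sqrt (2 * pi))%:E * (EFin \o fold_slice) (x, y)))%E.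
  apply: eq_integral => x _; apply: eq_integral => y _.
  by rewrite -EFinM; congr EFin; rewrite /fold_slice /fold_form/=; ring.
rewrite -(@ge0_iterated_integralZl _ (c * Num.sqrt (2 * pi)) (EFin \o fold_slice))//.
- rewrite (@integral_fold_form R) -EFinM; congr EFin.
  transitivity (c * (Num.sqrt (2 * pi) * Num.sqrt (2 * pi)) * ln 3 / 8); first by ring.
  by rewrite sqrt_2pi; field.
- by rewrite mulr_ge0// sqrtr_ge0.
Qed.

(** The variable [s] separates and contributes sqrt (2 pi), which multiplies the value sqrt (2 pi)
    ln 3 / 8 of [integral_fold_form]. *)
Lemma C_foldE : @C_fold R = pi / 4 * ln 3.
Proof.
pose g (p : R * R * R) : R := expR (- (p.1.1 ^+ 2 / 2)) * fold_slice (p.1.2, p.2).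
have mg : measurable_fun [set: R * R * R] (EFin \o g).
  apply: (iffRL (measurable_EFinP _ _)); apply: measurable_funM.
    apply: measurableT_comp => //; apply: measurableT_comp => //.
    apply: measurable_funM => //; apply: measurable_funX.
    exact: (measurableT_comp measurable_fst measurable_fst).
  apply: (measurableT_comp m_fold_slice); apply: measurable_fun_pair => //.
  exact: (measurableT_comp measurable_snd measurable_fst).
have g0 p : (0 <= (EFin \o g) p)%E by rewrite lee_fin mulr_ge0// expR_ge0.
suff : (\int[((mu \x mu) \x mu)%E]_p (EFin \o g) p = (pi / 4 * ln 3)%:E)%E.
  move=> E; rewrite /C_fold /Rintegral integral_mkcond -[RHS]/(fine (pi / 4 * ln 3)%:E) -E.
  congr fine; apply: eq_integral => -[[s u] v] _; rewrite patchE/= /g/= /fold_slice/=.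
  rewrite !indicE !mem_setE !in_itv/= !andbT; case: ifPn => [|/negP].
    move=> /set_mem/= [-> ->]; rewrite !mulr1 -expRD; congr (expR _)%:E.
    by rewrite /fold_form; field.
  move=> h; suff -> : (0 <= u)%R%:R * (0 <= v)%R%:R = 0 :> R by rewrite !mulr0.
  case: (boolP (0 <= u)) => u0; rewrite ?mul0r//.
  case: (boolP (0 <= v)) => v0; rewrite ?mulr0//.
  by exfalso; apply: h; apply/mem_set.
rewrite tonelli_R3//.
pose K (u : R) := (\int[mu]_v (EFin \o fold_slice) (u, v))%E.
have K0 u : (0 <= K u)%E by apply: integral_ge0 => v _; rewrite lee_fin.
have mK : measurable_fun [set: R] K.
  exact: (measurable_section_integral measurableT mE_fold_slice).
have mG := @measurable_gauss_scaled R 2^-1.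
pose h (p : R * R) := ((expR (- (2^-1 * p.1 ^+ 2)))%:E * K p.2)%E.
have mh : measurable_fun [set: R * R] h.
  apply: emeasurable_funM; last exact: (measurableT_comp mK measurable_snd).
  apply: (iffRL (measurable_EFinP _ _)).
  exact: (measurableT_comp mG measurable_fst).
have h0 p : (0 <= h p)%E by rewrite mule_ge0// lee_fin expR_ge0.
transitivity (\int[mu]_s \int[mu]_u h (s, u))%E.
  apply: eq_integral => s _; apply: eq_integral => u _; rewrite /h/= /K.
  rewrite -ge0_integralZl_EFin ?expR_ge0//.
  - by apply: eq_integral => v _; rewrite -EFinM /g/= [2^-1 * _]mulrC.
  - by move=> v _; rewrite lee_fin.
  - exact: (measurableT_comp mE_fold_slice (measurable_pair1 u)).
rewrite (@fubini_tonelli _ _ (measurableTypeR R) (measurableTypeR R) R mu mu h mh h0).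
transitivity (\int[mu]_u ((Num.sqrt (2 * pi))%:E * K u))%E.
  apply: eq_integral => u _; rewrite /h/=.
  rewrite ge0_integralZr//; last first.
    by apply: (iffRL (measurable_EFinP _ _)).
  by rewrite gauss_integral_scaled// invrK [pi * 2]mulrC.
rewrite ge0_integralZl_EFin ?sqrtr_ge0//.
rewrite /K (@integral_fold_form R) -EFinM; congr EFin.
by rewrite !mulrA sqrt_2pi; field.
Qed.

Section Combine.
Variables (F : R * R * R -> R) (M : R).
Hypotheses (cF : continuous F) (F0 : forall x, 0 <= F x) (FM : forall x, F x <= M).
Hypothesis FT : forall x u v, F (x + 2 * pi, u, v) = F (x, u, v).

Lemma sin_lt0_regular (u : R) : 4 * pi / 3 <= u <= 3 * pi / 2 -> sin u < 0.
Proof.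
have := pi_gt0 R => p0 u_int.
have -> : u = (u - pi) + pi by rewrite subrK.
by rewrite sinDpi oppr_lt0; apply: sin_gt0_pi; apply/andP; split; lra.
Qed.

Lemma regular_density_continuous :
  {within `[4 * pi / 3, 3 * pi / 2],
    continuous (fun u => pi * F (pi - v_Gamma u, u, v_Gamma u) / - sin u)}.
Proof.
have := pi_gt0 R => p0.
apply: continuous_in_subspaceT => u /set_mem; rewrite /= in_itv/= => u_int.
have cv : {for u, continuous (@v_Gamma R)}.
  by apply: continuous_v_Gamma; apply/andP; split; lra.
apply: cvgM.
  apply: cvgMr.
  apply: (@continuous_comp _ _ _ (fun u : R => (pi - v_Gamma u, u, v_Gamma u)) F).
    have c1 : (pi - v_Gamma x, x) @[x --> u] --> (pi - v_Gamma u, u).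
      exact: (cvg_pair (cvgB (cvg_cst (pi : R)) cv) (@cvg_id _ _)).
    exact: (cvg_pair c1 cv).
  exact: cF.
apply: cvgV; first by rewrite oppr_eq0 lt_eqF// sin_lt0_regular.
by apply: cvgN; exact: continuous_sin.
Qed.

(** The Gaussian in [y] integrates to sqrt (pi / (2 sin^2 x)); times sqrt (2 pi) this is pi / |sin
    x|, and sin x < 0 on the interval. *)
Lemma integral_regular_limit :
  (\int[mu]_x \int[mu]_y (F (pi - v_Gamma x, x, v_Gamma x) *
     expR (- ((2 * y * sin x) ^+ 2 / 2)) * Num.sqrt (2 * pi) *
     \1_(`](4 * pi / 3)%R, (3 * pi / 2)%R]%classic) x)%:E =
   \int[mu]_(x in `[(4 * pi / 3)%R, (3 * pi / 2)%R])
     (pi * F (pi - v_Gamma x, x, v_Gamma x) / - sin x)%:E)%E.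
Proof.
rewrite -integral_itv_obnd_cbnd; last first.
  apply: (iffRL (measurable_EFinP _ _)); apply: (measurable_funS _ _
    (subspace_continuous_measurable_fun _ regular_density_continuous)) => //.
  by move=> x /=; rewrite !in_itv/= => /andP[/ltW -> ->].
rewrite [RHS]integral_mkcond; apply: eq_integral => x _; rewrite patchE indicE.
case: ifPn => xin; last by rewrite integral0_eq// => y _; rewrite mulr0.
have sx : sin x < 0.
  apply: sin_lt0_regular; move: xin => /set_mem; rewrite /= in_itv/=.
  by move=> /andP[/ltW -> ->].
set c := F _; have c0 : 0 <= c by exact: F0.
transitivity (\int[mu]_y ((c * Num.sqrt (2 * pi))%:E *
    (expR (- ((2 * sin x ^+ 2) * y ^+ 2)))%:E))%E.
  apply: eq_integral => y _; rewrite -EFinM mulr1 mulrAC; congr (_ * expR (- _))%:E.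
  by field.
have s2 : 0 < 2 * sin x ^+ 2 by rewrite mulr_gt0// exprn_even_gt0//= lt_eqF.
rewrite ge0_integralZl_EFin//; last 2 first.
- by apply: (iffRL (measurable_EFinP _ _)); exact: measurable_gauss_scaled.
- by rewrite mulr_ge0// sqrtr_ge0.
rewrite gauss_integral_scaled// -EFinM; congr EFin.
rewrite -[LHS]mulrA -sqrtrM ?mulr_ge0 ?pi_ge0//.
have -> : 2 * pi * (pi / (2 * sin x ^+ 2)) = (pi / - sin x) ^+ 2.
  by have := lt_eqF sx; move: (pi : R) => p sx0; field; rewrite sx0.
rewrite sqrtr_sqr ger0_norm ?divr_ge0 ?pi_ge0 ?oppr_ge0 ?ltW//.
by rewrite mulrA [c * pi]mulrC.
Qed.

Let G a (u : R) : \bar R :=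
  (\int[mu]_(v in `[pi, (4 * pi / 3)%R]) slice_integral F a (u, v))%E.

(** The range of [u] is cut at pi between the two regimes; the point 4 pi / 3 missing from
    [regular_angles] does not change the integral. *)
Lemma configuration_integral_cvg (a : nat -> R) :
  (forall n, 0 < a n) -> a n @[n --> \oo] --> +oo ->
  ((a n ^+ 2)%:E * \int[mu]_(u in `[0%R, (3 * pi / 2)%R])
     \int[mu]_(v in `[pi, (4 * pi / 3)%R]) slice_integral F (a n) (u, v))%E
    @[n --> \oo] -->
  ((F (0, 0, pi) * (pi / 4 * ln 3))%:E +
   \int[mu]_(x in `[(4 * pi / 3)%R, (3 * pi / 2)%R])
     (pi * F (pi - v_Gamma x, x, v_Gamma x) / - sin x)%:E)%E.
Proof.
have := pi_gt0 R => p0 a0 aoo.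
have mG b : measurable_fun setT (G b).
  apply: (measurable_section_integral (s := slice_integral F b)) => //.
    exact: (measurable_slice_integral cF).
  by move=> p; exact: (slice_integral_ge0 F0).
have G0 b u : (0 <= G b u)%E.
  by apply: integral_ge0 => v _; exact: (slice_integral_ge0 F0).
have split_G b : (\int[mu]_(u in `[0%R, (3 * pi / 2)%R]) G b u =
    \int[mu]_(u in `[0%R, pi[) G b u + \int[mu]_(u in regular_angles) G b u)%E.
  have ms := @measurable_funTS _ _ _ _ _ _ (mG b).
  rewrite (@itv_bndbnd_setU _ _ _ (BLeft (pi : R))) ?bnd_simp; [|lra..].
  have cup (A B : set R) : measurable A -> measurable B ->
      (forall x, A x -> B x -> False) ->
      (\int[mu]_(x in A `|` B) G b x = \int[mu]_(x in A) G b x + \int[mu]_(x in B) G b x)%E.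
    move=> mA mB AB; apply: ge0_integral_setU => //.
      exact: ms.
    by apply/disj_setPS => x []; exact: AB.
  rewrite cup//; last by move=> x /=; rewrite !in_itv/=; lra.
  congr (_ + _)%E.
  rewrite (@itv_bndbnd_setU _ _ _ (BLeft (4 * pi / 3 : R))) ?bnd_simp; [|lra..].
  rewrite /regular_angles !cup//.
  - by rewrite integral_itv_obnd_cbnd.
  - by move=> x /=; rewrite !in_itv/=; lra.
  - by move=> x /=; rewrite !in_itv/=; lra.
have h1 := fold_cvg cF F0 FM FT a0 aoo.
have h2 := regular_cvg cF F0 FM FT a0 aoo.
rewrite integral_fold_limit// in h1; rewrite integral_regular_limit in h2.
have : (((a n ^+ 2)%:E * \int[mu]_(u in `[0%R, pi[) G (a n) u) +
    ((a n ^+ 2)%:E * \int[mu]_(u in regular_angles) G (a n) u))%E @[n --> \oo] -->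
  ((F (0, 0, pi) * (pi / 4 * ln 3))%:E +
   \int[mu]_(x in `[(4 * pi / 3)%R, (3 * pi / 2)%R])
     (pi * F (pi - v_Gamma x, x, v_Gamma x) / - sin x)%:E)%E.
  by apply: cvgeD => //; rewrite fin_num_adde_defr.
apply: cvg_trans; apply: near_eq_cvg; apply: nearW => n /=.
by rewrite -ge0_muleDr ?integral_ge0// -split_G.
Qed.

End Combine.

(** A primitive is - pi ln (- tan (x / 2)), and tan (x / 2) is - sqrt 3 and -1 at the two ends. *)
Lemma integral_cosecant :
  (\int[mu]_(x in `[(4 * pi / 3)%R, (3 * pi / 2)%R]) (pi / - sin x)%:E =
   (pi / 2 * ln 3)%:E)%E.
Proof.
have := pi_gt0 R => p0.
pose H (x : R) := - (pi * ln (- tan (x / 2))).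
pose I : set R := `[(4 * pi / 3)%R, (3 * pi / 2)%R]%classic.
have hs (x : R) : I x -> 0 < sin (x / 2) /\ cos (x / 2) < 0.
  rewrite /I/= in_itv/= => xi; split.
    by apply: sin_gt0_pi; apply/andP; split; lra.
  have -> : x / 2 = (x / 2 - pi) + pi by rewrite subrK.
  by rewrite cosDpi oppr_lt0; apply: cos_gt0_pihalf; apply/andP; split; lra.
have dH (x : R) : I x -> is_derive x 1 H (pi / - sin x).
  move=> xI; have [s0 c0] := hs x xI.
  have t0 : 0 < - tan (x / 2) by rewrite /tan oppr_gt0 pmulr_rlt0// invr_lt0.
  have dh : is_derive x 1 (fun x : R => x / 2) 2^-1.
    by apply: is_derive_eq; rewrite /GRing.scale/=; ring.
  have dt := @is_derive1_comp _ (@tan R) (fun x => x / 2) x _ _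
    (@is_derive_tan _ (x / 2) (ltr0_neq0 c0)) dh.
  have dN := is_deriveN dt.
  have dl := @is_derive1_comp _ (@ln R) (- (@tan R \o (fun x => x / 2))) x _ _ (is_derive1_ln t0) dN.
  have -> : H = (- pi) \*: (@ln R \o (- (@tan R \o (fun x => x / 2)))).
    by apply/funext => y; rewrite /H -mulNr.
  apply: is_derive_eq; rewrite /GRing.scale/=.
  have -> : sin x = 2 * sin (x / 2) * cos (x / 2).
    rewrite [in LHS](_ : x = x / 2 + x / 2); last by field.
    by rewrite sinD; ring.
  rewrite /tan; move: (pi : R) (sin (x / 2)) (cos (x / 2)) s0 c0 => p s c s0 c0.
  by field; rewrite (gt_eqF s0) (lt_eqF c0).
have tt : tan (3 * pi / 2 / 2) = -1 :> R.
  have -> : 3 * pi / 2 / 2 = pi / 2 + pi / 4 :> R by field.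
  rewrite /tan sinD cosD sin_pihalf cos_pihalf !mul1r !mul0r.
  rewrite addr0 sub0r; have := tan_piquarter R; rewrite /tan => tp.
  have c0 : cos (pi / 4) != 0 :> R.
    by apply/eqP => h; move: tp; rewrite h invr0 mulr0 => /esym/eqP; rewrite oner_eq0.
  have -> : sin (pi / 4) = cos (pi / 4) :> R by move: tp => /(congr1 ( *%R^~ (cos (pi / 4)))); rewrite divfK// mul1r.
  by rewrite invrN mulrN divff.
have tt2 : tan (4 * pi / 3 / 2) = - Num.sqrt 3 :> R.
  have -> : 4 * pi / 3 / 2 = pi - pi / 3 :> R by field.
  rewrite /tan sinB cosB sinpi cospi sin_pi3 cos_pi3.
  by field.
rewrite (@continuous_FTC2 R _ H).
- rewrite -EFinB /H tt tt2 !opprK ln1; congr EFin.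
  have -> : ln 3 = 2 * ln (Num.sqrt 3) :> R.
    by rewrite -{1}(sqr_sqrtr (ler0n _ 3)) lnXn ?sqrtr_gt0// mulr_natl.
  by field.
- lra.
- apply: continuous_in_subspaceT => x /set_mem xI; have xI' := xI.
  move: xI' => /=; rewrite in_itv/= => xI'.
  apply: cvgMr; apply: cvgV; first by rewrite oppr_eq0 lt_eqF// sin_lt0_regular.
  by apply: cvgN; exact: continuous_sin.
- have dfc (x : R) : I x -> {for x, continuous H}.
    move=> xI; apply: differentiable_continuous; apply/derivable1_diffP.
    exact: (@ex_derive _ _ _ _ _ _ _ (dH x xI)).
  split.
  + move=> x; rewrite in_itv/= => xi; apply: (@ex_derive _ _ _ _ _ _ _ (dH x _)).
    by rewrite /I/= in_itv/=; lra.
  + by apply: cvg_at_right_filter; apply: dfc; rewrite /I/= in_itv/=; lra.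
  + by apply: cvg_at_left_filter; apply: dfc; rewrite /I/= in_itv/=; lra.
- move=> x; rewrite in_itv/= => xi; rewrite derive1E.
  apply: (@derive_val _ _ _ _ _ _ _ (dH x _)).
  by rewrite /I/= in_itv/=; lra.
Qed.

End LimitValues.

(** * Measurable coordinates on the circle and on the torus *)

Section CircleCoordinates.
Context {R : realType}.
Local Notation mu := (@lebesgue_measure R).
Let tau_gt0 : 0 < 2 * pi :> R. Proof. by rewrite mulr_gt0// pi_gt0. Qed.

Lemma angDk (x : R) (k : int) : ang (x + k%:~R * (2 * pi)) = ang x.
Proof. by apply/ang_eq; exists k; rewrite addrAC subrr add0r. Qed.

Lemma ang_inj (x y : R) : `|x - y| < 2 * pi -> ang x = ang y -> x = y.
Proof.
move=> xy /ang_eq[k kE]; apply/eqP; rewrite -subr_eq0 kE mulf_eq0 intr_eq0.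
rewrite kE normrM (gtr0_norm tau_gt0) gtr_pMl// -intr_norm ltrz1 in xy.
by rewrite -normr_le0 -ltzD1 add0r xy.
Qed.

Lemma ang_window (b : R) (s : circle R) : exists2 x, b <= x < b + 2 * pi & ang x = s.
Proof.
pose y := repr s; pose k := Num.floor ((y - b) / (2 * pi)).
exists (y + (- k)%:~R * (2 * pi)); last by rewrite angDk /ang reprK.
have /andP[h1 h2] := real_floor_itv (num_real ((y - b) / (2 * pi))).
rewrite -/k ler_pdivlMr// in h1; rewrite -/k intrD ltr_pdivrMr// mulrDl mul1r in h2.
by rewrite intrN mulNr; lra.
Qed.

(** [repr] is an arbitrary choice, whose measurability is unknown; the representative in [0, 2 pi[
    is measurable. The default 0 never occurs. *)
Definition circle_coord (s : circle R) : R :=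
  xget 0 [set x | 0 <= x < 2 * pi /\ ang x = s].

Lemma circle_coordP s : 0 <= circle_coord s < 2 * pi /\ ang (circle_coord s) = s.
Proof.
have [x] := ang_window 0 s; rewrite add0r => x_int xs.
exact: (@xgetPex _ 0 [set x | 0 <= x < 2 * pi /\ ang x = s]) (ex_intro _ x (conj x_int xs)).
Qed.

Lemma circle_coordK s : ang (circle_coord s) = s.
Proof. by have [] := circle_coordP s. Qed.

Lemma circle_coord_itv s : 0 <= circle_coord s < 2 * pi.
Proof. by have [] := circle_coordP s. Qed.

Lemma circle_coord_ang x : 0 <= x < 2 * pi -> circle_coord (ang x) = x.
Proof.
move=> x_int; apply: ang_inj; last by rewrite circle_coordK.
by have := circle_coord_itv (ang x); rewrite ltr_norml; lra.
Qed.

(** The saturation of [A] is the union of its translates by the multiples of 2 pi. *)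
Lemma open_ang_image (A : set R) : open A -> open (@ang R @` A).
Proof.
move=> oA; change (open (@ang R @^-1` (@ang R @` A))).
suff -> : @ang R @^-1` (@ang R @` A) =
    \bigcup_(k in [set: int]) ((fun x : R => x + k%:~R * (2 * pi)) @^-1` A).
  apply: bigcup_open => k _.
  have ck : continuous (fun x : R => x + k%:~R * (2 * pi)).
    by move=> x; apply: cvgD; [exact: cvg_id|exact: cvg_cst].
  by move/continuousP : ck; exact.
apply/seteqP; split=> x /=.
  by move=> [y Ay /ang_eq[k kE]]; exists k => //=; rewrite -kE subrKC.
by move=> [k _ /= kA]; exists (x + k%:~R * (2 * pi)) => //; exact: angDk.
Qed.

(** For c >= 0 the coordinate exceeds [c] exactly on the image of ]c, 2 pi[, which is open because
    [ang] is an open map; for c < 0 it does so everywhere. *)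
Lemma measurable_circle_coord : measurable_fun [set: circle R] circle_coord.
Proof.
move=> mD; apply: (measurability _ (RGenOInfty.measurableE R)) => //.
move=> _ [_ [c ->] <-]; rewrite setTI.
have [c0|c0] := ltP c 0.
  rewrite (_ : _ @^-1` _ = setT) ?measurableT//; apply/seteqP; split=> // s _ /=.
  by rewrite in_itv/= andbT; have := circle_coord_itv s; lra.
rewrite (_ : _ @^-1` _ = @ang R @` `]c, 2 * pi[).
  by apply: sub_sigma_algebra; exact/open_ang_image/itv_open.
apply/seteqP; split=> s /=; rewrite in_itv/= andbT.
  move=> cs; exists (circle_coord s); last exact: circle_coordK.
  by rewrite /= in_itv/= cs/=; have /andP[] := circle_coord_itv s.
move=> [x /=]; rewrite in_itv/= => /andP[cx x2] <-.
by rewrite circle_coord_ang// x2 (le_trans c0 (ltW cx)).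
Qed.

Lemma measurable_ang : measurable_fun [set: R] (@ang R).
Proof. by move=> _ A mA; rewrite setTI; exact: ang_measurable. Qed.

(** [circle_measure] is the image under [ang] of Lebesgue measure restricted to [0, 2 pi[, and the
    restriction is read as the density [\1_D]. *)
Lemma ge0_integral_circle (g : circle R -> \bar R) :
  measurable_fun setT g -> (forall s, (0 <= g s)%E) ->
  (\int[circle_measure]_s g s = \int[mu]_(x in `[0%R, (2 * pi)%R[) g (ang x))%E.
Proof.
move=> mg g0; pose D : set R := `[0, 2 * pi[%classic.
have mD : measurable D by exact: measurable_itv.
have mgA : measurable_fun setT (g \o @ang R) by exact: measurableT_comp mg measurable_ang.
have mang : @measurable_fun _ _ (measurableTypeR R) _ setT (@ang R) := measurable_ang.
have E := @ge0_integral_pushforward _ _ _ _ R _ mang (mrestr mu mD) setT g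
  measurableT mg (fun s _ => g0 s).
apply: (etrans _ (etrans E _)); first exact: eq_measure_integral.
rewrite preimage_setT.
rewrite (@ge0_integral_density _ _ R mu (\1_D)) //=.
- rewrite [RHS]integral_mkcond; apply: eq_integral => x _; rewrite patchE indicE.
  by case: ifPn; rewrite ?mule1 ?mule0.
- by move=> A mA; rewrite integral_indic// /mrestr setIC.
Qed.

Lemma ge0_integral_volume3 (g : torus3 R -> \bar R) :
  measurable_fun setT g -> (forall q, (0 <= g q)%E) ->
  (\int[@volume3 R]_q g q =
   \int[mu]_(x in `[0%R, (2 * pi)%R[) \int[mu]_(u in `[0%R, (2 * pi)%R[)
     \int[mu]_(v in `[0%R, (2 * pi)%R[) g (ang x, ang u, ang v))%E.
Proof.
move=> mg g0.
have mF := @measurable_fun_fubini_tonelli_F _ _ _ _ R (@circle_measure R) g mg g0.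
have F0 p : (0 <= fubini_F (@circle_measure R) g p)%E by exact: integral_ge0.
have mF2 := @measurable_fun_fubini_tonelli_F _ _ _ _ R (@circle_measure R) _ mF F0.
rewrite /volume3 (@tonelli3 _ _ _ _ _ _ R circle_measure circle_measure circle_measure g)//.
rewrite ge0_integral_circle//; last by move=> s; do 2 apply: integral_ge0 => ? _.
apply: eq_integral => x _; rewrite ge0_integral_circle//; last 2 first.
- exact: (measurableT_comp mF (measurable_pair1 (ang x))).
- by move=> s; apply: integral_ge0.
apply: eq_integral => u _; rewrite ge0_integral_circle//.
exact: (measurableT_comp mg (measurable_pair1 (ang x, ang u))).
Qed.

Lemma OmegaE (q : torus3 R) : Omega q <->
  0 <= circle_coord q.1.2 <= 3 * pi / 2 /\ pi <= circle_coord q.2 <= 4 * pi / 3.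
Proof.
have := pi_gt0 R => p0; rewrite /Omega/=; split.
  move=> [[u /= ui <-] [v /= vi <-]]; rewrite !in_itv/= in ui vi.
  by rewrite !circle_coord_ang; lra.
move=> [ui vi]; split; [exists (circle_coord q.1.2)|exists (circle_coord q.2)];
  by rewrite /= ?in_itv//= circle_coordK.
Qed.

Lemma measurable_coords : [/\ measurable_fun setT (fun q : torus3 R => circle_coord q.1.1),
  measurable_fun setT (fun q : torus3 R => circle_coord q.1.2) &
  measurable_fun setT (fun q : torus3 R => circle_coord q.2)].
Proof.
split; apply: (measurableT_comp measurable_circle_coord) => //.
  exact: (measurableT_comp measurable_fst measurable_fst).
exact: (measurableT_comp measurable_snd measurable_fst).
Qed.

Lemma measurable_Omega : measurable (@Omega R).
Proof.
have [_ m2 m3] := measurable_coords.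
have -> : @Omega R = ((fun q : torus3 R => circle_coord q.1.2) @^-1` `[0, 3 * pi / 2]) `&`
    ((fun q : torus3 R => circle_coord q.2) @^-1` `[pi, 4 * pi / 3]).
  by apply/seteqP; split=> q; [move/OmegaE|move=> h; apply/OmegaE; move: h];
    rewrite /= !in_itv/=.
by apply: measurableI; rewrite -[X in measurable X]setTI; [exact: m2|exact: m3].
Qed.

End CircleCoordinates.

(** * A chart onto Omega defined on all of R^3 *)

Section Chart.
Context {R : realType}.
Definition clamp (p : R * R * R) : R * R * R :=
  (p.1.1, Num.max 0 (Num.min (3 * pi / 2) p.1.2),
   Num.max pi (Num.min (4 * pi / 3) p.2)).

(* Clamping makes [f \o chart] continuous everywhere when [f] is only continuous
   on [Omega]. *)
Definition chart (p : R * R * R) : torus3 R :=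
  (ang (clamp p).1.1, ang (clamp p).1.2, ang (clamp p).2).

Let clamp_itv (a b x : R) : a <= b -> a <= Num.max a (Num.min b x) <= b.
Proof. by move=> ab; rewrite le_max lexx/= ge_max ab ge_min lexx. Qed.

Lemma chart_Omega p : Omega (chart p).
Proof.
have := pi_gt0 R => p0; split; apply: imageP; rewrite /= in_itv/=.
- by apply: clamp_itv; lra.
- by apply: clamp_itv; lra.
Qed.

Lemma chartE x u v : 0 <= u <= 3 * pi / 2 -> pi <= v <= 4 * pi / 3 ->
  chart (x, u, v) = (ang x, ang u, ang v).
Proof.
by move=> /andP[u0 u1] /andP[v0 v1]; rewrite /chart/= !min_r// !max_r.
Qed.

Lemma chart_coord q : Omega q ->
  chart (circle_coord q.1.1, circle_coord q.1.2, circle_coord q.2) = q.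
Proof.
by move/OmegaE => [ui vi]; rewrite chartE// !circle_coordK; case: q {ui vi} => -[].
Qed.

Lemma continuous_clamp : continuous clamp.
Proof.
have ccl (a b : R) : continuous (fun x => Num.max a (Num.min b x)).
  move=> x; apply: (@continuous_max _ _ (cst a) (fun x => Num.min b x)); first exact: cvg_cst.
  by apply: (@continuous_min _ _ (cst b) id); [exact: cvg_cst|exact: cvg_id].
move=> [[x u] v]; pose p := (x, u, v).
have c1 : z.1.1 @[z --> p] --> x by exact: (cvg_comp _ _ cvg_fst cvg_fst).
have c2 : z.1.2 @[z --> p] --> u by exact: (cvg_comp _ _ cvg_fst cvg_snd).
have c3 : z.2 @[z --> p] --> v by exact: cvg_snd.
have d2 := cvg_comp _ _ c2 (ccl 0 (3 * pi / 2) u).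
have d3 := cvg_comp _ _ c3 (ccl pi (4 * pi / 3) v).
exact: (cvg_pair (cvg_pair c1 d2) d3).
Qed.

Lemma continuous_chart : continuous chart.
Proof.
move=> p; apply: (@continuous_comp _ _ _ clamp
  (fun z : R * R * R => (ang z.1.1, ang z.1.2, ang z.2) : torus3 R)).
  exact: continuous_clamp.
case: (clamp p) => -[x u] v; pose z0 := (x, u, v).
have c1 : z.1.1 @[z --> z0] --> x by exact: (cvg_comp _ _ cvg_fst cvg_fst).
have c2 : z.1.2 @[z --> z0] --> u by exact: (cvg_comp _ _ cvg_fst cvg_snd).
have c3 : z.2 @[z --> z0] --> v by exact: cvg_snd.
have d1 := cvg_comp _ _ c1 (@ang_continuous R x).
have d2 := cvg_comp _ _ c2 (@ang_continuous R u).
have d3 := cvg_comp _ _ c3 (@ang_continuous R v).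
exact: (cvg_pair (cvg_pair d1 d2) d3).
Qed.

(** [chart] is continuous with values in Omega, so composing with it turns continuity relative to
    Omega into plain continuity. *)
Lemma continuous_within_chart (T : topologicalType) (f : torus3 R -> T) :
  {within @Omega R, continuous f} -> continuous (f \o chart).
Proof.
move=> cf p U /= nU.
have : within (@Omega R) (nbhs (chart p)) (f @^-1` U).
  by rewrite nbhs_subspace_in; [exact: cf|exact: chart_Omega].
move=> hU; have := @continuous_chart p _ hU; apply: (@filterS _ (nbhs p)) => z h.
exact: h (chart_Omega z).
Qed.

Lemma chart_periodic x u v : chart (x + 2 * pi, u, v) = chart (x, u, v).
Proof. by rewrite /chart/= -[2 * pi]mul1r (angDk _ 1). Qed.

Lemma bounded_on_Omega (f : torus3 R -> R) : continuous (f \o chart) ->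
  exists M, forall q, Omega q -> `|f q| <= M.
Proof.
move=> cF.
have cK : compact ((`[0, 2 * pi] `*` `[0, 3 * pi / 2]) `*` `[pi, 4 * pi / 3] : set (R * R * R)).
  by apply: compact_setX; [apply: compact_setX|]; exact: segment_compact.
have := continuous_compact (continuous_subspaceT cF) cK.
move/compact_bounded => [M [_ /(_ (M + 1))]]; rewrite ltrDl ltr01 => /(_ isT) h.
exists (M + 1) => q qO; rewrite -(chart_coord qO); apply: h.
exists (circle_coord q.1.1, circle_coord q.1.2, circle_coord q.2) => //.
have [ui vi] := iffLR (OmegaE q) qO.
do 2?split; rewrite /= in_itv//=.
by have := circle_coord_itv q.1.1; lra.
Qed.

(** On Omega, [f] is [f \o chart] composed with the coordinates, and these are measurable although
    they jump at the class of 0. *)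
Lemma measurable_on_Omega (f : torus3 R -> R) :
  continuous (f \o chart) -> measurable_fun (@Omega R) f.
Proof.
move=> /continuous_measurable_R3 mF.
have [m1 m2 m3] := @measurable_coords R.
apply: (@eq_measurable_fun _ _ _ _ _ (f \o chart \o (fun q : torus3 R =>
  (circle_coord q.1.1, circle_coord q.1.2, circle_coord q.2)))).
  by move=> q /set_mem qO; rewrite /= chart_coord.
apply: measurable_funTS; apply: (measurableT_comp mF).
by apply: measurable_fun_pair => //; apply: measurable_fun_pair.
Qed.

End Chart.

(** * Continuity from continuous partial derivatives *)

Section C1Continuous.
Context {R : realType}.
Variables (O : set 'rV[R]_3) (h : 'rV[R]_3 -> R).
Hypotheses (oO : open O) (hC1 : C1_open O h).
Local Notation e_ i := (delta_mx 0 i : 'rV[R]_3).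

Lemma is_derive_line (a : 'rV[R]_3) i (s : R) : O (a + s *: e_ i) ->
  is_derive s 1 (fun s : R => h (a + s *: e_ i)) ('D_(e_ i) h (a + s *: e_ i)).
Proof.
move=> /(hC1 i)[dh _].
have E : (fun k : R => k^-1 *: (h (a + (k *: 1 + s) *: e_ i) - h (a + s *: e_ i))) =
    (fun k : R => k^-1 *: (h (k *: e_ i + (a + s *: e_ i)) - h (a + s *: e_ i))).
  apply/funext => k; congr (_ *: (h _ - _)).
  by rewrite scalerDl addrCA -[k *: 1]/(k * 1) mulr1.
have d1 : derivable (fun s : R => h (a + s *: e_ i)) s 1.
  by rewrite /derivable /=; move: dh; rewrite /derivable -E.
by apply: DeriveDef => //; rewrite /derive E.
Qed.

(** The mean value theorem on a segment parametrized by [0, 1], so that both signs of [t] are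
    treated at once. *)
Lemma line_increment (a : 'rV[R]_3) i (t K : R) :
  (forall s, 0 <= s <= 1 -> O (a + (s * t) *: e_ i) /\
    `|'D_(e_ i) h (a + (s * t) *: e_ i)| <= K) ->
  `|h (a + t *: e_ i) - h a| <= K * `|t|.
Proof.
move=> hK.
have d (s : R) : 0 <= s <= 1 -> is_derive s 1 (fun s : R => h (a + (s * t) *: e_ i))
    ('D_(e_ i) h (a + (s * t) *: e_ i) * t).
  move=> /hK[Os _]; have d1 : is_derive s 1 (fun s : R => s * t) t.
    by apply: is_derive_eq; rewrite /GRing.scale/=; ring.
  exact: (@is_derive1_comp _ (fun s : R => h (a + s *: e_ i)) (fun s => s * t) s _ _ (is_derive_line Os) d1).
have [] := @MVT R (fun s : R => h (a + (s * t) *: e_ i))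
  (fun s => 'D_(e_ i) h (a + (s * t) *: e_ i) * t) 0 1 ltr01.
- by move=> s; rewrite in_itv/= => si; apply: d; lra.
- apply: continuous_in_subspaceT => s /set_mem; rewrite /= in_itv/= => si.
  apply: differentiable_continuous; apply/derivable1_diffP.
  exact: (@ex_derive _ _ _ _ _ _ _ (d s si)).
move=> c; rewrite in_itv/= => ci; rewrite mul1r mul0r scale0r addr0 subr0 mulr1 => ->.
by rewrite normrM ler_wpM2r//; apply: (hK c _).2; lra.
Qed.

(** [C1_open] speaks of partial derivatives only. The increment from [y] to a nearby point is split
    along a staircase parallel to the axes, each leg of which is bounded by [line_increment]. *)
Lemma C1_continuous y : O y -> {for y, continuous h}.
Proof.
move=> Oy.
(* [K] exceeds the modulus of each partial derivative at [y] by at least 1, so by continuity it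
   bounds them all nearby. *)
pose K := \sum_(i < 3) `|'D_(e_ i) h y| + 1.
have K0 : 0 < K by rewrite ltr_wpDl// sumr_ge0.
have near_y : \forall z \near y, O z /\ forall i, `|'D_(e_ i) h z| <= K.
  apply: filterI; first exact: open_nbhs_nbhs.
  apply: (@filter_forall _ _ (fun i z => `|'D_(e_ i) h z| <= K) (nbhs y) _) => i.
  have [_ cD] := hC1 i Oy.
  have : `|'D_(e_ i) h z| @[z --> y] --> `|'D_(e_ i) h y| by exact: cvg_norm cD.
  move=> /cvgrPdist_lt /(_ 1 ltr01); apply: filterS => z.
  rewrite ltr_norml => /andP[h1 h2].
  have : `|'D_(e_ i) h y| <= \sum_(i < 3) `|'D_(e_ i) h y|.
    by rewrite (bigD1 i)//= lerDl sumr_ge0.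
  by rewrite /K; lra.
have [e /= e0 he] := iffLR (nbhs_ballP _ _) near_y.
(* The radius r / (3 K) makes the three legs add up to less than [r]. *)
move=> U /nbhs_ballP[r /= r0 rU]; pose d := Num.min e (r / (3 * K)).
have d0 : 0 < d by rewrite lt_min e0 divr_gt0// mulr_gt0.
apply: (@filterS _ (nbhs y) _ (ball y d)); last exact: nbhsx_ballx.
move=> z yz; apply: rU; rewrite /ball/= distrC.
have ze : ball y e z by apply: le_ball yz; rewrite ge_min lexx.
have zd : ball y (r / (3 * K)) z by apply: le_ball yz; rewrite ge_min lexx orbT.
pose t i := z 0 i - y 0 i.
have tr i : `|t i| < r / (3 * K).
  by have := zd.2 0 i; rewrite /ball/= distrC.
have te i : `|t i| < e by have := ze.2 0 i; rewrite /ball/= distrC.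
have inb (c : 'I_3 -> R) : (forall i, 0 <= c i <= 1) ->
    ball y e (\row_i (y 0 i + c i * t i)).
  move=> c01; split=> // i j; rewrite !mxE ord1 /ball/= opprD addrA subrr sub0r normrN.
  rewrite normrM (le_lt_trans _ (te j))// ger0_norm; last by have := c01 j; lra.
  by rewrite ler_piMl//; have := c01 j; lra.
have j3 (j : 'I_3) : [\/ j = 0, j = 1 | j = ord_max].
  by case: j => [[|[|[|]]]]//= ?; [apply: Or31|apply: Or32|apply: Or33]; exact/val_inj.
(* The legs of the staircase: [c1] moves the first coordinate from [y] to [z], then [c2] the second
   and [c3] the third. *)
pose c1 (s : R) (j : 'I_3) : R := if j == 0 then s else 0.
pose c2 (s : R) (j : 'I_3) : R := if j == 0 then 1 else if j == 1 then s else 0.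
pose c3 (s : R) (j : 'I_3) : R := if j == 0 then 1 else if j == 1 then 1 else s.
pose pt (c : 'I_3 -> R) : 'rV[R]_3 := \row_i (y 0 i + c i * t i).
have step (c : R -> 'I_3 -> R) i : (forall s, 0 <= s <= 1 -> forall j, 0 <= c s j <= 1) ->
    (forall s, pt (c s) = pt (c 0) + (s * t i) *: e_ i) ->
    `|h (pt (c 1)) - h (pt (c 0))| <= K * `|t i|.
  move=> c01 cE; rewrite (cE 1) mul1r; apply: line_increment => s s01.
  rewrite -cE; have [? hD] := he _ (inb _ (c01 s s01)).
  by split=> //; exact: hD.
have s1 := step c1 0; have s2 := step c2 1; have s3 := step c3 ord_max.
have e0' : pt (c1 0) = y.
  by apply/rowP => j; rewrite !mxE /c1; case: ifP; rewrite mul0r addr0.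
have e1 : pt (c1 1) = pt (c2 0).
  by apply/rowP => j; rewrite !mxE /c1 /c2; case: ifP => //; case: ifP.
have e2 : pt (c2 1) = pt (c3 0).
  by apply/rowP => j; rewrite !mxE /c2 /c3; case: ifP => //; case: ifP.
have e3 : pt (c3 1) = z.
  by apply/rowP => j; rewrite !mxE /c3 !if_same mul1r /t subrKC.
have -> : h z - h y = (h (pt (c3 1)) - h (pt (c3 0))) +
    ((h (pt (c2 1)) - h (pt (c2 0))) + (h (pt (c1 1)) - h (pt (c1 0)))).
  by rewrite e0' e1 e2 e3; ring.
have sum_lt : K * `|t ord_max| + (K * `|t 1| + K * `|t 0|) < r.
  rewrite -!mulrDr -ltr_pdivlMl//.
  have -> : K^-1 * r = r / (3 * K) + (r / (3 * K) + r / (3 * K)).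
    by field; rewrite gt_eqF.
  by rewrite !ltrD.
apply: le_lt_trans sum_lt; apply: (le_trans (ler_normD _ _)); apply: lerD.
  apply: s3 => [s s01 j|s].
    by rewrite /c3; case: ifP => _; rewrite ?ler01 ?lexx//; case: ifP => _; rewrite ?ler01 ?lexx.
  apply/rowP => j; rewrite !mxE /c3.
  by case: (j3 j) => -> /=; rewrite ?eqxx /= ?mulr1n ?mulr0n; ring.
apply: (le_trans (ler_normD _ _)); apply: lerD.
  apply: s2 => [s s01 j|s].
    by rewrite /c2; case: ifP => _; rewrite ?ler01 ?lexx//; case: ifP => _; rewrite ?ler01 ?lexx.
  apply/rowP => j; rewrite !mxE /c2.
  by case: (j3 j) => -> /=; rewrite ?eqxx /= ?mulr1n ?mulr0n; ring.
apply: s1 => [s s01 j|s].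
  by rewrite /c1; case: ifP => _; rewrite ?ler01 ?lexx.
apply/rowP => j; rewrite !mxE /c1.
by case: (j3 j) => -> /=; rewrite ?eqxx /= ?mulr1n ?mulr0n; ring.
Qed.

End C1Continuous.

Section ContinuousWeight.
Context {R : realType}.

Lemma continuous_row3 : continuous (fun p : R * R * R =>
  \row_j nth 0 [:: p.1.1; p.1.2; p.2] j : 'rV[R]_3).
Proof.
move=> [[x u] v] U /nbhs_ballP[e /= e0 he].
have c1 : z.1.1 @[z --> (x, u, v)] --> x by exact: (cvg_comp _ _ cvg_fst cvg_fst).
have c2 : z.1.2 @[z --> (x, u, v)] --> u by exact: (cvg_comp _ _ cvg_fst cvg_snd).
have c3 : z.2 @[z --> (x, u, v)] --> v by exact: cvg_snd.
have : \forall z \near (x, u, v), [/\ `|x - z.1.1| < e, `|u - z.1.2| < e & `|v - z.2| < e].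
  have FN : Filter (nbhs (x, u, v)) := nbhs_filter _.
  have n1 := iffLR (cvgrPdist_lt _ _) c1 e e0.
  have n2 := iffLR (cvgrPdist_lt _ _) c2 e e0.
  have n3 := iffLR (cvgrPdist_lt _ _) c3 e e0.
  by apply: filterS3 (n1 FN) (n2 FN) (n3 FN) => z.
apply: (@filterS _ (nbhs (x, u, v))) => -[[x' u'] v'] [/= h1 h2 h3]; apply: he; split=> // i j.
by rewrite !mxE; case: j => [[|[|[|]]]].
Qed.

(** The hypothesis concerns the lift to R^3 of an extension of [w], so [chart] is factored as
    [proj3] after the row of clamped coordinates, where [C1_continuous] applies to that lift. *)
Lemma C2_continuous_chart (w : torus3 R -> R) :
  C2 (@Omega R) w -> continuous (w \o chart).
Proof.
move=> [U [g [oU OU wg [gC1 _]]]].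
have -> : w \o chart = g \o chart.
  by apply/funext => p /=; rewrite wg//; apply/mem_set/chart_Omega.
pose h := g \o @proj3 R.
have cp : continuous (@proj3 R).
  move=> y; have cy i : z 0 i @[z --> y] --> y 0 i by exact: coord_continuous.
  have d i := cvg_comp _ _ (cy i) (@ang_continuous R _).
  exact: (cvg_pair (cvg_pair (d 0) (d 1)) (d ord_max)).
have oO : open (@proj3 R @^-1` U) by move/continuousP : cp; exact.
have clE p : proj3 (\row_j nth 0 [:: (clamp p).1.1; (clamp p).1.2; (clamp p).2] j) = chart p.
  by rewrite /proj3 !mxE.
have -> : g \o chart = h \o (fun p => \row_j nth 0 [:: p.1.1; p.1.2; p.2] j) \o @clamp R.
  by apply/funext => p /=; rewrite /h/= clE.
move=> p; apply: (@continuous_comp _ _ _ (@clamp R)); first exact: continuous_clamp.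
apply: (@continuous_comp _ _ _ (fun p => \row_j nth 0 [:: p.1.1; p.1.2; p.2] j) h).
  exact: continuous_row3.
apply: (C1_continuous oO gC1); rewrite /preimage/= clE; apply: OU; exact: chart_Omega.
Qed.

End ContinuousWeight.

(** * The curve gamma: explicit form, speed and Jacobian *)

Section SelfMotionCurve.
Context {R : realType}.
Local Notation mu := (@lebesgue_measure R).

Lemma expi_ang_eq (x y : R) : ang x = ang y -> expi x = expi y.
Proof. by move=> /ang_eq[k kE]; rewrite -(expiDk y k) -kE subrKC. Qed.

Lemma expi_repr (x : R) : expi (repr (ang x)) = expi x.
Proof. by apply: expi_ang_eq; rewrite /ang reprK. Qed.

Lemma expi_inj (x y : R) : expi x = expi y -> ang x = ang y.
Proof.
rewrite /expi => -[cxy sxy]; have [z z_int zE] := ang_window 0 (ang (x - y)).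
have cz : cos z = 1.
  have [->] := expi_ang_eq zE; rewrite cosB cxy sxy => _; exact: cos2Dsin2.
have : sin (z / 2) ^+ 2 = 0.
  have : cos z = 1 - 2 * sin (z / 2) ^+ 2.
    rewrite [in LHS](_ : z = z / 2 + z / 2); last by field.
    by rewrite cosD -!expr2; have := cos2Dsin2 (z / 2); lra.
  rewrite cz; lra.
move=> /eqP; rewrite sqrf_eq0 => /eqP s0.
have z0 : z = 0.
  have [zp|] := ltP 0 z; last by lra.
  have : 0 < sin (z / 2) by apply: sin_gt0_pi; lra.
  by rewrite s0 ltxx.
move: zE; rewrite z0 => /esym/ang_eq[k kE]; apply/ang_eq; exists k.
by rewrite -kE subr0.
Qed.

Lemma S_armE (u v : R) : S_arm u v = arm_re u v +i* arm_im u v.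
Proof.
by rewrite /S_arm /expi /arm_re /arm_im; simpc; congr (_ +i* _); ring.
Qed.

(** Since - e^(i v) = e^(i (v - pi)), its inverse is e^(i (pi - v)); this determines the first angle
    on the curve. *)
Lemma expi_mul_eq1 (t v : R) :
  expi t * (- cos v +i* - sin v) = 1 <-> ang t = ang (pi - v).
Proof.
have cs := cos2Dsin2 v.
have cv : cos (pi - v) = - cos v by rewrite addrC cosDpi cosN.
have sv : sin (pi - v) = sin v by rewrite addrC sinDpi sinN opprK.
split=> [h|h]; last first.
  rewrite (expi_ang_eq h) /expi cv sv; simpc; congr (_ +i* _); last by ring.
  by rewrite -!expr2.
apply: expi_inj; move: h; rewrite /expi cv sv; simpc => -[].
move: cs; set a := cos t; set b := sin t; set c := cos v; set s := sin v => cs h1 h2.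
have ea : a = - c * (- (a * c) + b * s) - s * (- (a * s) - b * c) + a * (1 - (c ^+ 2 + s ^+ 2)) by ring.
have eb : b = s * (- (a * c) + b * s) - c * (- (a * s) - b * c) + b * (1 - (c ^+ 2 + s ^+ 2)) by ring.
rewrite h1 h2 cs subrr !mulr0 !mulr1 subr0 addr0 in ea.
rewrite h1 h2 cs subrr !mulr0 !mulr1 subr0 addr0 in eb.
by congr (_ +i* _).
Qed.

(** On the curve S = - e^(i v_Gamma(u)), so [expi_mul_eq1] gives existence and uniqueness of the
    class, and with them the value of [get]. *)
Lemma theta_ang (u : R) : 4 * pi / 3 <= u <= 3 * pi / 2 ->
  theta u = ang (pi - v_Gamma u).
Proof.
have := pi_gt0 R => p0 u_int.
have [re im] : arm_re u (v_Gamma u) = - cos (v_Gamma u) /\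
    arm_im u (v_Gamma u) = - sin (v_Gamma u) by apply: arm_on_Gamma; lra.
pose T := [set t : circle R | expi (repr t) * S_arm u (v_Gamma u) = 1].
have TE (t : R) : T (ang t) <-> ang t = ang (pi - v_Gamma u).
  by rewrite /T/= expi_repr S_armE re im; exact: expi_mul_eq1.
have : T (theta u) by apply: (@getPex _ T); exists (ang (pi - v_Gamma u)); apply/TE.
by rewrite -[theta u]reprK => /TE.
Qed.

Lemma v_Gamma_itv (u : R) : 4 * pi / 3 < u <= 3 * pi / 2 ->
  pi < v_Gamma u < 4 * pi / 3.
Proof.
have := pi_gt0 R => p0 u_int; have u2 : 0 < u < 2 * pi by lra.
have v1 := v_Gamma_gtpi u2; have [v2 _] := v_Gamma_cmp u2.
by rewrite v1 v2//; lra.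
Qed.

Lemma gamma_ang (u : R) : 4 * pi / 3 <= u <= 3 * pi / 2 ->
  gamma u = (ang (pi - v_Gamma u), ang u, ang (v_Gamma u)).
Proof. by move=> u_int; rewrite /gamma theta_ang. Qed.

Lemma gamma_chart (u : R) : 4 * pi / 3 < u <= 3 * pi / 2 ->
  gamma u = chart (pi - v_Gamma u, u, v_Gamma u).
Proof.
have := pi_gt0 R => p0 u_int; have v_int := v_Gamma_itv u_int.
by rewrite gamma_ang ?chartE//; lra.
Qed.

(** For other lifts the difference changes by a multiple of 2 pi; if this is nonzero, the modulus
    becomes at least 2 pi - |x - y| >= |x - y|. The infimum is attained at (x, y). *)
Lemma circle_dist_ang (x y : R) : `|x - y| <= pi -> circle_dist (ang x) (ang y) = `|x - y|.
Proof.
have := pi_gt0 R => p0 xy; rewrite /circle_dist; set E := [set r | _].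
have lbE : lbound E `|x - y|.
  move=> _ [x' [y' [/ang_eq[k kE] /ang_eq[l lE] ->]]].
  have -> : x' - y' = (x - y) + (k - l)%:~R * (2 * pi).
    by rewrite intrB mulrBl -kE -lE; ring.
  have [->|kl] := eqVneq (k - l) 0; first by rewrite mul0r addr0.
  have : 2 * pi <= `|(k - l)%:~R * (2 * pi)| :> R.
    rewrite normrM -intr_norm (gtr0_norm (_ : 0 < 2 * pi)); last by lra.
    by rewrite ler_peMl ?ler1z ?normr_gt0 -?gtz0_ge1 ?normr_gt0//; lra.
  have := ler_normB ((x - y) + (k - l)%:~R * (2 * pi)) (x - y).
  rewrite addrAC subrr add0r; lra.
have Exy : E `|x - y| by exists x, y.
apply/eqP; rewrite eq_le; apply/andP; split.
  by apply: ge_inf => //; exists `|x - y|.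
by apply: lb_le_inf => //; exists `|x - y|.
Qed.

(** The denominator is A^2 for the amplitude of [v_Gamma_branch], whose phase relations express both
    sines through [f]. In this form the slope can be compared with [J_X]. *)
Lemma v_Gamma_slope (u : R) : 4 * pi / 3 <= u <= 3 * pi / 2 ->
  - 3 / (sin (u / 2) ^+ 2 + 9 * cos (u / 2) ^+ 2) = - (sin (v_Gamma u) / sin u).
Proof.
have := pi_gt0 R => p0 u_int.
have su := sin_lt0_regular u_int.
have u2 : pi <= u <= 3 * pi / 2 by lra.
have [A [f [vE fi A1 [cf sf _]]]] := @v_Gamma_branch R u u2.
have -> : sin (v_Gamma u) = - (2 * sin f * cos f).
  rewrite vE -[_ - _]opprB sinN [2 * f - _](_ : _ = (f + f) + (-1)%:~R * (2 * pi)); last by ring.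
  have [_ ->] := expiDk (f + f) (-1).
  by rewrite sinD; congr (- _); ring.
have sE : sin u = 2 * sin (u / 2) * cos (u / 2).
  rewrite [in LHS](_ : u = u / 2 + u / 2); last by field.
  by rewrite sinD; ring.
have cE : cos (u / 2) = - (A * sin f) / 3 by rewrite sf; field.
have cs := cos2Dsin2 f.
move: su; rewrite sE -cf cE; move: cs; set c := cos f; set s := sin f => cs.
have [->|c0] := eqVneq c 0; first by rewrite !mulr0 !mul0r ltxx.
have [->|s0] := eqVneq s 0; first by rewrite !(mulr0, mul0r, oppr0) ltxx.
move=> _.
have -> : (A * c) ^+ 2 + 9 * (- (A * s) / 3) ^+ 2 = A ^+ 2 * (c ^+ 2 + s ^+ 2) by field.
by rewrite cs mulr1; field; rewrite s0 c0 gt_eqF//; lra.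
Qed.

Lemma v_Gamma_quotient_cvg (u : R) : 4 * pi / 3 < u < 3 * pi / 2 ->
  h^-1 * (v_Gamma (u + h) - v_Gamma u) @[h --> 0^'] --> - (sin (v_Gamma u) / sin u).
Proof.
have := pi_gt0 R => p0 u_int; have u2 : 0 < u < 2 * pi by lra.
have dv := is_derive_v_Gamma u2.
rewrite -v_Gamma_slope; last by lra.
have := @ex_derive _ _ _ _ _ _ _ dv; rewrite /derivable => /cvg_ex[l hl].
have lE : l = - 3 / (sin (u / 2) ^+ 2 + 9 * cos (u / 2) ^+ 2).
  by rewrite -(@derive_val _ _ _ _ _ _ _ dv); apply/esym; apply: cvg_lim hl.
rewrite -lE; apply: cvg_trans hl; apply: near_eq_cvg; near=> h => /=.
by rewrite /GRing.scale/= mulr1 [u + h]addrC.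
Unshelve. all: by end_near. Qed.

(** The first and third angles are pi - v_Gamma(u) and v_Gamma(u), so both move at the rate of
    v_Gamma and the squared speed is 1 + 2 v_Gamma'(u)^2. *)
Lemma speed_gamma (u : R) : 4 * pi / 3 < u < 3 * pi / 2 ->
  speed (@gamma R) u = Num.sqrt (1 + 2 * (sin (v_Gamma u) / sin u) ^+ 2).
Proof.
have := pi_gt0 R => p0 u_int.
have : Num.sqrt (1 + 2 * (h^-1 * (v_Gamma (u + h) - v_Gamma u)) ^+ 2) @[h --> 0^'] -->
    Num.sqrt (1 + 2 * (sin (v_Gamma u) / sin u) ^+ 2).
  have q := v_Gamma_quotient_cvg u_int.
  have q2 : 1 + 2 * (h^-1 * (v_Gamma (u + h) - v_Gamma u)) ^+ 2 @[h --> 0^'] -->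
      1 + 2 * (sin (v_Gamma u) / sin u) ^+ 2.
    apply: cvgD; first exact: cvg_cst.
    apply: cvgMr; rewrite -[X in _ --> X]sqrrN.
    exact: (cvg_comp _ _ q (@exprn_continuous _ 2 _)).
  exact: (cvg_comp _ _ q2 (@sqrt_continuous R _)).
move=> lim1; apply: cvg_lim => //.
apply: cvg_trans lim1; apply: near_eq_cvg; near=> h.
have h0 : h != 0 by near: h; exact: nbhs_dnbhs_neq.
(* u + h must stay where [gamma_ang] and [v_Gamma_itv] hold; the latter keeps the angular
   differences within pi, as [circle_dist_ang] requires. *)
have hs : `|h| < Num.min (u - 4 * pi / 3) (3 * pi / 2 - u).
  near: h; apply: dnbhs0_lt; rewrite lt_min; apply/andP; split; lra.
move: hs; rewrite lt_min !ltr_norml => /andP[/andP[h1 h2] /andP[h3 h4]].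
have v1 : pi < v_Gamma u < 4 * pi / 3 by apply: v_Gamma_itv; lra.
have v2 : pi < v_Gamma (u + h) < 4 * pi / 3 by apply: v_Gamma_itv; lra.
rewrite !gamma_ang; [|lra|lra]; rewrite /torus3_dist/=.
rewrite !circle_dist_ang; [|rewrite ler_norml; lra..].
have -> : pi - v_Gamma (u + h) - (pi - v_Gamma u) = - (v_Gamma (u + h) - v_Gamma u) by ring.
rewrite normrN [u + h]addrC addrK !real_normK ?num_real//.
rewrite -(sqrtr_sqr h) -sqrtrV ?sqr_ge0// -sqrtrM ?addr_ge0 ?sqr_ge0//.
by congr Num.sqrt; field.
Unshelve. all: by end_near. Qed.

Let re3 (y : 'rV[R]_3) : R :=
  2 * cos (y 0 0) + cos (y 0 0 + y 0 1) + 2 * cos (y 0 0 + y 0 1 + y 0 ord_max).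
Let im3 (y : 'rV[R]_3) : R :=
  2 * sin (y 0 0) + sin (y 0 0 + y 0 1) + 2 * sin (y 0 0 + y 0 1 + y 0 ord_max).

Lemma X_coordE (y : 'rV[R]_3) :
  X_coord y = re3 y *: delta_mx 0 0 + im3 y *: delta_mx 0 1.
Proof.
apply/rowP => j; rewrite /X_coord !mxE X_proj3 /expi; simpc.
by case: j => [[|[|]]]//= ?; rewrite ?mulr1n ?mulr0n ?mulr1 ?mulr0 ?addr0 ?add0r.
Qed.

Lemma is_derive_along (V : normedModType R) (f : V -> R) (y v : V) (d : R) :
  is_derive (0 : R) 1 (fun s : R => f (s *: v + y)) d -> is_derive y v f d.
Proof.
move=> df; have d1 : derivable f y v.
  by apply/derivable1P; exact: (@ex_derive _ _ _ _ _ _ _ df).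
apply: DeriveDef => //; rewrite -(@derive_val _ _ _ _ _ _ _ df) /derive.
have E : (fun h : R => h^-1 *: (f (h *: v + y) - f y)) =
    (fun h : R => h^-1 *: (f ((h * 1 + 0 : R) *: v + y) - f ((0 : R) *: v + y))).
  by apply/funext => h; rewrite addr0 scale0r add0r mulr1.
exact: (congr1 (fun k : R -> R => lim (k h @[h --> 0^'])) E).
Qed.

Let is_derive_shift (A a : R) : is_derive (0 : R) 1 (fun s => A + s * a) a.
Proof. by apply: is_derive_eq; rewrite /GRing.scale/=; ring. Qed.

Let is_derive_cos_shift (A a : R) :
  is_derive (0 : R) 1 (fun s => cos (A + s * a)) (- (sin A * a)).
Proof.
have := @is_derive1_comp _ cos (fun s => A + s * a) 0 _ _ (is_derive_cos _) (is_derive_shift A a).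
by rewrite mul0r addr0 mulNr.
Qed.

Let is_derive_sin_shift (A a : R) :
  is_derive (0 : R) 1 (fun s => sin (A + s * a)) (cos A * a).
Proof.
have := @is_derive1_comp _ sin (fun s => A + s * a) 0 _ _ (is_derive_sin _) (is_derive_shift A a).
by rewrite mul0r addr0.
Qed.

Lemma is_derive_re3 (y v : 'rV[R]_3) :
  is_derive y v re3 (- (2 * (sin (y 0 0) * v 0 0)
    + sin (y 0 0 + y 0 1) * (v 0 0 + v 0 1)
    + 2 * (sin (y 0 0 + y 0 1 + y 0 ord_max) * (v 0 0 + v 0 1 + v 0 ord_max)))).
Proof.
apply: is_derive_along.
have -> : (fun s : R => re3 (s *: v + y)) =
  (fun s => 2 * cos (y 0 0 + s * v 0 0) +
    cos (y 0 0 + y 0 1 + s * (v 0 0 + v 0 1)) +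
    2 * cos (y 0 0 + y 0 1 + y 0 ord_max + s * (v 0 0 + v 0 1 + v 0 ord_max))).
  apply/funext => s; rewrite /re3 !mxE.
  by congr (2 * cos _ + cos _ + 2 * cos _); ring.
have h := is_deriveD (is_deriveD (is_deriveZ 2 (is_derive_cos_shift (y 0 0) (v 0 0)))
  (is_derive_cos_shift (y 0 0 + y 0 1) (v 0 0 + v 0 1)))
  (is_deriveZ 2 (is_derive_cos_shift (y 0 0 + y 0 1 + y 0 ord_max) (v 0 0 + v 0 1 + v 0 ord_max))).
by apply: (is_derive_eq h); rewrite /GRing.scale/=; ring.
Qed.

Lemma is_derive_im3 (y v : 'rV[R]_3) :
  is_derive y v im3 (2 * (cos (y 0 0) * v 0 0)
    + cos (y 0 0 + y 0 1) * (v 0 0 + v 0 1)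
    + 2 * (cos (y 0 0 + y 0 1 + y 0 ord_max) * (v 0 0 + v 0 1 + v 0 ord_max))).
Proof.
apply: is_derive_along.
have -> : (fun s : R => im3 (s *: v + y)) =
  (fun s => 2 * sin (y 0 0 + s * v 0 0) +
    sin (y 0 0 + y 0 1 + s * (v 0 0 + v 0 1)) +
    2 * sin (y 0 0 + y 0 1 + y 0 ord_max + s * (v 0 0 + v 0 1 + v 0 ord_max))).
  apply/funext => s; rewrite /im3 !mxE.
  by congr (2 * sin _ + sin _ + 2 * sin _); ring.
have h := is_deriveD (is_deriveD (is_deriveZ 2 (is_derive_sin_shift (y 0 0) (v 0 0)))
  (is_derive_sin_shift (y 0 0 + y 0 1) (v 0 0 + v 0 1)))
  (is_deriveZ 2 (is_derive_sin_shift (y 0 0 + y 0 1 + y 0 ord_max) (v 0 0 + v 0 1 + v 0 ord_max))).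
by apply: (is_derive_eq h); rewrite /GRing.scale/=; ring.
Qed.

Lemma differentiable_X_coord (y : 'rV[R]_3) : differentiable (@X_coord R) y.
Proof.
have dc (x : R) : differentiable (@cos R) x.
  by apply/derivable1_diffP; exact: (@ex_derive _ _ _ _ _ _ _ (is_derive_cos x)).
have ds (x : R) : differentiable (@sin R) x.
  by apply/derivable1_diffP; exact: (@ex_derive _ _ _ _ _ _ _ (is_derive_sin x)).
have d0 (i : 'I_3) : differentiable (fun z : 'rV[R]_3 => z 0 i) y by exact: differentiable_coord.
have d1 := differentiableD (d0 0) (d0 1).
have d2 := differentiableD d1 (d0 ord_max).
have -> : @X_coord R = (fun y => re3 y *: delta_mx 0 0) + (fun y => im3 y *: delta_mx 0 1).
  by apply/funext => z; rewrite X_coordE.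
apply: differentiableD; apply: differentiableZl.
  apply: (differentiableD (differentiableD (differentiableZ 2 _) _) (differentiableZ 2 _)).
  - exact: (differentiable_comp (d0 0) (dc _)).
  - exact: (differentiable_comp d1 (dc _)).
  - exact: (differentiable_comp d2 (dc _)).
apply: (differentiableD (differentiableD (differentiableZ 2 _) _) (differentiableZ 2 _)).
- exact: (differentiable_comp (d0 0) (ds _)).
- exact: (differentiable_comp d1 (ds _)).
- exact: (differentiable_comp d2 (ds _)).
Qed.

Lemma diff_X_coord (y : 'rV[R]_3) (k : 'I_3) (i : 'I_2) :
  'd (@X_coord R) y (delta_mx 0 k) 0 i = 'D_(delta_mx 0 k) (fun z => X_coord z 0 i) y.
Proof.
have dX := differentiable_X_coord y.
have dv : derivable (@X_coord R) y (delta_mx 0 k) by exact: diff_derivable.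
by rewrite -deriveE// derive_mx// mxE.
Qed.

Lemma X_coord0 : (fun z : 'rV[R]_3 => X_coord z 0 0) = re3.
Proof. by apply/funext => z; rewrite X_coordE !mxE/= mulr1 mulr0 addr0. Qed.

Lemma X_coord1 : (fun z : 'rV[R]_3 => X_coord z 0 1) = im3.
Proof. by apply/funext => z; rewrite X_coordE !mxE/= mulr1 mulr0 add0r. Qed.

Lemma det_mx2 (A : 'M[R]_2) : \det A = A 0 0 * A 1 1 - A 0 1 * A 1 0.
Proof.
rewrite (expand_det_row _ 0) !big_ord_recl big_ord0 addr0 /cofactor !det_mx11 !mxE/=.
have l0 : lift 0 0 = 1 :> 'I_2 by exact/val_inj.
have l1 : lift 1 0 = 0 :> 'I_2 by exact/val_inj.
by rewrite !l0 ?l1 /bump/= expr0 expr1 mul1r mulN1r mulrN.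
Qed.

Lemma angD_eq (x x' y y' : R) : ang x = ang x' -> ang y = ang y' ->
  ang (x + y) = ang (x' + y').
Proof.
move=> /ang_eq[k kE] /ang_eq[l lE]; apply/ang_eq; exists (k + l).
by rewrite intrD mulrDl -kE -lE; ring.
Qed.

(** [DX] is taken at [lift3], of which only the classes modulo 2 pi are known. They fix the sines
    and cosines of the partial sums of the angles, which are congruent to pi - v, u - v + pi and u +
    pi. *)
Lemma J_X_gamma (u : R) : 4 * pi / 3 <= u <= 3 * pi / 2 ->
  J_X (gamma u) = Num.sqrt (4 * sin u ^+ 2 + 8 * sin (v_Gamma u) ^+ 2).
Proof.
have := pi_gt0 R => p0 u_int; rewrite /J_X /DX; congr Num.sqrt.
have [re im] : arm_re u (v_Gamma u) = - cos (v_Gamma u) /\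
    arm_im u (v_Gamma u) = - sin (v_Gamma u) by apply: arm_on_Gamma; lra.
have yE := lift3K (gamma u); rewrite gamma_ang// in yE *.
move: (lift3 _) yE => y yE; move: (v_Gamma u) yE re im => v yE re im.
case: yE => y0 y1 y2.
have [cA sA] : expi (y 0 0) = expi (pi - v) by exact: expi_ang_eq.
have a01 := angD_eq y0 y1.
have [cB sB] : expi (y 0 0 + y 0 1) = expi (pi - v + u) by exact: expi_ang_eq.
have [cC sC] : expi (y 0 0 + y 0 1 + y 0 ord_max) = expi (pi - v + u + v).
  by apply: expi_ang_eq; exact: angD_eq.
rewrite [pi - v]addrC in cA sA; rewrite cosDpi cosN in cA; rewrite sinDpi sinN opprK in sA.
rewrite (_ : pi - v + u = (u - v) + pi) in cB sB; last by ring.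
rewrite cosDpi cosB in cB; rewrite sinDpi sinB in sB.
rewrite (_ : pi - v + u + v = u + pi) in cC sC; last by ring.
rewrite cosDpi in cC; rewrite sinDpi in sC.
rewrite det_mx2 !mxE !big_ord_recl !big_ord0 !mxE.
have l1 : lift 0 0 = 1 :> 'I_3 by exact/val_inj.
have l2 : lift 0 (lift 0 0) = ord_max :> 'I_3 by exact/val_inj.
rewrite !l2 !l1 !diff_X_coord !X_coord0 !X_coord1.
rewrite !(@derive_val _ _ _ _ _ _ _ (is_derive_re3 y _)).
rewrite !(@derive_val _ _ _ _ _ _ _ (is_derive_im3 y _)) !mxE/=.
rewrite cA sA cB sB cC sC.
move: re im; rewrite /arm_re /arm_im cosD sinD.
have := cos2Dsin2 u; have := cos2Dsin2 v.
set cv := cos v; set sv := sin v; set cu := cos u; set su := sin u => hv hu re im.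
(* [E1] and [E2] are the components of X = 1; they make the q_1 column of [DX], which is i X, equal
   to (0, 1). *)
have E1 : - (2 * cv) - (cu * cv + su * sv) - 2 * cu = 1.
  have : - cv * (2 + cu + 2 * (cu * cv - su * sv)) - sv * (su + 2 * (su * cv + cu * sv)) =
      - (2 * cv) - (cu * cv + su * sv) - 2 * cu * (cv ^+ 2 + sv ^+ 2) by ring.
  rewrite re im hv mulr1 => <-.
  by rewrite -hv; ring.
have E2 : 2 * sv + cu * sv - su * cv - 2 * su = 0.
  have : sv * (2 + cu + 2 * (cu * cv - su * sv)) - cv * (su + 2 * (su * cv + cu * sv)) =
      2 * sv + cu * sv - su * cv - 2 * su * (cv ^+ 2 + sv ^+ 2) by ring.
  rewrite re im hv mulr1 => <-.
  by ring.
have key (a0 a1 a2 b0 b1 b2 : R) : a0 = 0 -> a1 = 2 * sv -> a2 = 2 * su ->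
    b0 = 1 -> b1 = 1 + 2 * cv -> b2 = - (2 * cu) ->
    (a0 * a0 + (a1 * a1 + (a2 * a2 + 0))) * (b0 * b0 + (b1 * b1 + (b2 * b2 + 0))) -
    (a0 * b0 + (a1 * b1 + (a2 * b2 + 0))) * (b0 * a0 + (b1 * a1 + (b2 * a2 + 0))) =
    4 * su ^+ 2 + 8 * sv ^+ 2.
  move=> -> -> -> -> -> ->.
  (* By Cauchy-Binet the determinant is the sum of the squares of the minors, which are up to sign 2
     sin u, 2 sin v and 2 [arm_im]; on the curve [arm_im] is - sin v. *)
  transitivity (4 * su ^+ 2 + 4 * sv ^+ 2 + (2 * (su + 2 * (su * cv + cu * sv))) ^+ 2).
    by ring.
  by rewrite im; ring.
apply: key.
- by move: E2; rewrite ?mulr1n ?mulr0n; lra.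
- by move: E2; rewrite ?mulr1n ?mulr0n; lra.
- by rewrite ?mulr1n ?mulr0n; ring.
- by move: E1; rewrite ?mulr1n ?mulr0n; lra.
- by move: E1; rewrite ?mulr1n ?mulr0n; lra.
- by rewrite ?mulr1n ?mulr0n; ring.
Qed.

Lemma arclength_density (u : R) : 4 * pi / 3 < u < 3 * pi / 2 ->
  speed (@gamma R) u / J_X (gamma u) = (2 * - sin u)^-1.
Proof.
have := pi_gt0 R => p0 u_int; have u_int' : 4 * pi / 3 <= u <= 3 * pi / 2 by lra.
have su := sin_lt0_regular u_int'.
rewrite speed_gamma// J_X_gamma//; set s := sin u in su *; set t := sin (v_Gamma u).
have -> : 4 * s ^+ 2 + 8 * t ^+ 2 = (2 * - s) ^+ 2 * (1 + 2 * (t / s) ^+ 2).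
  by field; rewrite lt_eqF.
have d0 : 0 < 1 + 2 * (t / s) ^+ 2 by rewrite ltr_pwDl// mulr_ge0// sqr_ge0.
rewrite sqrtrM ?sqr_ge0// sqrtr_sqr gtr0_norm; last by rewrite mulr_gt0// oppr_gt0.
rewrite invfM mulrCA mulfV ?mulr1// gt_eqF// sqrtr_gt0//.
Qed.

(** [arclength_density] holds in the open interval only, since the speed at an end involves
    parameters beyond it; the ends are a null set. *)
Lemma Gamma_integralE (f : torus3 R -> R) : continuous (f \o @chart R) ->
  2 * pi * Gamma_integral (fun p => f p / J_X p) =
  \int[mu]_(u in `[4 * pi / 3, 3 * pi / 2])
    (pi * (f \o @chart R) (pi - v_Gamma u, u, v_Gamma u) / - sin u).
Proof.
have := pi_gt0 R => p0 cf; set F := f \o @chart R.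
pose g u := pi * F (pi - v_Gamma u, u, v_Gamma u) / - sin u.
have cg : {within `[4 * pi / 3, 3 * pi / 2], continuous g} := regular_density_continuous cf.
have ig : mu.-integrable `[4 * pi / 3, 3 * pi / 2] (EFin \o g).
  by apply: continuous_compact_integrable => //; exact: segment_compact.
have gE u : 4 * pi / 3 < u < 3 * pi / 2 ->
    f (gamma u) / J_X (gamma u) * speed (@gamma R) u = (2 * pi)^-1 * g u.
  move=> u_int; rewrite -mulrA [_^-1 * speed _ _]mulrC arclength_density//.
  have -> : f (gamma u) = F (pi - v_Gamma u, u, v_Gamma u) by rewrite gamma_chart//; lra.
  have su : sin u < 0 by apply: sin_lt0_regular; lra.
  have alg (y s p : R) : s != 0 -> p != 0 -> y / (2 * - s) = (2 * p)^-1 * (p * y / - s).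
    by move=> s0 p1; field; rewrite s0.
  exact: (alg _ _ _ (ltr0_neq0 su) (lt0r_neq0 p0)).
have mg : measurable_fun `[4 * pi / 3, 3 * pi / 2] g.
  exact: subspace_continuous_measurable_fun.
have -> : Gamma_integral (fun p => f p / J_X p) =
    \int[mu]_(u in `[4 * pi / 3, 3 * pi / 2]) ((2 * pi)^-1 * g u).
  rewrite /Gamma_integral /arc_integral /Rintegral; congr fine.
  have oE (h : R -> \bar R) : measurable_fun `]4 * pi / 3, 3 * pi / 2[ h ->
      (\int[mu]_(x in `[(4 * pi / 3)%R, (3 * pi / 2)%R]) h x =
       \int[mu]_(x in `](4 * pi / 3)%R, (3 * pi / 2)%R[) h x)%E.
    by move=> mh; rewrite integral_itv_bndoo.
  have mo : measurable_fun `]4 * pi / 3, 3 * pi / 2[ (fun u => ((2 * pi)^-1 * g u)%:E).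
    apply: (iffRL (measurable_EFinP _ _)); apply: measurable_funM => //.
    by apply: measurable_funS mg => // x /=; rewrite !in_itv/= => /andP[/ltW -> /ltW ->].
  have E : {in `]4 * pi / 3, 3 * pi / 2[%classic, (fun u => ((2 * pi)^-1 * g u)%:E) =1
      (fun u => (f (gamma u) / J_X (gamma u) * speed (@gamma R) u)%:E)}.
    by move=> u /set_mem; rewrite /= in_itv/= => u_int; rewrite gE.
  rewrite !oE//; last by apply: eq_measurable_fun mo.
  by apply: eq_integral => u uin; rewrite E.
rewrite RintegralZl// mulrA mulfV ?mul1r// mulf_neq0 ?pnatr_eq0//.
exact: lt0r_neq0.
Qed.

End SelfMotionCurve.

(** * The integral over Omega in coordinates, and its limit *)

Section PartitionFunction.
Context {R : realType}.
Local Notation mu := (@lebesgue_measure R).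

Let kinetic3 (p : R * R * R) : R :=
  kinetic (arm_re p.1.2 p.2) (arm_im p.1.2 p.2) p.1.1.

Lemma continuous_kinetic3 : continuous kinetic3.
Proof.
move=> [[x u] v]; pose z0 := (x, u, v).
have c1 : z.1.1 @[z --> z0] --> x by exact: (cvg_comp _ _ cvg_fst cvg_fst).
have c2 : z.1.2 @[z --> z0] --> u by exact: (cvg_comp _ _ cvg_fst cvg_snd).
have c3 : z.2 @[z --> z0] --> v by exact: cvg_snd.
have c23 : (z.1.2 + z.2) @[z --> z0] --> u + v by exact: cvgD.
have cc (f : R * R * R -> R) (l : R) : f z @[z --> z0] --> l -> cos (f z) @[z --> z0] --> cos l.
  by move=> h; exact: (cvg_comp _ _ h (@continuous_cos R _)).
have cs (f : R * R * R -> R) (l : R) : f z @[z --> z0] --> l -> sin (f z) @[z --> z0] --> sin l.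
  by move=> h; exact: (cvg_comp _ _ h (@continuous_sin R _)).
have sq (f : R * R * R -> R) (l : R) : f z @[z --> z0] --> l -> f z ^+ 2 @[z --> z0] --> l ^+ 2.
  by move=> h; exact: (cvg_comp _ _ h (@exprn_continuous _ 2 _)).
have re : arm_re z.1.2 z.2 @[z --> z0] --> arm_re u v.
  apply: cvgD; first by apply: cvgD; [exact: cvg_cst|exact: cc].
  by apply: cvgMr; exact: cc.
have im : arm_im z.1.2 z.2 @[z --> z0] --> arm_im u v.
  by apply: cvgD; [exact: cs|apply: cvgMr; exact: cs].
apply: cvgD; apply: sq.
  apply: cvgB; last exact: cvg_cst.
  by apply: cvgB; apply: cvgM => //; [exact: cc|exact: cs].
by apply: cvgD; apply: cvgM => //; [exact: cs|exact: cc].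
Qed.

Lemma Re_sqr_norm (z : R[i]) :
  complex.Re (`|z| ^+ 2) = complex.Re z ^+ 2 + complex.Im z ^+ 2.
Proof.
case: z => a b; rewrite normc_def expr2; simpc; rewrite -expr2 sqr_sqrtr//.
by rewrite addr_ge0 ?sqr_ge0.
Qed.

Lemma energy_ang (x u v : R) :
  complex.Re (`|X (ang x, ang u, ang v) - 1| ^+ 2) = kinetic3 (x, u, v).
Proof.
pose y : 'rV[R]_3 := \row_j nth 0 [:: x; u; v] j.
have -> : (ang x, ang u, ang v) = proj3 y by rewrite /proj3 !mxE.
rewrite Re_sqr_norm X_proj3 !mxE /expi /kinetic3 /kinetic /arm_re /arm_im.
simpc; rewrite /=.
rewrite -[x + u + v]addrA !(cosD x) !(sinD x).
by congr (_ ^+ 2 + _ ^+ 2); ring.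
Qed.

Lemma energy_chart p :
  complex.Re (`|X (chart p) - 1| ^+ 2) = kinetic3 (clamp p).
Proof. by rewrite -energy_ang; case: (clamp p) => -[]. Qed.

(** Two exchanges bring the q_1 integral to the innermost place, where [slice_integral] has it. *)
Lemma tonelli_swap3 (g : R * R * R -> \bar R) :
  measurable_fun [set: R * R * R] g -> (forall p, (0 <= g p)%E) ->
  (\int[mu]_x \int[mu]_u \int[mu]_v g (x, u, v) =
   \int[mu]_u \int[mu]_v \int[mu]_x g (x, u, v))%E.
Proof.
move=> mg g0.
have mG := @measurable_fun_fubini_tonelli_F _ _ (measurableTypeR R * measurableTypeR R)%type
  (measurableTypeR R) R mu g mg g0.
have G0 p : (0 <= fubini_F mu g p)%E by exact: integral_ge0.
rewrite (@fubini_tonelli _ _ (measurableTypeR R) (measurableTypeR R) R mu mu _ mG G0).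
apply: eq_integral => u _.
pose h (p : R * R) := g (p.1, u, p.2).
have mh : measurable_fun [set: R * R] h.
  apply: (measurableT_comp mg); apply: measurable_fun_pair => //.
  by apply: measurable_fun_pair.
exact: (@fubini_tonelli _ _ (measurableTypeR R) (measurableTypeR R) R mu mu h mh (fun p => g0 _)).
Qed.

Variable w : torus3 R -> R.
Hypotheses (cw : continuous (w \o @chart R)) (w_gt0 : forall q, Omega q -> 0 < w q).

Lemma continuous_weighted (f : torus3 R -> R) z : continuous (f \o @chart R) ->
  continuous ((fun q => f q * weight w z q) \o @chart R).
Proof.
move=> cf p.
have -> : (fun q => f q * weight w z q) \o @chart R = (fun p => (f \o @chart R) p *
    ((w \o @chart R) p * expR (- (z / 2) * (kinetic3 \o @clamp R) p))).
  by apply/funext => t; rewrite /weight -[((fun q => _) \o _) t]/(_ * (_ * expR (_ * complex.Re (`|X (chart t) - 1| ^+ 2)))) energy_chart.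
apply: cvgM; first exact: cf.
apply: cvgM; first exact: cw.
have ck : {for p, continuous (kinetic3 \o @clamp R)}.
  apply: (@continuous_comp _ _ _ (@clamp R) kinetic3); first exact: continuous_clamp.
  exact: continuous_kinetic3.
have ce : - (z / 2) * (kinetic3 \o @clamp R) x @[x --> p] --> - (z / 2) * (kinetic3 \o @clamp R) p.
  by apply: cvgMr; exact: ck.
exact: (cvg_comp _ _ ce (@continuous_expR R _)).
Qed.

Lemma weight_ge0 z q : Omega q -> 0 <= weight w z q.
Proof. by move=> qO; rewrite mulr_ge0 ?expR_ge0// ltW// w_gt0. Qed.

(** Everything is first written over R^3 with indicators, so that the order of integration can be
    changed; on the box [chart] agrees with the angles, and off the box the indicators vanish. *)
Lemma ge0_integral_Omega (f : torus3 R -> R) z : 0 < z ->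
  continuous (f \o @chart R) -> (forall q, Omega q -> 0 <= f q) ->
  (\int[@volume3 R]_(q in @Omega R) (f q * weight w z q)%:E =
   \int[mu]_(u in `[0%R, (3 * pi / 2)%R]) \int[mu]_(v in `[pi, (4 * pi / 3)%R])
     slice_integral (fun p => (f \o @chart R) p * (w \o @chart R) p)%R (Num.sqrt z) (u, v))%E.
Proof.
have := pi_gt0 R => p0 z0 cf f0.
have mG := measurable_on_Omega (continuous_weighted (z := z) cf).
have mO := @measurable_Omega R.
rewrite integral_mkcond ge0_integral_volume3; last 2 first.
- by apply/(measurable_restrictT _ mO); apply: (iffRL (measurable_EFinP _ _)).
- move=> q; rewrite patchE; case: ifPn => // /set_mem qO.
  by rewrite lee_fin mulr_ge0 ?weight_ge0// f0.
pose X0 : set R := `[0, 2 * pi[%classic.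
pose U0 : set R := `[0, 3 * pi / 2]%classic.
pose V0 : set R := `[pi, 4 * pi / 3]%classic.
pose F p := (f \o @chart R) p * (w \o @chart R) p.
have cF : continuous F by move=> p; apply: cvgM; [exact: cf|exact: cw].
have F0 p : 0 <= F p by rewrite mulr_ge0 ?f0 ?(ltW (w_gt0 _))//; exact: chart_Omega.
pose g (p : R * R * R) : \bar R := (F p * expR (- (Num.sqrt z ^+ 2 / 2) * kinetic3 p) *
  (\1_X0 p.1.1 * (\1_U0 p.1.2 * \1_V0 p.2)))%:E.
have mX0 : measurable X0 by exact: measurable_itv.
have mU0 : measurable U0 by exact: measurable_itv.
have mV0 : measurable V0 by exact: measurable_itv.
have mg : measurable_fun [set: R * R * R] g.
  apply: (iffRL (measurable_EFinP _ _)); apply: measurable_funM.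
    apply: measurable_funM; first exact: continuous_measurable_R3.
    apply: measurableT_comp => //; apply: measurable_funM => //.
    exact: continuous_measurable_R3 continuous_kinetic3.
  apply: measurable_funM.
    apply: (measurableT_comp (measurable_indic mX0)).
    exact: (measurableT_comp measurable_fst measurable_fst).
  apply: measurable_funM.
    apply: (measurableT_comp (measurable_indic mU0)).
    exact: (measurableT_comp measurable_snd measurable_fst).
  exact: (measurableT_comp (measurable_indic mV0) measurable_snd).
have g0 p : (0 <= g p)%E.
  rewrite lee_fin; apply: mulr_ge0; last by rewrite !mulr_ge0.
  by apply: mulr_ge0; [exact: F0|exact: expR_ge0].
transitivity (\int[mu]_x \int[mu]_u \int[mu]_v g (x, u, v))%E.
  rewrite integral_mkcond; apply: eq_integral => x _; rewrite patchE.
  case: ifPn => xin; last first.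
    rewrite integral0_eq// => u _; rewrite integral0_eq// => v _.
    by rewrite /g/= [\1_X0 x]indicE (negbTE xin) !(mul0r, mulr0).
  rewrite integral_mkcond; apply: eq_integral => u _; rewrite patchE.
  case: ifPn => uin; last first.
    rewrite integral0_eq// => v _; rewrite /g/= (_ : \1_U0 u = 0) ?(mul0r, mulr0)//.
    apply: indic_out; move/negP: uin => uin /= h; apply: uin; apply/mem_set.
    by move: h; rewrite /U0/= !in_itv/=; lra.
  rewrite integral_mkcond; apply: eq_integral => v _; rewrite patchE.
  move: xin uin => /set_mem; rewrite /= in_itv/= => xi /set_mem; rewrite /= in_itv/= => ui.
  case: ifPn => vin; last first.
    rewrite /g/= (_ : \1_V0 v = 0) ?(mul0r, mulr0)//.
    apply: indic_out; move/negP: vin => vin /= h; apply: vin; apply/mem_set.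
    by move: h; rewrite /V0/= !in_itv/=; lra.
  move: vin => /set_mem; rewrite /= in_itv/= => vi.
  have xX : X0 x by rewrite /X0/= in_itv.
  rewrite patchE; case: ifPn => [/set_mem/OmegaE|/negP qO]/=; last first.
    have [uU|uU] := pselect (U0 u); last by rewrite /g/= (indic_out uU) !(mul0r, mulr0).
    have [vV|vV] := pselect (V0 v); last by rewrite /g/= (indic_out vV) !(mul0r, mulr0).
    exfalso; apply: qO; apply/mem_set; split; apply: imageP => //.
  rewrite !circle_coord_ang// => -[uU vV].
  have uU' : U0 u by rewrite /U0/= in_itv.
  have vV' : V0 v by rewrite /V0/= in_itv.
  rewrite /g/= !indic_in// !mulr1 /weight energy_ang sqr_sqrtr ?ltW// /F/=.
  by rewrite chartE// mulrA.
rewrite (tonelli_swap3 mg g0) [RHS]integral_mkcond.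
apply: eq_integral => u _; rewrite patchE.
case: ifPn => [/set_mem uU|/negP uU]; last first.
  rewrite integral0_eq// => v _; rewrite integral0_eq// => x _.
  rewrite /g/= [\1_U0 u]indic_out ?(mul0r, mulr0)// => h; apply: uU; exact/mem_set.
rewrite [RHS]integral_mkcond; apply: eq_integral => v _; rewrite patchE.
case: ifPn => [/set_mem vV|/negP vV]; last first.
  rewrite integral0_eq// => x _.
  rewrite /g/= [\1_V0 v]indic_out ?(mul0r, mulr0)// => h; apply: vV; exact/mem_set.
rewrite /slice_integral /inner_integral [RHS]integral_mkcond; apply: eq_integral => x _.
rewrite patchE /g/= (indic_in uU) (indic_in vV) !mulr1 indicE.
by case: ifPn => _; rewrite ?mulr1 ?mulr0.
Qed.

(** The real form of [limit_functional] with the value of [C_fold] inserted; the complex one is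
    recovered by components. *)
Definition limit_value (f : torus3 R -> R) : R :=
  2 * pi * Gamma_integral (fun p => f p * w p / J_X p) + pi / 4 * ln 3 * f (q0 R) * w (q0 R).

Let curve_density f u :=
  pi * ((fun q => f q * w q) \o @chart R) (pi - v_Gamma u, u, v_Gamma u) / - sin u.

Let continuous_fw (f : torus3 R -> R) : continuous (f \o @chart R) ->
  continuous ((fun q => f q * w q) \o @chart R).
Proof. by move=> cf p; apply: cvgM; [exact: cf|exact: cw]. Qed.

Lemma integrable_curve_density (f : torus3 R -> R) : continuous (f \o @chart R) ->
  mu.-integrable `[4 * pi / 3, 3 * pi / 2] (EFin \o curve_density f).
Proof.
move=> /continuous_fw/regular_density_continuous cf.
by apply: continuous_compact_integrable => //; exact: segment_compact.
Qed.

Lemma limit_valueE (f : torus3 R -> R) : continuous (f \o @chart R) -> limit_value f =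
  \int[mu]_(u in `[4 * pi / 3, 3 * pi / 2]) curve_density f u +
  pi / 4 * ln 3 * f (q0 R) * w (q0 R).
Proof. by move=> cf; rewrite /limit_value Gamma_integralE//; exact: continuous_fw. Qed.

Lemma limit_valueB (f1 f2 : torus3 R -> R) :
  continuous (f1 \o @chart R) -> continuous (f2 \o @chart R) ->
  limit_value (fun q => f1 q - f2 q) = limit_value f1 - limit_value f2.
Proof.
move=> c1 c2.
have i1 := integrable_curve_density c1; have i2 := integrable_curve_density c2.
rewrite !limit_valueE//; last by move=> p; apply: cvgB; [exact: c1|exact: c2].
rewrite opprD addrACA -RintegralB//.
congr (_ + _); last by ring.
by apply: eq_Rintegral => u _; rewrite /curve_density/=; ring.
Qed.

Lemma ge0_laplace (f : torus3 R -> R) :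
  continuous (f \o @chart R) -> (forall q, Omega q -> 0 <= f q) ->
  (z%:E * \int[@volume3 R]_(q in @Omega R) (f q * weight w z q)%:E)%E @[z --> +oo] -->
  (limit_value f)%:E.
Proof.
have := pi_gt0 R => p0 cf f0; rewrite limit_valueE//.
pose F p := (f \o @chart R) p * (w \o @chart R) p.
have cF : continuous F by exact: continuous_fw.
have F0 p : 0 <= F p by rewrite mulr_ge0 ?f0 ?(ltW (w_gt0 _))//; exact: chart_Omega.
have [M FM] : exists M, forall p, F p <= M.
  have [M h] := bounded_on_Omega (continuous_fw cf); exists M => p.
  by apply: le_trans (ler_norm _) (h _ _); exact: chart_Omega.
have FT x u v : F (x + 2 * pi, u, v) = F (x, u, v) by rewrite /F/= chart_periodic.
(* The limit at infinity is tested on sequences. The maximum with 1 makes [a n] positive for every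
   [n]; eventually [a n] is sqrt (b n). *)
apply/cvge_pinftyP => b boo; pose a n := Num.sqrt (Num.max 1 (b n)).
have a0 n : 0 < a n by rewrite sqrtr_gt0 lt_max ltr01.
have aoo : a n @[n --> \oo] --> +oo.
  apply: sqrt_pinfty; apply/cvgryPge => A.
  move/cvgryPge : boo => /(_ A); apply: filterS => n h.
  by rewrite le_max h orbT.
have E : ((F (0, 0, pi) * (pi / 4 * ln 3))%:E +
   \int[mu]_(x in `[(4 * pi / 3)%R, (3 * pi / 2)%R])
     (pi * F (pi - v_Gamma x, x, v_Gamma x) / - sin x)%:E)%E =
   (\int[mu]_(u in `[4 * pi / 3, 3 * pi / 2]) curve_density f u +
  pi / 4 * ln 3 * f (q0 R) * w (q0 R))%:E.
  have -> : F (0, 0, pi) = f (q0 R) * w (q0 R) by rewrite /F/= chartE//; lra.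
  rewrite -[X in (_ + X)%E]fineK; last first.
    by apply: integrable_fin_num => //; exact: integrable_curve_density.
  by rewrite -EFinD addrC; congr (_ + _)%:E; ring.
have := configuration_integral_cvg cF F0 FM FT a0 aoo; rewrite E.
apply: cvg_trans; apply: near_eq_cvg.
move/cvgryPge : boo => /(_ 1); apply: filterS => n b1.
have b0 : 0 < b n by exact: lt_le_trans b1.
have aE : a n = Num.sqrt (b n) by rewrite /a max_r.
by rewrite (ge0_integral_Omega b0 cf f0) /F aE sqr_sqrtr; [reflexivity|exact: ltW].
Qed.

Lemma volume3_setT_lty : (@volume3 R setT < +oo)%E.
Proof.
have I (c : R) : (\int[mu]_(x in `[0%R, (2 * pi)%R[) c%:E = (c * (2 * pi))%:E)%E.
  transitivity (c%:E * mu (`[0%R, (2 * pi)%R[%classic : set R))%E; first exact: integral_cst.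
  by rewrite lebesgue_measure_itv/= lte_fin mulr_gt0 ?pi_gt0// sube0 EFinM.
rewrite -[X in (X < _)%E]mul1e -[1%E]/(1%:E) -integral_cst// ge0_integral_volume3//.
under eq_integral do under eq_integral do rewrite I.
under eq_integral do rewrite I.
by rewrite I ltry.
Qed.

Lemma integrable_weighted (f : torus3 R -> R) z : continuous (f \o @chart R) ->
  (@volume3 R).-integrable (@Omega R) (EFin \o (fun q => f q * weight w z q)).
Proof.
move=> /(continuous_weighted (z := z)) cf; have mO := @measurable_Omega R.
apply: measurable_bounded_integrable => //.
- apply: le_lt_trans volume3_setT_lty; by apply: le_measure; rewrite ?inE.
- exact: measurable_on_Omega.
- have [M h] := bounded_on_Omega cf; exists M; split; first exact: num_real.
  by move=> x Mx q /= qO; exact: le_trans (h q qO) (ltW Mx).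
Qed.

Lemma laplace (f : torus3 R -> R) : continuous (f \o @chart R) ->
  z * \int[@volume3 R]_(q in @Omega R) (f q * weight w z q) @[z --> +oo] --> limit_value f.
Proof.
have mO := @measurable_Omega R => cf.
(* Adding the constant [|M|] makes the function nonnegative on Omega; both terms of the difference
   are then covered by [ge0_laplace]. *)
have [M hM] := bounded_on_Omega cf; pose f1 q := f q + `|M|; pose f2 (q : torus3 R) := `|M|.
have c2 : continuous (f2 \o @chart R) by move=> p; exact: cvg_cst.
have c1 : continuous (f1 \o @chart R) by move=> p; apply: cvgD; [exact: cf|exact: cvg_cst].
have f10 q : Omega q -> 0 <= f1 q.
  by move=> /hM; rewrite ler_norml /f1 => /andP[h _]; have := ler_norm M; lra.
have h1 : fine (z%:E * \int[@volume3 R]_(q in @Omega R) (f1 q * weight w z q)%:E)%E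
    @[z --> +oo] --> limit_value f1 by exact: fine_cvg (ge0_laplace c1 f10).
have h2 : fine (z%:E * \int[@volume3 R]_(q in @Omega R) (f2 q * weight w z q)%:E)%E
    @[z --> +oo] --> limit_value f2.
  exact: fine_cvg (ge0_laplace c2 (fun q _ => normr_ge0 M)).
have -> : limit_value f = limit_value f1 - limit_value f2.
  rewrite -limit_valueB//; congr limit_value; apply/funext => q.
  by rewrite /f1 /f2 addrK.
have : (fine (z%:E * \int[@volume3 R]_(q in @Omega R) (f1 q * weight w z q)%:E)%E -
    fine (z%:E * \int[@volume3 R]_(q in @Omega R) (f2 q * weight w z q)%:E)%E)
    @[z --> +oo] --> limit_value f1 - limit_value f2 by exact: cvgB.
apply: cvg_trans; apply: near_eq_cvg; apply: nearW => z /=.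
have i1 := @integrable_weighted f1 z c1; have i2 := @integrable_weighted f2 z c2.
rewrite -(@fineK _ (\int[_]_(q in _) (f1 q * _)%:E)%E); last exact: integrable_fin_num i1.
rewrite -(@fineK _ (\int[_]_(q in _) (f2 q * _)%:E)%E); last exact: integrable_fin_num i2.
rewrite -!EFinM/= -mulrBr -!/(Rintegral _ _ _) -RintegralB//.
by congr (_ * _); apply: eq_Rintegral => q _; rewrite /f1 /f2; ring.
Qed.

End PartitionFunction.

(** * Continuity and convergence by real and imaginary parts *)

Section ComplexCoordinates.
Context {R : realType}.

Lemma normc_ReIm (z : R[i]) (r : R) : `|z| < r%:C ->
  `|complex.Re z| < r /\ `|complex.Im z| < r.
Proof.
rewrite normc_def ltcR => h; split; apply: le_lt_trans h.
  by rewrite -[X in X <= _]sqrtr_sqr ler_wsqrtr// lerDl sqr_ge0.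
by rewrite -[X in X <= _]sqrtr_sqr ler_wsqrtr// lerDr sqr_ge0.
Qed.

Lemma continuous_Re : continuous (@complex.Re R : R[i] -> R).
Proof.
move=> z U /nbhs_ballP[e /= e0 eU].
apply: (@filterS _ (nbhs z) _ (ball z e%:C)); last by apply: nbhsx_ballx; rewrite ltcR.
by move=> y /normc_ReIm[h _]; apply: eU; rewrite /ball/= -raddfB.
Qed.

Lemma continuous_Im : continuous (@complex.Im R : R[i] -> R).
Proof.
move=> z U /nbhs_ballP[e /= e0 eU].
apply: (@filterS _ (nbhs z) _ (ball z e%:C)); last by apply: nbhsx_ballx; rewrite ltcR.
by move=> y /normc_ReIm[_ h]; apply: eU; rewrite /ball/= -raddfB.
Qed.

Lemma ball_complex (z y : R[i]) (e : R) : `|complex.Re z - complex.Re y| < e / 2 ->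
  `|complex.Im z - complex.Im y| < e / 2 -> ball z e%:C y.
Proof.
case: z => a b; case: y => c d /= h1 h2.
rewrite /ball/= normc_def ltcR/= -[X in _ < X]ger0_norm; last first.
  by have := normr_ge0 (a - c); lra.
rewrite -sqrtr_sqr ltr_sqrt; last first.
  by rewrite exprn_gt0//; have := normr_ge0 (a - c); lra.
rewrite -(real_normK (num_real (a - c))) -(real_normK (num_real (b - d))).
have := normr_ge0 (a - c); have := normr_ge0 (b - d).
move: h1 h2; set s := `|_|; set t := `|_| => *; nra.
Qed.

Lemma nbhs_complex (z : R[i]) (U : set R[i]) : nbhs z U ->
  exists2 e : R, 0 < e & forall y : R[i], `|complex.Re z - complex.Re y| < e ->
    `|complex.Im z - complex.Im y| < e -> U y.
Proof.
move=> /nbhs_ballP[e /= e0 eU]; move: e0; rewrite ltcE/= => /andP[/eqP ei er].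
exists (complex.Re e / 2); first by rewrite divr_gt0.
move=> y h1 h2; apply: eU; rewrite [e]complexE ei mulr0 addr0.
exact: ball_complex.
Qed.

Lemma cvg_complex0 (T : Type) (F : set_system T) (FF : Filter F) (f g : T -> R) :
  f x @[x --> F] --> (0 : R) -> g x @[x --> F] --> (0 : R) ->
  (f x +i* g x) @[x --> F] --> (0 : R[i]).
Proof.
move=> /cvgrPdist_lt f0 /cvgrPdist_lt g0 U /nbhs_complex[e e0 eU].
apply: (@filterS2 _ F FF _ _ _ _ (f0 e e0) (g0 e e0)) => x h1 h2.
exact: eU.
Qed.

Lemma continuous_real_complex : continuous (fun r : R => r%:C : R[i]).
Proof.
move=> r U /nbhs_complex[e e0 eU].
apply: (@filterS _ (nbhs r) _ (ball r e)); last exact: nbhsx_ballx.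
by move=> y h; apply: eU => //=; rewrite subrr normr0.
Qed.

Lemma Re_mul_real (z : R[i]) (r : R) : complex.Re (z * r%:C) = complex.Re z * r.
Proof. by case: z => a b; simpc. Qed.

Lemma Im_mul_real (z : R[i]) (r : R) : complex.Im (z * r%:C) = complex.Im z * r.
Proof. by case: z => a b; simpc. Qed.

Lemma real_mulC (r a b : R) : r%:C * (a +i* b) = (r * a) +i* (r * b).
Proof. by simpc. Qed.

End ComplexCoordinates.

(** Normalizing a measure of total mass 1 changes nothing; the Dirac measure is the fallback for
    mass 0 or infinity. *)
Lemma probability_of_measure d (T : measurableType d) (R : realType)
    (m : {measure set T -> \bar R}) (x0 : T) : m setT = 1%E ->
  exists P : probability T R, forall A, P A = m A.
Proof.
move=> m1; exists (mnormalize m (dirac x0)) => A.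
change ((let ev := m setT in (if (ev == 0) || (ev == +oo) then
  [eta (dirac x0 : probability T R)] else fun U => m U * ((fine ev)^-1)%:E) A) = m A)%E.
by rewrite m1 /= onee_eq0/= invr1 mule1.
Qed.

(** * Total mass, the constants, and the expansion of Z *)

Section Measures.
Context {R : realType}.
Variable w : torus3 R -> R.
Hypotheses (cw : continuous (w \o @chart R)) (w_gt0 : forall q, Omega q -> 0 < w q).
Let mO := @measurable_Omega R.

Definition laplace_integral (z : R) (f : torus3 R -> R) : R :=
  \int[@volume3 R]_(q in @Omega R) (f q * weight w z q).

Definition mass (z : R) : R := laplace_integral z (cst 1).

Let c1 : continuous ((cst 1 : torus3 R -> R) \o @chart R).
Proof. by move=> p; exact: cvg_cst. Qed.

Lemma q0_Omega : Omega (q0 R).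
Proof.
have := pi_gt0 R => p0.
have -> : q0 R = chart (0, 0, pi) by rewrite chartE//; lra.
exact: chart_Omega.
Qed.

Lemma Rintegral_eq0 d (T : measurableType d) (m : {measure set T -> \bar R}) (D : set T)
  (f : T -> R) : (forall x, f x = 0) -> \int[m]_(x in D) f x = 0.
Proof. by move=> f0; rewrite /Rintegral integral0_eq// => x _; rewrite f0. Qed.

Lemma Gamma_integral0 (f : torus3 R -> R) : (forall p, f p = 0) -> Gamma_integral f = 0.
Proof.
move=> f0; rewrite /Gamma_integral /arc_integral.
by apply: Rintegral_eq0 => u; rewrite f0 mul0r.
Qed.

Lemma limit_value0 : limit_value w (cst 0) = 0.
Proof.
rewrite /limit_value mulr0 mul0r addr0 Gamma_integral0 ?mulr0// => p.
by rewrite !mul0r.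
Qed.

Lemma limit_value1 : limit_value w (cst 1) = K_reg w + K_fold w.
Proof.
rewrite /limit_value /K_reg /K_fold mulr1; congr (_ * Gamma_integral _ + _).
by apply/funext => p; rewrite mul1r.
Qed.

Lemma ln3_gt0 : 0 < ln 3 :> R.
Proof. by rewrite ln_gt0// ltr1n. Qed.

Lemma K_fold_gt0 : 0 < K_fold w.
Proof.
by rewrite /K_fold !mulr_gt0 ?divr_gt0 ?pi_gt0 ?ln3_gt0// w_gt0//; exact: q0_Omega.
Qed.

Let curve_density (f : torus3 R -> R) (u : R) :=
  pi * ((fun q => f q * w q) \o @chart R) (pi - v_Gamma u, u, v_Gamma u) / - sin u.

Lemma K_regE : K_reg w =
  \int[lebesgue_measure]_(u in `[4 * pi / 3, 3 * pi / 2]) curve_density (cst 1) u.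
Proof.
have := limit_valueE cw c1; rewrite limit_value1 /K_fold mulr1.
by move=> /addIr.
Qed.

Lemma K_reg_ge0 : 0 <= K_reg w.
Proof.
rewrite K_regE; apply: Rintegral_ge0 => u; rewrite /= in_itv/= => u_int.
have su := sin_lt0_regular u_int.
rewrite /curve_density/= divr_ge0 ?oppr_ge0 ?(ltW su)// mulr_ge0 ?pi_ge0//.
by rewrite mul1r ltW// w_gt0//; exact: chart_Omega.
Qed.

Lemma K_gt0 : 0 < K_reg w + K_fold w.
Proof. by rewrite ltr_wpDl ?K_reg_ge0 ?K_fold_gt0. Qed.

Lemma mass_cvg : z * mass z @[z --> +oo] --> K_reg w + K_fold w.
Proof. by rewrite -limit_value1; exact: laplace. Qed.

Lemma mass_mono (y z : R) : y <= z -> mass z <= mass y.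
Proof.
move=> yz; apply: le_Rintegral => //; try exact: integrable_weighted.
move=> q qO; rewrite !mul1r /weight ler_wpM2l ?(ltW (w_gt0 qO))// ler_expR.
rewrite ler_wpM2r ?Re_sqr_norm ?addr_ge0 ?sqr_ge0//.
by rewrite lerN2 ler_pM2r.
Qed.

(** Positivity is read off the asymptotics: z [mass z] has a positive limit, so the mass is positive
    for some large z, and it is nonincreasing in z. *)
Lemma mass_gt0 (z : R) : 0 < mass z.
Proof.
have : \forall y \near +oo, 0 < y * mass y.
  exact: (cvgr_gt (K_reg w + K_fold w) mass_cvg 0 K_gt0).
move=> [A [_ hA]]; pose y := Num.max (Num.max A z) 0 + 1.
have [yA yz y0] : [/\ A < y, z <= y & 0 < y].
  have h1 : Num.max A z <= Num.max (Num.max A z) 0 by rewrite le_max lexx.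
  have h2 : A <= Num.max A z by rewrite le_max lexx.
  have h3 : z <= Num.max A z by rewrite le_max lexx orbT.
  have h4 : 0 <= Num.max (Num.max A z) 0 by rewrite le_max lexx orbT.
  by rewrite /y; split; lra.
apply: lt_le_trans (mass_mono yz).
by have := hA _ yA; rewrite pmulr_rgt0.
Qed.

Lemma integrable_prob (P : probability (torus3 R) R) (f : torus3 R -> R) :
  continuous (f \o @chart R) -> P.-integrable (@Omega R) (EFin \o f).
Proof.
move=> cf; apply: measurable_bounded_integrable => //.
- exact: le_lt_trans (probability_le1 _ mO) (ltry _).
- exact: measurable_on_Omega.
- have [M h] := bounded_on_Omega cf; exists M; split; first exact: num_real.
  by move=> x Mx q /= qO; exact: le_trans (h q qO) (ltW Mx).
Qed.

(* Signed functions are handled by adding a constant that makes them nonnegative. *)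
Lemma additive_eq (I J : (torus3 R -> R) -> R) :
  (forall f g : torus3 R -> R, continuous (f \o @chart R) -> continuous (g \o @chart R) ->
    I (fun q => f q - g q) = I f - I g) ->
  (forall f g : torus3 R -> R, continuous (f \o @chart R) -> continuous (g \o @chart R) ->
    J (fun q => f q - g q) = J f - J g) ->
  (forall f : torus3 R -> R, continuous (f \o @chart R) ->
    (forall q, Omega q -> 0 <= f q) -> I f = J f) ->
  forall f : torus3 R -> R, continuous (f \o @chart R) -> I f = J f.
Proof.
move=> IB JB IJ f cf; have [M hM] := bounded_on_Omega cf.
pose f1 q := f q + `|M|; pose f2 (q : torus3 R) := `|M|.
have c2 : continuous (f2 \o @chart R) by move=> p; exact: cvg_cst.
have cf1 : continuous (f1 \o @chart R) by move=> p; apply: cvgD; [exact: cf|exact: cvg_cst].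
have -> : f = (fun q => f1 q - f2 q) by apply/funext => q; rewrite /f1 /f2 addrK.
rewrite IB// JB// (IJ f1)// ?(IJ f2)//; first by move=> q _; exact: normr_ge0.
by move=> q /hM; rewrite ler_norml /f1 => /andP[h _]; have := ler_norm M; lra.
Qed.

Lemma prob_integralB (P : probability (torus3 R) R) (f g : torus3 R -> R) :
  continuous (f \o @chart R) -> continuous (g \o @chart R) ->
  \int[P]_(q in @Omega R) (f q - g q) =
  \int[P]_(q in @Omega R) f q - \int[P]_(q in @Omega R) g q.
Proof. by move=> cf cg; rewrite RintegralB//; exact: integrable_prob. Qed.

Lemma laplace_integralB z (f g : torus3 R -> R) :
  continuous (f \o @chart R) -> continuous (g \o @chart R) ->
  laplace_integral z (fun q => f q - g q) = laplace_integral z f - laplace_integral z g.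
Proof.
move=> cf cg; rewrite /laplace_integral -RintegralB//; try exact: integrable_weighted.
by apply: eq_Rintegral => q _; rewrite mulrBl.
Qed.

Lemma Z_ReIm z (psi : torus3 R -> R[i]) :
  Z w z psi = laplace_integral z (fun q => complex.Re (psi q)) +i*
              laplace_integral z (fun q => complex.Im (psi q)).
Proof.
rewrite /Z /integralC /laplace_integral; congr (_ +i* _);
  by apply: eq_Rintegral => q _; rewrite ?Re_mul_real ?Im_mul_real.
Qed.

Lemma limit_functional_ReIm (psi : torus3 R -> R[i]) :
  limit_functional w psi = limit_value w (fun q => complex.Re (psi q)) +i*
                           limit_value w (fun q => complex.Im (psi q)).
Proof.
rewrite /limit_functional /Gamma_integralC /arc_integralC real_mulC.
have E (p : torus3 R) : psi p * (w p)%:C / (J_X p)%:C = psi p * (w p / J_X p)%:C.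
  by rewrite -mulrA rmorphM fmorphV.
have -> : (C_fold R)%:C * psi (q0 R) * (w (q0 R))%:C =
    (pi / 4 * ln 3 * complex.Re (psi (q0 R)) * w (q0 R)) +i*
    (pi / 4 * ln 3 * complex.Im (psi (q0 R)) * w (q0 R)).
  by rewrite C_foldE; case: (psi (q0 R)) => a b; simpc.
rewrite /limit_value; simpc; congr ((_ * _ + _) +i* (_ * _ + _)).
  by congr arc_integral; apply/funext => p; rewrite E Re_mul_real mulrA.
by congr arc_integral; apply/funext => p; rewrite E Im_mul_real mulrA.
Qed.

Lemma Z1 z : Z w z (fun=> 1) = (mass z)%:C.
Proof.
rewrite Z_ReIm; congr (_ +i* _).
by apply: Rintegral_eq0 => q; rewrite mul0r.
Qed.

Lemma limit_functional1 :
  limit_functional w (fun=> 1) = (K_reg w)%:C + (K_fold w)%:C.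
Proof. by rewrite limit_functional_ReIm limit_value1 limit_value0 -rmorphD. Qed.

Lemma continuous_ReIm (psi : torus3 R -> R[i]) : {within @Omega R, continuous psi} ->
  continuous ((fun q => complex.Re (psi q)) \o @chart R) /\
  continuous ((fun q => complex.Im (psi q)) \o @chart R).
Proof.
move=> /continuous_within_chart c; split=> p.
  by apply: (cvg_comp _ _ (c p) (@continuous_Re R _)).
by apply: (cvg_comp _ _ (c p) (@continuous_Im R _)).
Qed.

(** The error is defined, by components, as z Z minus the limit, so the identity is exact and
    [laplace] makes the error vanish. *)
Lemma Z_expansion (psi : torus3 R -> R[i]) : {within @Omega R, continuous psi} ->
  exists2 e : R -> R[i], e z @[z --> +oo] --> (0 : R[i]) &
    forall z, 0 < z -> Z w z psi = (z%:C)^-1 * (limit_functional w psi + e z).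
Proof.
move=> /continuous_ReIm[cr ci].
pose d f z := z * laplace_integral z f - limit_value w f.
exists (fun z => d (fun q => complex.Re (psi q)) z +i* d (fun q => complex.Im (psi q)) z).
  have d0 f : continuous (f \o @chart R) -> d f z @[z --> +oo] --> (0 : R).
    move=> cf; rewrite -(subrr (limit_value w f)); apply: cvgB; last exact: cvg_cst.
    exact: laplace.
  by apply: cvg_complex0; exact: d0.
move=> z z0; rewrite Z_ReIm limit_functional_ReIm -fmorphV.
simpc; rewrite /d; congr (_ +i* _).
  by rewrite addrC subrK mulrA mulVf ?mul1r// gt_eqF.
by rewrite addrC subrK mulrA mulVf ?mul1r// gt_eqF.
Qed.

End Measures.

(** * Existence of the Gibbs measures and of the limit measure *)

Section LimitMeasures.
Context {R : realType}.
Local Notation mu := (@lebesgue_measure R).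
Variable w : torus3 R -> R.
Hypotheses (cw : continuous (w \o @chart R)) (w_gt0 : forall q, Omega q -> 0 < w q).
Let mO := @measurable_Omega R.
Let K := K_reg w + K_fold w.
Let K0 : 0 < K. Proof. exact: K_gt0. Qed.

Let c1 : continuous ((cst 1 : torus3 R -> R) \o @chart R).
Proof. by move=> p; exact: cvg_cst. Qed.

Let gibbs_density (z : R) : torus3 R -> R :=
  (fun q => weight w z q / mass w z) \_ (@Omega R).

Let m_weight z : measurable_fun (@Omega R) (weight w z).
Proof.
have := measurable_on_Omega (continuous_weighted (z := z) cw c1).
by apply: eq_measurable_fun => q _; rewrite mul1r.
Qed.

Let i_weight z : (@volume3 R).-integrable (@Omega R) (EFin \o weight w z).
Proof.
have := @integrable_weighted R w cw (cst 1) z c1.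
by apply: eq_integrable => // q _ /=; rewrite mul1r.
Qed.

Let massE z : \int[@volume3 R]_(q in @Omega R) weight w z q = mass w z.
Proof. by apply: eq_Rintegral => q _; rewrite mul1r. Qed.

Let m_gibbs z : measurable_fun setT (gibbs_density z).
Proof. by apply/(measurable_restrictT _ mO); exact: measurable_funM. Qed.

Let gibbs_ge0 z q : 0 <= gibbs_density z q.
Proof.
rewrite /gibbs_density patchE; case: ifPn => // /set_mem qO.
by rewrite divr_ge0 ?weight_ge0// ltW// mass_gt0.
Qed.

Let gibbs_integral_set z A : measurable A ->
  (\int[@volume3 R]_(q in A) (gibbs_density z q)%:E =
   ((mass w z)^-1 * \int[@volume3 R]_(q in @Omega R `&` A) weight w z q)%:E)%E.
Proof.
move=> mA; have iA : (@volume3 R).-integrable (@Omega R `&` A) (EFin \o weight w z).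
  by apply: integrableS (i_weight z) => //; exact: measurableI.
transitivity (\int[@volume3 R]_(q in @Omega R `&` A) (weight w z q / mass w z)%:E)%E.
  rewrite integral_mkcondl; apply: eq_integral => q _.
  by rewrite /gibbs_density !patchE; case: ifP.
transitivity (\int[@volume3 R]_(q in @Omega R `&` A) ((mass w z)^-1%:E * (weight w z q)%:E))%E.
  by apply: eq_integral => q _; rewrite -EFinM mulrC.
rewrite integralZl//; last exact: measurableI.
by rewrite EFinM /Rintegral fineK//; apply: integrable_fin_num => //; exact: measurableI.
Qed.

Lemma gibbs_exists z : exists P : probability (torus3 R) R, is_Pi w z P.
Proof.
have [nu nuE] := density_measure_exists (@volume3 R) (m_gibbs z) (gibbs_ge0 z).
have nu1 : nu setT = 1%E.
  by rewrite nuE gibbs_integral_set// setIT massE mulVf// gt_eqF// mass_gt0.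
have [P PE] := probability_of_measure (q0 R) nu1; exists P; split.
  by rewrite PE nuE gibbs_integral_set// setIid massE mulVf// gt_eqF// mass_gt0.
by move=> A mA; rewrite PE nuE gibbs_integral_set//= Z1 -fmorphV -rmorphM.
Qed.

(** [is_Pi] prescribes values on sets. It identifies [P] as the measure with density
    [gibbs_density], which settles nonnegative functions; [additive_eq] passes to signed ones. *)
Lemma gibbs_integral z (P : probability (torus3 R) R) (f : torus3 R -> R) :
  is_Pi w z P -> continuous (f \o @chart R) ->
  \int[P]_(q in @Omega R) f q = laplace_integral w z f / mass w z.
Proof.
move=> [_ PA]; have PE A : measurable A ->
    P A = (\int[@volume3 R]_(q in A) (gibbs_density z q)%:E)%E.
  move=> mA; have := PA A mA; rewrite Z1 -fmorphV -rmorphM => /(congr1 (@complex.Re R))/= E.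
  by rewrite gibbs_integral_set// -E fineK// fin_num_measure.
move: f; apply: additive_eq.
- exact: prob_integralB.
- by move=> f g cf cg; rewrite laplace_integralB// mulrBl.
move=> f cf f0.
have mf : measurable_fun setT ((EFin \o f) \_ (@Omega R)).
  by apply/(measurable_restrictT _ mO); apply: (iffRL (measurable_EFinP _ _)); exact: measurable_on_Omega.
have fO0 q : (0 <= ((EFin \o f) \_ (@Omega R)) q)%E.
  by rewrite patchE; case: ifPn => // /set_mem/f0; rewrite lee_fin.
rewrite {1}/Rintegral integral_mkcond.
rewrite (ge0_integral_density (m_gibbs z) (gibbs_ge0 z) PE mf fO0).
rewrite /laplace_integral -RintegralZr//; last exact: integrable_weighted.
rewrite [RHS]/Rintegral [in RHS]integral_mkcond; congr fine; apply: eq_integral => q _.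
rewrite /gibbs_density !patchE; case: ifP => _; last by rewrite mul0e.
by rewrite -EFinM mulrA.
Qed.

Let D : set R := `]4 * pi / 3, 3 * pi / 2]%classic.
Let mD : measurable D. Proof. exact: measurable_itv. Qed.

Let curve_density (f : torus3 R -> R) (u : R) :=
  pi * ((fun q => f q * w q) \o @chart R) (pi - v_Gamma u, u, v_Gamma u) / - sin u.

Let v_D : R -> R := @v_Gamma R \_ D.
(** The curve as a map on the whole line: extending [v_Gamma] by 0 and clamping keep it measurable
    with values in Omega, and off [D] the density [h_D] is 0. *)
Let G (u : R) : torus3 R := chart (pi - v_D u, u, v_D u).

Let m_v_D : measurable_fun [set: R] v_D.
Proof.
apply/(measurable_restrictT _ mD); apply: subspace_continuous_measurable_fun => //.
apply: continuous_in_subspaceT => u /set_mem; rewrite /D/= in_itv/= => u_int.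
by apply: continuous_v_Gamma; have := pi_gt0 R; lra.
Qed.

Let m_G : measurable_fun [set: R] G.
Proof.
have mcl : measurable_fun [set: R * R * R] (@clamp R).
  have ccl := @continuous_clamp R.
  apply: measurable_fun_pair; last first.
    by apply: continuous_measurable_R3 => p; exact: (cvg_comp _ _ (ccl p) cvg_snd).
  apply: measurable_fun_pair.
    exact: (measurableT_comp measurable_fst measurable_fst).
  by apply: continuous_measurable_R3 => p;
    exact: (cvg_comp _ _ (cvg_comp _ _ (ccl p) cvg_fst) cvg_snd).
have m3 : measurable_fun [set: R] (fun u => (pi - v_D u, u, v_D u)).
  apply: measurable_fun_pair => //; apply: measurable_fun_pair => //.
  exact: measurable_funB.
have mc := measurableT_comp mcl m3.
have ma := @measurable_ang R.
apply: measurable_fun_pair; last exact: (measurableT_comp ma (measurableT_comp measurable_snd mc)).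
apply: measurable_fun_pair.
  exact: (measurableT_comp ma (measurableT_comp measurable_fst (measurableT_comp measurable_fst mc))).
exact: (measurableT_comp ma (measurableT_comp measurable_snd (measurableT_comp measurable_fst mc))).
Qed.

Let h_D : R -> R := (fun u => curve_density (cst 1) u / K) \_ D.

Let m_h_D : measurable_fun [set: R] h_D.
Proof.
apply/(measurable_restrictT _ mD); apply: measurable_funM => //.
have /integrableP[+ _] := integrable_curve_density cw c1.
move=> /(iffLR (measurable_EFinP _ _)) m.
by apply: measurable_funS m => // u; rewrite /D/= !in_itv/= => /andP[/ltW -> ->].
Qed.

Let h_D_ge0 u : 0 <= h_D u.
Proof.
rewrite /h_D patchE; case: ifPn => // /set_mem; rewrite /D/= in_itv/= => u_int.
have su : sin u < 0 by apply: sin_lt0_regular; lra.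
rewrite divr_ge0 ?(ltW K0)// /curve_density/= divr_ge0 ?oppr_ge0 ?(ltW su)//.
by rewrite mulr_ge0 ?pi_ge0// mul1r ltW// w_gt0//; exact: chart_Omega.
Qed.

Let kf : {nonneg R} := NngNum (ltW (divr_gt0 (K_fold_gt0 w_gt0) K0)).

(** The measure is the image under [G] of the measure with density [h_D], plus a point mass at
    [q0]. *)
Let limit_measure_exists : exists m : {measure set (torus3 R) -> \bar R},
  forall F : torus3 R -> \bar R, measurable_fun setT F -> (forall q, (0 <= F q)%E) ->
    (\int[m]_q F q =
     \int[mu]_u (F (G u) * (h_D u)%:E) + (K_fold w / K)%:E * F (q0 R))%E.
Proof.
have [nu nuE] := @density_measure_exists _ (measurableTypeR R) R mu h_D m_h_D h_D_ge0.
pose mG : @measurable_fun _ _ (measurableTypeR R) _ setT G := m_G.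
pose m1' := pushforward nu G : {measure set (torus3 R) -> \bar R}.
pose m1 := m1' mG.
pose m2 : {measure set (torus3 R) -> \bar R} := mscale kf (@dirac _ (torus3 R) (q0 R) R).
exists (measure_add m1 m2) => F mF F0.
rewrite ge0_integral_measure_add//; congr (_ + _)%E.
  have E := @ge0_integral_pushforward _ _ _ _ R _ mG nu setT F measurableT mF (fun q _ => F0 q).
  apply: (etrans _ (etrans E _)); first exact: eq_measure_integral.
  rewrite preimage_setT.
  have mFG := measurableT_comp mF mG.
  by rewrite (@ge0_integral_density _ (measurableTypeR R) R mu h_D m_h_D h_D_ge0 nu _ (fun A _ => nuE A) mFG (fun u => F0 _)).
rewrite /m2 ge0_integral_mscale// integral_dirac//= diracT mul1e.
by [].
Qed.

Let limit_measure_formula (m : {measure set (torus3 R) -> \bar R}) (f : torus3 R -> R) :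
  (forall F : torus3 R -> \bar R, measurable_fun setT F -> (forall q, (0 <= F q)%E) ->
    (\int[m]_q F q =
     \int[mu]_u (F (G u) * (h_D u)%:E) + (K_fold w / K)%:E * F (q0 R))%E) ->
  continuous (f \o @chart R) -> (forall q, Omega q -> 0 <= f q) ->
  (\int[m]_(q in @Omega R) (f q)%:E = (limit_value w f / K)%:E)%E.
Proof.
move=> mE cf f0; rewrite integral_mkcond mE; last 2 first.
- by apply/(measurable_restrictT _ mO); apply: (iffRL (measurable_EFinP _ _)); exact: measurable_on_Omega.
- by move=> q; rewrite patchE; case: ifPn => // /set_mem/f0; rewrite lee_fin.
rewrite patchE mem_set; last exact: q0_Omega.
have icf := integrable_curve_density cw cf.
have E : (\int[mu]_u (((fun q => (f q)%:E) \_ (@Omega R)) (G u) * (h_D u)%:E) =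
    \int[mu]_(u in `[(4 * pi / 3)%R, (3 * pi / 2)%R]) ((K^-1)%:E * (curve_density f u)%:E))%E.
  rewrite -integral_itv_obnd_cbnd; last first.
    have /integrableP[+ _] := icf.
    move=> mcd; apply: emeasurable_funM => //.
    by apply: measurable_funS mcd => // u; rewrite /D/= !in_itv/= => /andP[/ltW -> ->].
  rewrite [RHS]integral_mkcond; apply: eq_integral => u _.
  rewrite [RHS]patchE /h_D [X in (_ * X%:E)%E]patchE; case: ifPn => uD; last by rewrite mule0.
  rewrite patchE mem_set; last exact: chart_Omega.
  rewrite -!EFinM /G /v_D patchE uD /curve_density/= mul1r; congr EFin.
  by move: (f _) (w _) (sin u) => a b s; ring.
rewrite E integralZl//.
rewrite -[X in (_ * X)%E]fineK; last exact: integrable_fin_num.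
rewrite -!EFinM -EFinD limit_valueE// /K_fold; congr EFin.
rewrite /Rintegral -/(curve_density f).
by rewrite [RHS]mulrDl [X in X + _ = _]mulrC; congr (_ + _); ring.
Qed.

Let limit_integral_of (Q : probability (torus3 R) R) (f : torus3 R -> R) :
  (forall F : torus3 R -> \bar R, measurable_fun setT F -> (forall q, (0 <= F q)%E) ->
    (\int[Q]_q F q =
     \int[mu]_u (F (G u) * (h_D u)%:E) + (K_fold w / K)%:E * F (q0 R))%E) ->
  continuous (f \o @chart R) ->
  \int[Q]_(q in @Omega R) f q = limit_value w f / K.
Proof.
move=> QE; move: f; apply: additive_eq.
- exact: prob_integralB.
- by move=> f g cf cg; rewrite limit_valueB// mulrBl.
by move=> f cf f0; rewrite /Rintegral limit_measure_formula.
Qed.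

Lemma limit_measure : exists Q : probability (torus3 R) R, is_Pi_infty w Q.
Proof.
have [m mE] := limit_measure_exists.
have c10 (q : torus3 R) : Omega q -> 0 <= (cst 1 : torus3 R -> R) q by move=> _; exact: ler01.
have mO1 : m (@Omega R) = 1%E.
  rewrite -[LHS]mul1e -[1%E in LHS]/(1%:E) -integral_cst//.
  by rewrite (limit_measure_formula mE c1 c10) limit_value1 divff// gt_eqF.
(* No mass lies off Omega, because [G] takes its values there and [q0] belongs to it. *)
have m1 : m setT = 1%E.
  have := limit_measure_formula mE c1 c10; rewrite limit_value1 divff ?gt_eqF// => <-.
  rewrite -[LHS]mul1e -[1%E in LHS]/(1%:E) -integral_cst// [RHS]integral_mkcond !mE//.
  - congr (_ + _)%E; last by rewrite patchE mem_set//; exact: q0_Omega.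
    apply: eq_integral => u _; congr (_ * _)%E.
    by rewrite patchE mem_set//; exact: chart_Omega.
  - apply/(measurable_restrictT _ mO); apply: (iffRL (measurable_EFinP _ _)).
    exact: measurable_cst.
  - by move=> q; rewrite patchE; case: ifP.
have [Q Qm] := probability_of_measure (q0 R) m1.
have QE (F : torus3 R -> \bar R) : measurable_fun setT F -> (forall q, (0 <= F q)%E) ->
    (\int[Q]_q F q =
     \int[mu]_u (F (G u) * (h_D u)%:E) + (K_fold w / K)%:E * F (q0 R))%E.
  by move=> mF F0; rewrite -mE//; apply: eq_measure_integral => A _ _; exact: Qm.
exists Q; split; first by rewrite Qm.
move=> psi /continuous_ReIm[cr ci]; rewrite /integralC limit_functional_ReIm.
rewrite (limit_integral_of QE cr) (limit_integral_of QE ci) -fmorphV.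
by simpc.
Qed.

End LimitMeasures.

(** * Weak convergence and the atom at q_0 *)

Section WeakLimit.
Context {R : realType}.
Variable w : torus3 R -> R.
Hypotheses (cw : continuous (w \o @chart R)) (w_gt0 : forall q, Omega q -> 0 < w q).
Let mO := @measurable_Omega R.
Let K := K_reg w + K_fold w.
Let K0 : 0 < K. Proof. exact: K_gt0. Qed.

Lemma limit_integral (Q : probability (torus3 R) R) (f : torus3 R -> R) :
  is_Pi_infty w Q -> {within @Omega R, continuous f} ->
  \int[Q]_(q in @Omega R) f q = limit_value w f / K.
Proof.
move=> [_ QE] cf; have cfC : {within @Omega R, continuous (fun q => (f q)%:C)}.
  move=> q; apply: (@continuous_comp (subspace (@Omega R)) R R[i] f (fun r : R => r%:C)).
    exact: cf.
  exact: continuous_real_complex.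
have := QE _ cfC; rewrite /integralC limit_functional_ReIm -fmorphV.
by move=> /(congr1 (@complex.Re R)); rewrite Re_mul_real.
Qed.

(** Numerator and denominator of the Gibbs average are both multiplied by z; each then has a limit,
    and that of the denominator is positive. *)
Lemma gibbs_weak_cvg (P : R -> probability (torus3 R) R) (Q : probability (torus3 R) R) :
  (forall z, 0 < z -> is_Pi w z (P z)) -> is_Pi_infty w Q -> weak_cvg (@Omega R) P Q.
Proof.
move=> hP hQ f cf _; rewrite (limit_integral hQ cf).
have ccf := continuous_within_chart cf.
have : (z * laplace_integral w z f) / (z * mass w z) @[z --> +oo] --> limit_value w f / K.
  apply: cvgM; first exact: laplace.
  by apply: cvgV; [rewrite gt_eqF|exact: mass_cvg].
apply: cvg_trans; apply: near_eq_cvg; near=> z.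
have z0 : 0 < z by near: z; exact: nbhs_pinfty_gt.
rewrite (gibbs_integral cw w_gt0 (hP z z0) ccf).
by rewrite invfM mulrACA divff ?mul1r// gt_eqF.
Unshelve. all: by end_near. Qed.

Let cosc (s : circle R) : R := cos (repr s).

Let cosc_ang x : cosc (ang x) = cos x.
Proof. by have [] := expi_repr x. Qed.

Let continuous_cosc : continuous cosc.
Proof.
apply/continuousP => A oA; change (open (@ang R @^-1` (cosc @^-1` A))).
have -> : @ang R @^-1` (cosc @^-1` A) = @cos R @^-1` A.
  by apply/seteqP; split=> x /=; rewrite cosc_ang.
by move/continuousP : (@continuous_cos R); exact.
Qed.

(* Continuous, equal to 1 at [q0] only. *)
Let bump (q : torus3 R) : R :=
  (1 + cosc q.1.1) / 2 * ((1 + cosc q.1.2) / 2) * ((1 - cosc q.2) / 2).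

Let continuous_bump : continuous bump.
Proof.
move=> [[x u] v]; pose z0 := (x, u, v).
have c1 : cosc z.1.1 @[z --> z0] --> cosc x.
  have d : z.1.1 @[z --> z0] --> x by exact: (cvg_comp _ _ cvg_fst cvg_fst).
  exact: (cvg_comp _ _ d (@continuous_cosc x)).
have c2 : cosc z.1.2 @[z --> z0] --> cosc u.
  have d : z.1.2 @[z --> z0] --> u by exact: (cvg_comp _ _ cvg_fst cvg_snd).
  exact: (cvg_comp _ _ d (@continuous_cosc u)).
have c3 : cosc z.2 @[z --> z0] --> cosc v.
  have d : z.2 @[z --> z0] --> v by exact: cvg_snd.
  exact: (cvg_comp _ _ d (@continuous_cosc v)).
apply: cvgM; first apply: cvgM.
- by apply: cvgMl; apply: cvgD; [exact: cvg_cst|exact: c1].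
- by apply: cvgMl; apply: cvgD; [exact: cvg_cst|exact: c2].
- by apply: cvgMl; apply: cvgB; [exact: cvg_cst|exact: c3].
Qed.

Let factor_itv (s : circle R) : 0 <= (1 + cosc s) / 2 <= 1 /\ 0 <= (1 - cosc s) / 2 <= 1.
Proof. by have := cos_geN1 (repr s); have := cos_le1 (repr s); rewrite /cosc; lra. Qed.

Let bump_itv q : 0 <= bump q <= 1.
Proof.
have [/andP[a0 a1] _] := factor_itv q.1.1; have [/andP[b0 b1] _] := factor_itv q.1.2.
have [_ /andP[c0 c1]] := factor_itv q.2.
apply/andP; split; first by apply: mulr_ge0 => //; exact: mulr_ge0.
by apply: mulr_ile1 => //; [rewrite mulr_ge0|rewrite mulr_ile1].
Qed.

Let bump_q0 : bump (q0 R) = 1.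
Proof. by rewrite /bump/= !cosc_ang cos0 cospi; field. Qed.

Let mulr_eq1 (a b : R) : 0 <= a <= 1 -> 0 <= b <= 1 -> a * b = 1 -> a = 1 /\ b = 1.
Proof. by move=> ha hb ab; split; nra. Qed.

Let cosc_eq (s : circle R) (x : R) : sin x = 0 -> cosc s = cos x -> s = ang x.
Proof.
rewrite /cosc => sx cs; rewrite -[s]reprK; apply: expi_inj; rewrite /expi cs sx.
congr (_ +i* _); apply/eqP; rewrite -sqrf_eq0; apply/eqP.
have := cos2Dsin2 (repr s); have := cos2Dsin2 x; rewrite cs sx; lra.
Qed.

(** A product of numbers in [0, 1] equals 1 only if each factor does, and a cosine equal to 1 or -1
    determines the class of its angle. *)
Let bump_eq1 q : bump q = 1 -> q = q0 R.
Proof.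
have [a _] := factor_itv q.1.1; have [b _] := factor_itv q.1.2.
have [_ c] := factor_itv q.2; rewrite /bump => h.
have ab : 0 <= (1 + cosc q.1.1) / 2 * ((1 + cosc q.1.2) / 2) <= 1.
  by move: a b => /andP[a0 a1] /andP[b0 b1]; rewrite mulr_ge0//= mulr_ile1.
have [h1 h2] := mulr_eq1 ab c h; have [h3 h4] := mulr_eq1 a b h1.
have e1 : q.1.1 = ang 0 by apply: cosc_eq; rewrite ?sin0// cos0; lra.
have e2 : q.1.2 = ang 0 by apply: cosc_eq; rewrite ?sin0// cos0; lra.
have e3 : q.2 = ang pi by apply: cosc_eq; rewrite ?sinpi// cospi; lra.
by move: e1 e2 e3; case: q {a b c h ab h1 h2 h3 h4} => -[x u] v /= -> -> ->.
Qed.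

Let within_bump n : {within @Omega R, continuous (fun q => bump q ^+ n)}.
Proof.
apply: continuous_subspaceT => q.
exact: (cvg_comp _ _ (@continuous_bump q) (@exprn_continuous _ n _)).
Qed.

Let chart_bump n : continuous ((fun q => bump q ^+ n) \o @chart R).
Proof. exact: continuous_within_chart. Qed.

(** The singleton is a level set of [bump], which is measurable on Omega. *)
Let measurable_q0 : measurable [set q0 R].
Proof.
have -> : [set q0 R] = @Omega R `&` (fun q => bump q ^+ 1) @^-1` [set 1].
  apply/seteqP; split=> q /=.
    by move=> ->; split; [exact: q0_Omega|rewrite expr1 bump_q0].
  by rewrite expr1 => -[_]; exact: bump_eq1.
exact: (measurable_on_Omega (@chart_bump 1) mO).
Qed.

Let c1 : continuous ((cst 1 : torus3 R -> R) \o @chart R).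
Proof. by move=> p; exact: cvg_cst. Qed.

(** On the curve cos u <= 0, so [bump] is at most 1 / 2 there and the curve term lies between 0 and
    2^-n K_reg, while at [q0] all powers equal 1. *)
Let bump_limit_cvg : limit_value w (fun q => bump q ^+ n) @[n --> \oo] --> K_fold w.
Proof.
pose cd (f : torus3 R -> R) (u : R) :=
  pi * ((fun q => f q * w q) \o @chart R) (pi - v_Gamma u, u, v_Gamma u) / - sin u.
have vE n : limit_value w (fun q => bump q ^+ n) =
    \int[lebesgue_measure]_(u in `[4 * pi / 3, 3 * pi / 2]) cd (fun q => bump q ^+ n) u
    + K_fold w.
  by rewrite (limit_valueE cw (@chart_bump n)) bump_q0 expr1n mulr1.
have i_cd n := integrable_curve_density cw (@chart_bump n).
have i_cd1 := integrable_curve_density cw c1.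
have pos (u : R) : 4 * pi / 3 <= u <= 3 * pi / 2 ->
    0 <= cd (cst 1) u /\ forall n, cd (fun q => bump q ^+ n) u =
      bump (chart (pi - v_Gamma u, u, v_Gamma u)) ^+ n * cd (cst 1) u.
  move=> u_int; have su := sin_lt0_regular u_int; split=> [|n].
    rewrite /cd/= divr_ge0 ?oppr_ge0 ?(ltW su)// mulr_ge0 ?pi_ge0// mul1r.
    by rewrite ltW// w_gt0//; exact: chart_Omega.
  by rewrite /cd/= mul1r; move: (bump _) (w _) (sin u) => a b s; ring.
have half (u : R) : 4 * pi / 3 <= u <= 3 * pi / 2 ->
    bump (chart (pi - v_Gamma u, u, v_Gamma u)) <= 2^-1.
  have := pi_gt0 R => p0 u_int.
  have cu : cos u <= 0.
    rewrite (_ : u = (u - pi) + pi); last by ring.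
    by rewrite cosDpi oppr_le0; apply: cos_ge0_pihalf; lra.
  rewrite /bump; set q := chart _.
  have c2 : cosc q.1.2 = cos u.
    by rewrite /q /chart/= cosc_ang min_r ?max_r//; lra.
  have [/andP[a0 a1] _] := factor_itv q.1.1; have [/andP[b0 b1] _] := factor_itv q.1.2.
  have [_ /andP[d0 d1]] := factor_itv q.2.
  apply: (@le_trans _ _ ((1 + cosc q.1.2) / 2)); last by rewrite c2; lra.
  apply: (@le_trans _ _ ((1 + cosc q.1.1) / 2 * ((1 + cosc q.1.2) / 2))).
    by rewrite ler_piMr// mulr_ge0.
  by rewrite ler_piMl.
have bnd n : K_fold w <= limit_value w (fun q => bump q ^+ n) <=
    2^-1 ^+ n * K_reg w + K_fold w.
  rewrite vE lerDr lerD2r (K_regE cw); apply/andP; split.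
    apply: Rintegral_ge0 => u; rewrite /= in_itv/= => u_int.
    have [p0 ->] := pos u u_int; rewrite mulr_ge0// exprn_ge0//.
    by have /andP[] := bump_itv (chart (pi - v_Gamma u, u, v_Gamma u)).
  rewrite -RintegralZl//; apply: le_Rintegral => //.
      exact: i_cd.
    have mI : @measurable _ (measurableTypeR R) `[4 * pi / 3, 3 * pi / 2].
      exact: measurable_itv.
    have := integrableZl mI (2^-1 ^+ n) i_cd1.
    by apply: eq_integrable => // u _; rewrite /= EFinM.
  move=> u; rewrite /= in_itv/= => u_int.
  have [p0 ->] := pos u u_int; apply: ler_wpM2r => //.
  have /andP[b0 _] := bump_itv (chart (pi - v_Gamma u, u, v_Gamma u)).
  by apply: lerXn2r; rewrite ?nnegrE// half.
apply: (@squeeze_cvgr _ _ _ _ (cst (K_fold w)) (fun n => 2^-1 ^+ n * K_reg w + K_fold w)).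
- exact: nearW.
- exact: cvg_cst.
- rewrite -[X in _ --> X]add0r -(mul0r (K_reg w)).
  apply: cvgD; last exact: cvg_cst.
  by apply: cvgMl; apply: cvg_expr; rewrite ger0_norm//; lra.
Qed.

(** The powers of [bump] tend pointwise to the indicator of [q0]; the limit of their integrals is
    computed by dominated convergence under [Q] on one side and by [bump_limit_cvg] on the other. *)
Lemma limit_atom (Q : probability (torus3 R) R) : is_Pi_infty w Q ->
  Q [set q0 R] = (K_fold w / K)%:E.
Proof.
move=> hQ; have i1 : Q.-integrable (@Omega R) (EFin \o (cst 1 : torus3 R -> R)).
  exact: integrable_prob.
have ic : (\int[Q]_(q in @Omega R) (bump q ^+ n)%:E)%E @[n --> \oo] -->
    (\int[Q]_(q in @Omega R) (\1_([set q0 R] : set (torus3 R)) q)%:E)%E.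
  have [] := @dominated_convergence _ _ R Q (@Omega R) mO
    (fun n q => (bump q ^+ n)%:E) (fun q => (\1_([set q0 R] : set (torus3 R)) q)%:E)
    (EFin \o (cst 1 : torus3 R -> R)).
  - move=> n; apply: (iffRL (measurable_EFinP _ _)).
    exact: (measurable_on_Omega (@chart_bump n)).
  - by apply: (iffRL (measurable_EFinP _ _)); exact: measurable_indic.
  - apply: aeW => q _; apply: cvg_EFin; first exact: nearW.
    rewrite /comp/= indicE; have [->|qn] := pselect (q = q0 R).
      by rewrite mem_set//; under eq_fun do rewrite bump_q0 expr1n; exact: cvg_cst.
    rewrite memNset//; apply: cvg_expr; have /andP[b0 b1] := bump_itv q; rewrite ger0_norm// lt_neqAle b1 andbT.
    by apply/eqP => /bump_eq1.
  - exact: i1.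
  - apply: aeW => q n _; have /andP[b0 b1] := bump_itv q.
    by rewrite /= lee_fin ger0_norm ?exprn_ge0// exprn_ile1.
  by [].
rewrite integral_indic// setIC in ic.
have qO : @Omega R `&` [set q0 R] = [set q0 R] by apply/setIidr => q ->; exact: q0_Omega.
rewrite ?qO in ic.
have ic2 : (\int[Q]_(q in @Omega R) (bump q ^+ n)%:E)%E @[n --> \oo] --> (K_fold w / K)%:E.
  have : (limit_value w (fun q => bump q ^+ n) / K)%:E @[n --> \oo] --> (K_fold w / K)%:E.
    apply: cvg_EFin; first exact: nearW.
    by apply: cvgMl; exact: bump_limit_cvg.
  apply: cvg_trans; apply: near_eq_cvg; apply: nearW => n.
  rewrite -(limit_integral hQ (@within_bump n)) /Rintegral fineK//.
  apply: integrable_fin_num => //; exact: integrable_prob (@chart_bump n).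
exact: (cvg_unique (@ereal_hausdorff R) ic ic2).
Qed.

Lemma flat_constants : (forall q, Omega q -> w q = 1) ->
  K_reg w = pi / 2 * ln 3 /\ K_fold w = pi / 4 * ln 3.
Proof.
move=> w1; split; last by rewrite /K_fold w1 ?mulr1//; exact: q0_Omega.
rewrite (K_regE cw) /Rintegral.
transitivity (fine (pi / 2 * ln 3 : R)%:E) => //; rewrite -integral_cosecant; congr fine.
by apply: eq_integral => u _; rewrite /= w1 ?mulr1//; exact: chart_Omega.
Qed.

End WeakLimit.

Theorem proposition9p2 (R : realType) (w : torus3 R -> R)
    (w_C2 : C2 (@Omega R) w) (w_gt0 : forall q, Omega q -> 0 < w q) :
  [/\ forall psi : torus3 R -> R[i], {within @Omega R, continuous psi} ->
        exists2 e : R -> R[i], e z @[z --> +oo] --> (0 : R[i]) &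
          forall z, 0 < z ->
            Z w z psi = (z%:C)^-1 *
              ((2 * pi)%:C * Gamma_integralC (fun p => psi p * (w p)%:C / (J_X p)%:C)
               + (C_fold R)%:C * psi (q0 R) * (w (q0 R))%:C + e z),
      C_fold R = pi / 4 * ln 3,
      exists2 e : R -> R[i], e z @[z --> +oo] --> (0 : R[i]) &
        forall z, 0 < z ->
          Z w z (fun=> 1) = (z%:C)^-1 * ((K_reg w)%:C + (K_fold w)%:C + e z),
      [/\ exists P : R -> probability (torus3 R) R,
            forall z, 0 < z -> is_Pi w z (P z),
          exists Q : probability (torus3 R) R, is_Pi_infty w Q &
          forall (P : R -> probability (torus3 R) R) (Q : probability (torus3 R) R),
            (forall z, 0 < z -> is_Pi w z (P z)) -> is_Pi_infty w Q ->
            [/\ weak_cvg (@Omega R) P Q,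
                Q [set q0 R] = (K_fold w / (K_reg w + K_fold w))%:E,
                0 < K_fold w / (K_reg w + K_fold w) &
                (forall q, Omega q -> w q = 1) -> Q [set q0 R] = (1 / 3)%:E]] &
      (forall q, Omega q -> w q = 1) ->
        K_reg w = pi / 2 * ln 3 /\ K_fold w = pi / 4 * ln 3].
Proof.
have cw := C2_continuous_chart w_C2.
split.
- by move=> psi; exact: (Z_expansion cw w_gt0).
- exact: C_foldE.
- have c1 : {within @Omega R, continuous (fun=> 1 : R[i])}.
    by apply: continuous_subspaceT => q; exact: cvg_cst.
  have [e e0 eE] := Z_expansion cw w_gt0 c1; exists e => // z z0.
  by rewrite eE// limit_functional1.
- split.
  + have [P hP] := choice (gibbs_exists cw w_gt0).
    by exists P => z _; exact: hP.
  + exact: limit_measure.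
  + move=> P Q hP hQ; split.
    * exact: gibbs_weak_cvg hP hQ.
    * exact: limit_atom.
    * by rewrite divr_gt0 ?K_gt0 ?K_fold_gt0.
    * move=> w1; rewrite (limit_atom cw w_gt0 hQ).
      have [-> ->] := flat_constants cw w1; congr EFin.
      have l3 := ln3_gt0 (R := R); have := pi_gt0 R.
      move: (pi : R) (ln 3 : R) l3 => p l l0 p0.
      by field; rewrite !gt_eqF//; have := mulr_gt0 p0 l0; lra.
- exact: flat_constants.
Qed.
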